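(* Let $p\ge 4$ be even and let $\Theta_N$ be either $B_N=\{\pm1\}^N$ or $S_N=\{z\in\mathbb{R}^N:\|z\|_2^2=N\}$. Then there exist constants $\eta_{p,\mathrm{OGP}}<\eta_{p,\mathrm{OPT}}$, $0<\nu_1<\nu_2<1$ and $c>0$ such that, for all sufficiently large $N$, with probability at least $1-\exp(-cN)$ the following holds: for every $z_1,z_2\in\Theta_N$ with $\langle J,z_j^{\otimes p}\rangle\ge \eta_{p,\mathrm{OGP}}$ for $j=1,2$, $$\frac1N\,|\langle z_1,z_2\rangle|\notin(\nu_1,\nu_2).$$
   Context: $J$ is a random symmetric $N\times\cdots\times N$ ($p$-index) tensor: the entries $J_{i_1,\dots,i_p}$ with $1\le i_1<\dots<i_p\le N$ are i.i.d. centered Gaussian with variance $N^{-(p+1)}$, and $J_{i_{\sigma(1)},\dots,i_{\sigma(p)}}=J_{i_1,\dots,i_p}$ for every permutation $\sigma$. For $z\in\mathbb{R}^N$, $\langle J,z^{\otimes p}\rangle=\sum_{1\le i_1<\dots<i_p\le N}J_{i_1,\dots,i_p}z_{i_1}\cdots z_{i_p}$, and $\langle z_1,z_2\rangle=\sum_i (z_1)_i(z_2)_i$. $\eta_{p,\mathrm{OPT}}$ denotes the deterministic limit in probability, as $N\to\infty$, of $\max_{z\in\Theta_N}\langle J,z^{\otimes p}\rangle$ (which exists; its value depends on the choice of $\Theta_N$). *)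

(* Defs.v *)
From HB Require Import structures.
From mathcomp Require Import all_boot all_order all_algebra.
From mathcomp Require Import all_classical all_reals all_analysis.
Set Implicit Arguments. Unset Strict Implicit. Unset Printing Implicit Defensive.
Import Order.TTheory GRing.Theory Num.Theory.
Import numFieldNormedType.Exports.
Local Open Scope classical_set_scope.
Local Open Scope ring_scope.

(* Index set of the independent entries of a symmetric p-tensor on [N]:
   strictly increasing maps 'I_p -> 'I_N, i.e. tuples i_1 < ... < i_p. *)
Definition incr (p N : nat) (f : {ffun 'I_p -> 'I_N}) : bool :=
  [forall i : 'I_p, forall j : 'I_p, (i < j)%N ==> (f i < f j)%N].

Inductive domain := Ising (* B_N = {-1,1}^N *) | Spherical (* S_N *).

Definition inner (R : realType) (N : nat) (z1 z2 : 'I_N -> R) : R :=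
  \sum_(i < N) z1 i * z2 i.

Definition Theta (R : realType) (D : domain) (N : nat) : set ('I_N -> R) :=
  match D with
  | Ising => [set z | forall i, z i = 1 \/ z i = -1]
  | Spherical => [set z | inner z z = N%:R]
  end.
Arguments Theta : clear implicits.

Definition Hamil (R : realType) (p N : nat) (J : {ffun 'I_p -> 'I_N} -> R)
    (z : 'I_N -> R) : R :=
  \sum_(f | incr f) J f * \prod_(i < p) z (f i).

(* max_{z in Theta_N} <J, z^{\otimes p}> (the sup is attained: Theta_N is compact) *)
Definition maxH (R : realType) (D : domain) (p N : nat)
    (J : {ffun 'I_p -> 'I_N} -> R) : R :=
  sup [set Hamil J z | z in Theta R D N].

Definition sdev (R : realType) (p N : nat) : R :=
  Num.sqrt ((N%:R ^+ p.+1)^-1).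

Definition gaussian_disorder (R : realType) d (Omega : measurableType d)
    (P : probability Omega R) (p N : nat)
    (J : {ffun 'I_p -> 'I_N} -> Omega -> R) : Prop :=
  (forall f, incr f -> measurable_fun setT (J f)) /\
  (forall f, incr f -> forall B : set R, measurable B ->
       P (J f @^-1` B) = normal_prob 0 (sdev R p N) B) /\
  (forall B : {ffun 'I_p -> 'I_N} -> set R, (forall f, measurable (B f)) ->
       P (\bigcap_(f in [set f | incr f]) (J f @^-1` B f))
       = (\prod_(f | incr f) P (J f @^-1` B f))%E).

(* "E holds with probability at least r" (inner probability, so that no
   separate measurability claim on E is needed). *)
Definition prob_atleast (R : realType) d (Omega : measurableType d)
    (P : probability Omega R) (E : set Omega) (r : R) : Prop :=
  exists A : set Omega, measurable A /\ A `<=` E /\ (r%:E <= P A)%E.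

Definition is_eta_opt (R : realType) (D : domain) (p : nat) (eta : R) : Prop :=
  forall d (Omega : measurableType d) (P : probability Omega R)
         (J : forall N : nat, {ffun 'I_p -> 'I_N} -> Omega -> R),
    (forall N, gaussian_disorder P (J N)) ->
    forall eps : R, 0 < eps ->
      forall delta : R, 0 < delta ->
        exists N0 : nat, forall N : nat, (N0 <= N)%N ->
          prob_atleast P
            [set w | `|maxH D (fun f => J N f w) - eta| <= eps] (1 - delta).

(* Main.v *)
(** The overlap gap is obtained from Gaussian comparison in exponential-moment form, with Gaussian
    vectors replaced by sums of many Rademacher steps (the functional [gE]), for which the
    Sudakov-Fernique interpolation becomes an elementary one-step inequality.

    For pairs at overlap [r] in [[q, 2q]] the common disorder is compared with two independent
    copies plus linear fields of variance of order [q^(p-1)].  The overlap constraint is paid for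
    by a term [lam * (m - q/2) >= 0], where [m] is the clipped overlap; once the copies are
    independent, [m] may be gauged by random signs and so costs only a linear field of variance of
    order [lam^2].  A linear field of strength [th] raises the maximum by [O(th^2)] only, because
    it is dominated by an independent even tensor field.  Hence the maximum over such pairs is at
    most [2 eta - lam q / 2 + O(q^(p-1) + lam^2)], which is below [2 eta] for small [lam] and [q].
    On the sphere, random rotations first make all points flat, so that the missing diagonal
    entries of the tensor are negligible. *)
Require Import Defs.
From HB Require Import structures.
From mathcomp Require Import all_boot all_order all_algebra.
From mathcomp Require Import fingroup perm.
From mathcomp Require Import all_classical all_reals all_analysis.
From mathcomp Require Import measurable_realfun.
From mathcomp Require Import ring lra.
Import Order.TTheory GRing.Theory Num.Theory.
Import numFieldNormedType.Exports.
Set Implicit Arguments.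
Unset Strict Implicit.
Unset Printing Implicit Defensive.
Local Open Scope classical_set_scope.
Local Open Scope ring_scope.


(** * Second-order expansion of powers of partition functions *)
Section Expansion.
Context {R : realType}.
Implicit Types (v x : R).

(** All fields have variance O(1/N), so trading a comparison of covariances for one of increments
    costs O(s^2/N) in the exponent. With s = sig N this is O(sig s), while the overlap penalty gains
    s lam q / 2; [sig] is taken small last. The delicate point is that the linear fields must cost
    less than lam q. Estimated by their norm they would cost their strength, which contains lam K0
    for the clipping level K0 and is far too much; the quadratic bound costs q^(p-1) + lam^2 K0^2
    instead. Clipping is needed to make products of coordinates Lipschitz. Points with bounded
    eighth moments lose O(K0^-3) of overlap by it, so K0^3 q has to be of order 1. With t = 1/K0
    this makes q of order t^3, and balancing lam q against lam^2 K0^2 makes lam of order t^5. The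
    gain is then of order t^8, and q^(p-1) is O(t^9) because p - 1 >= 3. Evenness of p is what lets
    tensor fields ignore signs: it reduces |overlap| to overlap, and it forces a separate device for
    recovering signs when a linear field is dominated by a tensor field. *)

Lemma is_derive_bigsum (I : Type) (r : seq I) (f df : I -> R -> R) x :
  (forall i, is_derive x (1 : R) (f i) (df i x)) ->
  is_derive x (1 : R) (fun y => \sum_(i <- r) f i y) (\sum_(i <- r) df i x).
Proof.
move=> H; elim: r => [|i r IH].
  rewrite big_nil (_ : (fun y => _) = cst 0); last first.
    by apply/funext => y; rewrite big_nil.
  exact: is_derive_cst.
rewrite big_cons (_ : (fun y => _) = f i + (fun y => \sum_(i <- r) f i y)).
  exact: is_deriveD.
by apply/funext => y; rewrite big_cons.
Qed.

Lemma is_derive_mulcl (c : R) (f : R -> R) (df x : R) :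
  is_derive x (1 : R) f df -> is_derive x (1 : R) (fun y => c * f y) (c * df).
Proof.
move=> H; rewrite (_ : (fun y => _) = c \*: (f : R -> R)).
  by apply: is_derive_eq.
by apply/funext.
Qed.

Lemma is_derive_sqr (f : R -> R) (df x : R) :
  is_derive x (1 : R) f df -> is_derive x (1 : R) (fun y => f y ^+ 2) (2 * f x * df).
Proof.
move=> H; rewrite (_ : (fun y => _) = f * f); last by apply/funext => y; rewrite expr2.
by apply: (is_derive_eq (is_deriveM H H)); rewrite /GRing.scale/=; ring.
Qed.

(** The mean value theorem takes the place of an integral: each use gains one power of |v| and
    forgoes the factor 1/(k+1). Three uses give a third-order Taylor remainder. *)
Lemma growth_integrate (g dg : R -> R) (B K : R) (k : nat) :
  0 <= B -> 0 <= K -> (forall v, is_derive v (1 : R) g (dg v)) -> g 0 = 0 ->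
  (forall v, `|dg v| <= B * `|v| ^+ k * expR (K * `|v|)) ->
  forall v, `|g v| <= B * `|v| ^+ k.+1 * expR (K * `|v|).
Proof.
move=> B0 K0 Hg g0 Hdg v.
have cg a b : {within `[a, b], continuous g}.
  apply: continuous_subspaceT => x.
  by apply: differentiable_continuous; apply/derivable1_diffP; case: (Hg x).
have bnd c : `|c| <= `|v| -> `|dg c| <= B * `|v| ^+ k * expR (K * `|v|).
  move=> cv; apply: (le_trans (Hdg c)).
  apply: ler_pM; rewrite ?expR_ge0 ?mulr_ge0 ?exprn_ge0//.
    by rewrite ler_wpM2l// lerXn2r// nnegrE.
  by rewrite ler_expR ler_wpM2l.
rewrite exprSr mulrA mulrAC.
have [v0|v0] := leP 0 v.
  have [c /itvP cI e] := MVT_segment v0 (fun x _ => Hg x) (cg _ _).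
  move: e; rewrite g0 !subr0 => ->; rewrite normrM ler_wpM2r// bnd//.
  by rewrite !ger0_norm ?cI.
have [c /itvP cI e] := MVT_segment (ltW v0) (fun x _ => Hg x) (cg _ _).
move: e; rewrite g0 sub0r sub0r => /eqP; rewrite eqr_oppLR => /eqP ->.
rewrite !normrN normrM normrN ler_wpM2r// bnd//.
by rewrite !ler0_norm ?cI ?(ltW v0)// lerN2 cI.
Qed.

Variables (I J : finType) (m : J -> R) (p : J -> I -> R) (u : I -> R) (U : R).
Hypothesis p0 : forall j i, 0 <= p j i.
Hypothesis p1 : forall j, \sum_i p j i = 1.
Hypothesis uU : forall i, `|u i| <= U.

(** [rr k j v] is the k-th moment of [u] under the law proportional to p_j(i) e^{v u_i}. [F] is the
    product of the powers S_0^{m_j}, [A] its logarithmic derivative, and [A1], [A2] are the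
    derivatives of [A]. *)
Let S k j v := \sum_i p j i * u i ^+ k * expR (v * u i).
Let rr k j v := S k j v / S 0 j v.
Let A v := \sum_j m j * rr 1 j v.
Let A1 v := \sum_j m j * (rr 2 j v - rr 1 j v ^+ 2).
Let A2 v := \sum_j m j * (rr 3 j v - rr 1 j v * rr 2 j v
   - 2 * rr 1 j v * (rr 2 j v - rr 1 j v ^+ 2)).
Let F v := expR (\sum_j m j * ln (S 0 j v)).

Lemma expansion_mass_gt0 j v : 0 < \sum_i p j i * expR (v * u i).
Proof.
rewrite lt_neqAle sumr_ge0 => [|i _]; last by rewrite mulr_ge0// expR_ge0.
rewrite andbT eq_sym; apply/negP => /eqP/psumr_eq0P H.
have : \sum_i p j i = 0.
  apply: big1 => i _; have /eqP := H (fun i _ => mulr_ge0 (p0 j i) (expR_ge0 _)) i isT.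
  by rewrite mulf_eq0 expR_eq0 orbF => /eqP.
by rewrite p1 => /eqP; rewrite oner_eq0.
Qed.

Let S0E j v : S 0 j v = \sum_i p j i * expR (v * u i).
Proof. by apply: eq_bigr => i _; rewrite expr0 mulr1. Qed.

Let S0_gt0 j v : 0 < S 0 j v.
Proof. by rewrite S0E expansion_mass_gt0. Qed.

Let dS k j v : is_derive v (1 : R) (S k j) (S k.+1 j v).
Proof.
apply: (@is_derive_bigsum _ _ _
  (fun i v => p j i * u i ^+ k.+1 * expR (v * u i)) _) => i.
have H : is_derive v (1 : R) (fun y => expR (y * u i)) (u i * expR (v * u i)).
  rewrite mulrC; apply: (is_derive1_comp (g := fun y => y * u i)).
  rewrite (_ : (fun y => _) = (fun y => u i * y)).
    by rewrite -[X in is_derive _ _ _ X]mulr1; exact: is_derive_mulcl.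
  by apply/funext => y; rewrite mulrC.
apply: (is_derive_eq (is_derive_mulcl (p j i * u i ^+ k) H)).
by rewrite exprSr; ring.
Qed.

Let drr k j v : is_derive v (1 : R) (rr k j) (rr k.+1 j v - rr k j v * rr 1 j v).
Proof.
have n0 : S 0 j v != 0 by rewrite gt_eqF.
have H := is_deriveM (dS k j v) (is_deriveV n0 (dS 0 j v)).
apply: (is_derive_eq H).
by rewrite /rr /GRing.scale/=; field.
Qed.

Let dF v : is_derive v (1 : R) F (F v * A v).
Proof.
apply: is_derive1_comp.
apply: (@is_derive_bigsum _ _ _ (fun j v => m j * rr 1 j v) _) => j.
apply: is_derive_mulcl; rewrite /rr mulrC.
exact: (is_derive1_comp (is_derive1_ln (S0_gt0 j v)) (dS 0 j v)).
Qed.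

Let dA v : is_derive v (1 : R) A (A1 v).
Proof.
apply: (@is_derive_bigsum _ _ _
  (fun j v => m j * (rr 2 j v - rr 1 j v ^+ 2)) _) => j.
by rewrite expr2; exact: is_derive_mulcl.
Qed.

Let dA1 v : is_derive v (1 : R) A1 (A2 v).
Proof.
apply: (@is_derive_bigsum _ _ _
  (fun j v => m j * (rr 3 j v - rr 1 j v * rr 2 j v
   - 2 * rr 1 j v * (rr 2 j v - rr 1 j v ^+ 2))) _) => j.
apply: is_derive_mulcl.
apply: (is_derive_eq (is_deriveB (drr 2 j v) (is_derive_sqr (drr 1 j v)))).
by ring.
Qed.

Let rr_bound k j v : `|rr k j v| <= U ^+ k.
Proof.
rewrite normrM normfV (gtr0_norm (S0_gt0 j v)) ler_pdivrMr//.
apply: (le_trans (ler_norm_sum _ _ _)); rewrite S0E mulr_sumr.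
apply: ler_sum => i _; rewrite !normrM (ger0_norm (p0 _ _)) (ger0_norm (expR_ge0 _)).
rewrite mulrAC [leRHS]mulrC ler_wpM2l ?mulr_ge0 ?expR_ge0// normrX lerXn2r ?nnegrE//.
exact: le_trans (uU i).
Qed.

Variable (Mm : R).
Hypothesis mM : \sum_j `|m j| <= Mm.
Hypothesis U1 : 1 <= U.

Let U_ge0 : 0 <= U. Proof. exact: le_trans U1. Qed.
Let Mm_ge0 : 0 <= Mm.
Proof. by apply: le_trans mM; apply: sumr_ge0. Qed.

Let wsum_bound (f : J -> R) (C : R) : 0 <= C -> (forall j, `|f j| <= C) ->
  `|\sum_j m j * f j| <= Mm * C.
Proof.
move=> C0 fC; apply: (le_trans (ler_norm_sum _ _ _)).
apply: (le_trans _ (ler_wpM2r C0 mM)); rewrite mulr_suml.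
by apply: ler_sum => j _; rewrite normrM ler_wpM2l.
Qed.

Let A_bound v : `|A v| <= Mm * U.
Proof. by apply: wsum_bound => // j; rewrite -[leRHS]expr1. Qed.

Let A1_bound v : `|A1 v| <= Mm * (2 * U ^+ 2).
Proof.
apply: wsum_bound => [|j]; first by rewrite mulr_ge0 ?exprn_ge0.
apply: (le_trans (ler_normB _ _)); rewrite mulr2n mulrDl mul1r lerD//.
by rewrite normrX lerXn2r ?nnegrE// -[leRHS]expr1.
Qed.

Let A2_bound v : `|A2 v| <= Mm * (6 * U ^+ 3).
Proof.
apply: wsum_bound => [|j]; first by rewrite mulr_ge0 ?exprn_ge0.
have H1 := rr_bound 1 j v; have H2 := rr_bound 2 j v; have H3 := rr_bound 3 j v.
rewrite expr1 in H1.
have H4 : `|rr 1 j v ^+ 2| <= U ^+ 2 by rewrite normrX lerXn2r ?nnegrE.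
apply: (le_trans (ler_normB _ _)).
rewrite (_ : 6 * U ^+ 3 = U ^+ 3 + U * U ^+ 2 + 2 * U * (U ^+ 2 + U ^+ 2)); last by ring.
apply: lerD.
  by apply: (le_trans (ler_normB _ _)); rewrite lerD// normrM ler_pM.
rewrite normrM; apply: ler_pM => //.
  by rewrite normrM ger0_norm// ler_wpM2l.
by apply: (le_trans (ler_normB _ _)); rewrite lerD.
Qed.

Let lnS_bound j v : `|ln (S 0 j v)| <= U * `|v|.
Proof.
have E i : `|v * u i| <= U * `|v| by rewrite normrM mulrC ler_wpM2r.
rewrite ler_norml; apply/andP; split.
  rewrite -[leLHS]expRK ler_ln ?posrE ?expR_gt0// S0E.
  rewrite -[leLHS]mul1r -(p1 j) mulr_suml; apply: ler_sum => i _.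
  by rewrite ler_wpM2l// ler_expR; have := E i; rewrite ler_norml => /andP[].
rewrite -[leRHS]expRK ler_ln ?posrE ?expR_gt0// S0E.
rewrite -[leRHS]mul1r -(p1 j) mulr_suml; apply: ler_sum => i _.
by rewrite ler_wpM2l// ler_expR; have := E i; rewrite ler_norml => /andP[].
Qed.

Let F_bound v : F v <= expR (Mm * U * `|v|).
Proof.
rewrite ler_expR; apply: (le_trans (ler_norm _)); rewrite -mulrA.
by apply: wsum_bound => [|j]; [rewrite mulr_ge0|exact: lnS_bound].
Qed.

Lemma power_growth v : expR (\sum_j m j * ln (\sum_i p j i * expR (v * u i)))
  <= expR (Mm * U * `|v|).
Proof.
by apply: le_trans (F_bound v); rewrite /F; under [X in _ <= expR X]eq_bigr do rewrite S0E.
Qed.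

(** Bounds A^3 + 3 A A1 + A2, which is F'''/F, through |A| <= Mm U, |A1| <= 2 Mm U^2 and |A2| <= 6
    Mm U^3. *)
Definition expansion_cst : R := (Mm ^+ 3 + 6 * Mm ^+ 2 + 6 * Mm) * U ^+ 3.

Lemma expansion_cst_ge0 : 0 <= expansion_cst.
Proof. by rewrite mulr_ge0 ?addr_ge0 ?mulr_ge0 ?exprn_ge0. Qed.

(** Taylor's formula with F' = F A, F'' = F (A^2 + A1), F''' = F (A^3 + 3 A A1 + A2): the bound on
    F''' is integrated three times, each intermediate function being corrected so as to vanish at
    0. *)
Lemma power_expansion_aux v :
  `|F v - 1 - v * A 0 - v ^+ 2 * ((A1 0 + A 0 ^+ 2) / 2)|
    <= expansion_cst * `|v| ^+ 3 * expR (Mm * U * `|v|).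
Proof.
have MU : 0 <= Mm * U by rewrite mulr_ge0.
have F0 : F 0 = 1.
  rewrite /F big1 ?expR0// => j _; rewrite S0E.
  under eq_bigr do rewrite mul0r expR0 mulr1.
  by rewrite p1 ln1 mulr0.
pose b := (A1 0 + A 0 ^+ 2) / 2.
have dF2 w : is_derive w (1 : R) (fun y => F y * (A y ^+ 2 + A1 y) - 2 * b)
    (F w * (A w ^+ 3 + 3 * A w * A1 w + A2 w)).
  have H := is_deriveB (is_deriveM (dF w) (is_deriveD (is_derive_sqr (dA w)) (dA1 w)))
     (is_derive_cst (2 * b) w 1).
  by apply: (is_derive_eq H); rewrite /GRing.scale/= ?fctE/= subr0; ring.
have dF1 w : is_derive w (1 : R) (fun y => F y * A y - A 0 - 2 * b * y)
    (F w * (A w ^+ 2 + A1 w) - 2 * b).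
  have H := is_deriveB (is_deriveB (is_deriveM (dF w) (dA w)) (is_derive_cst (A 0) w 1))
     (is_derive_mulcl (2 * b) (is_derive_id w (1 : R))).
  by apply: (is_derive_eq H); rewrite /GRing.scale/= ?fctE/= subr0; ring.
have dF0 w : is_derive w (1 : R) (fun y => F y - 1 - A 0 * y - b * y ^+ 2)
    (F w * A w - A 0 - 2 * b * w).
  have H := is_deriveB (is_deriveB (is_deriveB (dF w) (is_derive_cst (1 : R) w 1))
     (is_derive_mulcl (A 0) (is_derive_id w (1 : R))))
     (is_derive_mulcl b (is_derive_sqr (is_derive_id w (1 : R)))).
  by apply: (is_derive_eq H); rewrite /GRing.scale/= ?fctE/= subr0; ring.
rewrite (_ : F v - _ - _ - _ = F v - 1 - A 0 * v - b * v ^+ 2); last by rewrite /b; ring.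
apply: (growth_integrate expansion_cst_ge0 MU dF0).
  by rewrite F0; ring.
apply: (growth_integrate expansion_cst_ge0 MU dF1).
  by rewrite F0; ring.
apply: (growth_integrate (k := 0) expansion_cst_ge0 MU dF2).
  by rewrite F0 /b; field.
move=> w; rewrite expr0 mulr1 normrM (ger0_norm (expR_ge0 _)) mulrC.
apply: ler_pM; rewrite ?expR_ge0//; last exact: F_bound.
have a1 := A_bound w; have a2 := A1_bound w; have a3 := A2_bound w.
apply: (le_trans (ler_normD _ _)).
apply: (le_trans (lerD (ler_normD _ _) (lexx _))).
rewrite (_ : expansion_cst = (Mm * U) ^+ 3 + 3 * (Mm * U) * (Mm * (2 * U ^+ 2))
   + Mm * (6 * U ^+ 3)); last by rewrite /expansion_cst; ring.
rewrite !lerD//; first by rewrite normrX lerXn2r ?nnegrE.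
by rewrite !normrM (ger0_norm (_ : 0 <= 3)) ?ler_pM ?mulr_ge0.
Qed.

(* The coefficient of the second-order term as a quadratic form in the direction. *)
Definition hess_coef (i i' : I) : R :=
  (\sum_j m j * ((i == i')%:R * p j i - p j i * p j i')
   + \sum_j \sum_j' m j * m j' * (p j i * p j' i')) / 2.

Lemma power_expansion v :
  `|expR (\sum_j m j * ln (\sum_i p j i * expR (v * u i))) - 1
     - v * (\sum_j m j * \sum_i p j i * u i)
     - v ^+ 2 * (\sum_i \sum_i' hess_coef i i' * (u i * u i'))|
    <= expansion_cst * `|v| ^+ 3 * expR (Mm * U * `|v|).
Proof.
have := power_expansion_aux v.
have r0 k j : rr k j 0 = \sum_i p j i * u i ^+ k.
  rewrite /rr S0E; under [X in _ / X]eq_bigr do rewrite mul0r expR0 mulr1.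
  rewrite p1 divr1; apply: eq_bigr => i _.
  by rewrite mul0r expR0 mulr1.
have AE : A 0 = \sum_j m j * \sum_i p j i * u i.
  by apply: eq_bigr => j _; rewrite r0; under eq_bigr do rewrite expr1.
have FE : F v = expR (\sum_j m j * ln (\sum_i p j i * expR (v * u i))).
  by congr expR; apply: eq_bigr => j _; rewrite S0E.
have -> : (A1 0 + A 0 ^+ 2) / 2 = \sum_i \sum_i' hess_coef i i' * (u i * u i').
  transitivity (\sum_i \sum_i' ((\sum_j m j * ((i == i')%:R * p j i - p j i * p j i')) * (u i * u i')
      + (\sum_j \sum_j' m j * m j' * (p j i * p j' i')) * (u i * u i')) / 2); last first.
    by apply: eq_bigr => i _; apply: eq_bigr => i' _; rewrite /hess_coef; ring.
  under eq_bigr do rewrite -mulr_suml big_split/=.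
  rewrite -mulr_suml big_split/=; congr ((_ + _) / 2).
    under eq_bigr do (under eq_bigr do rewrite mulr_suml; rewrite exchange_big/=).
    rewrite exchange_big/=; apply: eq_bigr => j _.
    rewrite !r0 expr2 mulrBr big_distrlr/= !mulr_sumr -sumrB; apply: eq_bigr => i _.
    under [RHS]eq_bigr do rewrite mulrBr mulrBl.
    rewrite [RHS]sumrB; congr (_ - _).
      rewrite (bigD1 i)//= eqxx big1 => [|i' /negbTE ne]; last first.
        by rewrite eq_sym ne mul0r mulr0 mul0r.
      by rewrite addr0 (_ : true%:R = 1)//; ring.
    by rewrite mulr_sumr; apply: eq_bigr => i' _; rewrite !expr1; ring.
  rewrite AE expr2 big_distrlr/=.
  under [RHS]eq_bigr do (under eq_bigr do rewrite mulr_suml; rewrite exchange_big/=).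
  rewrite [RHS]exchange_big/=; apply: eq_bigr => j _.
  under [RHS]eq_bigr do (under eq_bigr do rewrite mulr_suml; rewrite exchange_big/=).
  rewrite [RHS]exchange_big/=; apply: eq_bigr => j' _.
  rewrite mulrACA big_distrlr/= mulr_sumr; apply: eq_bigr => i _.
  by rewrite mulr_sumr; apply: eq_bigr => i' _; ring.
by rewrite AE FE.
Qed.

End Expansion.

(** * Random-walk expectations *)
Section Walk.
Context {R : realType}.
Section OneSpace.
Context {V : lmodType R}.
Implicit Types (u x y : V) (us vs : seq V) (F G : V -> R) (n : nat).

Definition halfstep u F x : R := (F (x + u) + F (x - u)) / 2.

Definition step us F : V -> R := foldr halfstep F us.

(* The expectation of [F (\sum_k g_k u_k)], where the [g_k] are independent copies
   of a sum of [n] Rademacher variables divided by [sqrt n]. *)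
Definition gE n us F : R :=
  iter n (step [seq (Num.sqrt n%:R)^-1 *: u | u <- us]) F 0.

Lemma halfstepC u v F : halfstep u (halfstep v F) = halfstep v (halfstep u F).
Proof.
apply/funext => x; rewrite /halfstep.
rewrite -!(addrA x) (addrC v u) (addrC (- v) u) (addrC v (- u)) (addrC (- v) (- u)).
by ring.
Qed.

Lemma step_cat us vs F : step (us ++ vs) F = step us (step vs F).
Proof. by rewrite /step foldr_cat. Qed.

Lemma step_halfC us v F : step us (halfstep v F) = halfstep v (step us F).
Proof. by elim: us => //= u us ->; rewrite halfstepC. Qed.

Lemma stepC us vs F : step us (step vs F) = step vs (step us F).
Proof. by elim: vs => //= v vs <-; rewrite step_halfC. Qed.

Lemma iter_stepC n k us vs F :
  iter n (step us) (iter k (step vs) F) = iter k (step vs) (iter n (step us) F).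
Proof.
have H j G : iter j (step us) (step vs G) = step vs (iter j (step us) G).
  by elim: j => //= j ->; rewrite stepC.
by elim: k => //= k IH; rewrite H IH.
Qed.

Lemma iter_step_cat n us vs F :
  iter n (step (us ++ vs)) F = iter n (step us) (iter n (step vs) F).
Proof.
elim: n => //= n ->; rewrite step_cat; congr (step us _).
exact: (iter_stepC 1 n vs us).
Qed.

Lemma step_shift us F x : step us (fun y => F (x + y)) = (fun y => step us F (x + y)).
Proof.
by elim: us => //= u us ->; apply/funext => y; rewrite /halfstep -!addrA.
Qed.

Lemma iter_step_shift n us F x :
  iter n (step us) (fun y => F (x + y)) = (fun y => iter n (step us) F (x + y)).
Proof. by elim: n => //= n ->; rewrite step_shift. Qed.

Lemma gE_shift n us F x : gE n us (fun y => F (x + y)) =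
  iter n (step [seq (Num.sqrt n%:R)^-1 *: u | u <- us]) F x.
Proof. by rewrite /gE iter_step_shift addr0. Qed.

Lemma gE_cat n us vs F :
  gE n (us ++ vs) F = gE n us (fun x => gE n vs (fun y => F (x + y))).
Proof.
rewrite {1}/gE map_cat iter_step_cat; congr (iter n _ _ 0).
by apply/funext => x; rewrite gE_shift.
Qed.

Lemma gE_catC n us vs F : gE n (us ++ vs) F = gE n (vs ++ us) F.
Proof. by rewrite /gE !map_cat !iter_step_cat iter_stepC. Qed.

Lemma halfstep_le u F G : (forall x, F x <= G x) ->
  forall x, halfstep u F x <= halfstep u G x.
Proof. by move=> FG x; rewrite ler_pM2r// lerD. Qed.

Lemma step_le us F G : (forall x, F x <= G x) -> forall x, step us F x <= step us G x.
Proof. by move=> FG; elim: us => //= u us IH; exact: halfstep_le. Qed.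

Lemma iter_step_le n us F G : (forall x, F x <= G x) ->
  forall x, iter n (step us) F x <= iter n (step us) G x.
Proof. by move=> FG; elim: n => //= n IH; exact: step_le. Qed.

Lemma gE_le n us F G : (forall x, F x <= G x) -> gE n us F <= gE n us G.
Proof. by move=> FG; exact: iter_step_le. Qed.

Lemma step_lin us (a b : R) F G :
  step us (fun x => a * F x + b * G x) = (fun x => a * step us F x + b * step us G x).
Proof.
elim: us => //= u us ->; apply/funext => x; rewrite /halfstep.
by ring.
Qed.

Lemma step_mull us (a : R) F : step us (fun x => a * F x) = (fun x => a * step us F x).
Proof.
by elim: us => //= u us ->; apply/funext => x; rewrite /halfstep; ring.
Qed.

Lemma iter_step_mull n us (a : R) F :
  iter n (step us) (fun x => a * F x) = (fun x => a * iter n (step us) F x).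
Proof. by elim: n => //= n ->; rewrite step_mull. Qed.

(* A one-step inequality iterates because all the step operators commute. *)
Lemma iter_step_compare n us vs (a : R) F : 0 <= a ->
  (forall x, step us F x <= a * step vs F x) ->
  forall x, iter n (step us) F x <= a ^+ n * iter n (step vs) F x.
Proof.
move=> a0 H; elim: n => [|n IH] x; first by rewrite expr0 mul1r.
rewrite iterS; apply: (le_trans (step_le _ IH x)).
rewrite step_mull exprSr -mulrA ler_wpM2l ?exprn_ge0//.
rewrite -[step us (iter n _ _)]/(iter 1 (step us) (iter n (step vs) F)) iter_stepC.
have -> : a * iter n.+1 (step vs) F x = iter n (step vs) (fun y => a * step vs F y) x.
  by rewrite iterSr iter_step_mull.
exact: iter_step_le.
Qed.

Lemma gE_lin n us (a b : R) F G :
  gE n us (fun x => a * F x + b * G x) = a * gE n us F + b * gE n us G.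
Proof.
rewrite /gE; move: (map _ _) => vs.
have -> // : iter n (step vs) (fun x => a * F x + b * G x) =
  fun x => a * iter n (step vs) F x + b * iter n (step vs) G x.
by elim: n => //= n ->; rewrite step_lin.
Qed.

Lemma gE_cst n us (c : R) : gE n us (fun _ => c) = c.
Proof.
rewrite /gE; move: (map _ _) => vs.
have H : step vs (fun _ => c) = fun _ => c.
  by elim: vs => //= v vs ->; apply/funext => x; rewrite /halfstep; field.
by have -> : iter n (step vs) (fun _ => c) = (fun _ => c) by elim: n => //= k ->.
Qed.

Lemma gE_mull n us (a : R) F : gE n us (fun x => a * F x) = a * gE n us F.
Proof.
have := gE_lin n us a 0 F (fun _ => 0); rewrite [0 * gE _ _ _]mul0r addr0 => <-.
by congr gE; apply/funext => x; rewrite mul0r addr0.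
Qed.

Lemma gE_add n us F G : gE n us (fun x => F x + G x) = gE n us F + gE n us G.
Proof.
have := gE_lin n us 1 1 F G; rewrite !mul1r => <-.
by congr gE; apply/funext => x; rewrite !mul1r.
Qed.

Lemma gE_sum n us (T : Type) (r : seq T) (F : T -> V -> R) :
  gE n us (fun x => \sum_(t <- r) F t x) = \sum_(t <- r) gE n us (F t).
Proof.
elim: r => [|t r IH].
  rewrite big_nil -[RHS](gE_cst n us 0); congr gE; apply/funext => x.
  by rewrite big_nil.
rewrite big_cons -IH -gE_add; congr gE; apply/funext => x.
by rewrite big_cons.
Qed.

Lemma gE_ge0 n us F : (forall x, 0 <= F x) -> 0 <= gE n us F.
Proof. by move=> F0; rewrite -(gE_cst n us 0); exact: gE_le. Qed.

Lemma gE_nil n F : gE n [::] F = F 0.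
Proof. by rewrite /gE /=; elim: n => //= n; rewrite /step. Qed.

End OneSpace.

Lemma step_map {V W : lmodType R} (L : V -> W) (us : seq V) (F : W -> R) :
  (forall x y, L (x + y) = L x + L y) ->
  step us (F \o L) = step (map L us) F \o L.
Proof.
move=> LD.
have LN x : L (- x) = - L x.
  have L0 : L 0 = 0 by apply: (addrI (L 0)); rewrite -LD !addr0.
  by apply: (addrI (L x)); rewrite -LD !subrr.
elim: us => //= u us ->; apply/funext => x.
by rewrite /halfstep /= !LD LN.
Qed.

Lemma gE_map {V W : lmodType R} n (L : V -> W) (us : seq V) (F : W -> R) :
  (forall x y, L (x + y) = L x + L y) -> (forall (a : R) x, L (a *: x) = a *: L x) ->
  gE n us (F \o L) = gE n (map L us) F.
Proof.
move=> LD LZ.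
have L0 : L 0 = 0 by apply: (addrI (L 0)); rewrite -LD !addr0.
rewrite /gE; set us' := map _ _; set vs' := map _ (map _ _).
have e : vs' = map L us'.
  by rewrite /vs' /us' -!map_comp; apply: eq_map => u /=; rewrite LZ.
rewrite e -[in RHS]L0.
have H k ws : iter k (step ws) (F \o L) = iter k (step (map L ws)) F \o L.
  by elim: k => //= k ->; rewrite step_map.
by rewrite H.
Qed.

End Walk.

(** * One-step comparison *)
Section OneStep.
Context {R : realType}.

Lemma large_invsqrt (r0 : R) : 0 < r0 ->
  exists n0, forall n, (n0 <= n)%N -> (0 < n)%N /\ (Num.sqrt n%:R)^-1 <= r0.
Proof.
move=> r00; exists (Num.truncn (r0 ^- 2)).+1 => n nn0.
have n0 : (0 < n)%N by exact: leq_trans nn0.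
split=> //; rewrite -(invrK r0) lef_pV2 ?posrE ?invr_gt0 ?sqrtr_gt0 ?ltr0n//.
rewrite -(@ler_pXn2r _ 2) ?nnegrE ?invr_ge0 ?sqrtr_ge0 ?(ltW r00)//.
rewrite sqr_sqrtr ?ler0n// exprVn; apply: ltW; apply: lt_le_trans (truncnS_gt _) _.
by rewrite ler_nat.
Qed.

(** The slack [eps] at order r^2 absorbs both cubic remainders for small r. Keeping the loss in the
    exponent lets n steps with r^2 = 1/n multiply to [expR (c + eps)]. *)
Lemma second_order_compare (K Bd c eps : R) : 0 <= K -> 0 <= Bd -> 0 <= c -> 0 < eps ->
  exists2 r0 : R, 0 < r0 <= 1 & forall r q1 q2 : R, 0 < r <= r0 ->
    q1 <= q2 + c -> `|q2| <= Bd ->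
    1 + r ^+ 2 * q1 + K * r ^+ 3 <=
      expR (r ^+ 2 * (c + eps)) * (1 + r ^+ 2 * q2 - K * r ^+ 3).
Proof.
move=> K0 Bd0 c0 e0.
(* [L] collects the coefficients of r^3: two remainders, then the product of the exponent with the
   lower-order part of the bracket; the last [Bd + K + 1] keeps that bracket nonnegative. *)
pose L := 2 * K + (c + eps) * (Bd + K) + (Bd + K) + 1.
have L0 : 0 < L.
  by rewrite /L; have := mulr_ge0 (addr_ge0 c0 (ltW e0)) (addr_ge0 Bd0 K0); lra.
pose r0 := Num.min 1 (Num.min eps 1 / L).
have r00 : 0 < r0 <= 1 by rewrite lt_min ltr01 divr_gt0 ?ge_min ?lexx// lt_min e0 ltr01.
exists r0 => // r q1 q2 /andP[r_gt0 rr] q12 qb.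
have r_le1 : r <= 1 by apply: (le_trans rr); rewrite ge_min lexx.
have rL : r * L <= Num.min eps 1.
  by rewrite -ler_pdivlMr// (le_trans rr)// ge_min lexx orbT.
have rLe : r * L <= eps by apply: (le_trans rL); rewrite ge_min lexx.
have rL1 : r * L <= 1 by apply: (le_trans rL); rewrite ge_min lexx orbT.
have r2 : r ^+ 2 <= r by rewrite expr2 ler_piMr ?(ltW r_gt0).
have r20 : 0 <= r ^+ 2 by rewrite exprn_ge0 ?(ltW r_gt0).
move: qb; rewrite ler_norml => /andP[q2l q2u].
have KB : 0 <= Bd + K by rewrite addr_ge0.
have ce : 0 <= c + eps by rewrite addr_ge0 ?(ltW e0).
have rest : r * (Bd + K) <= r * L.
  rewrite ler_wpM2l ?(ltW r_gt0)// /L; have := mulr_ge0 ce KB; lra.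
have fac0 : 0 <= 1 + r ^+ 2 * q2 - K * r ^+ 3.
  have h1 : r ^+ 2 * (- Bd) <= r ^+ 2 * q2 by rewrite ler_wpM2l.
  have h2 : K * r ^+ 3 <= K * r.
    by rewrite ler_wpM2l// exprS ler_piMr ?(ltW r_gt0)// (le_trans r2).
  have h3 : r ^+ 2 * Bd <= r * Bd by rewrite ler_wpM2r.
  nra.
apply: (le_trans _ (ler_wpM2r fac0 (expR_ge1Dx _))).
have key : 2 * K * r + r * ((c + eps) * (Bd + K)) <= eps.
  have := mulr_ge0 (ltW r_gt0) KB.
  by move: rLe; rewrite /L; lra.
have h4 : r ^+ 2 * q1 <= r ^+ 2 * (q2 + c) by rewrite ler_wpM2l.
have h5 : r ^+ 2 * (2 * K * r + r * ((c + eps) * (Bd + K))) <= r ^+ 2 * eps.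
  by rewrite ler_wpM2l.
have h6 : - (r * (Bd + K)) <= r ^+ 2 * q2 - K * r ^+ 3.
  have h1 : r ^+ 2 * (- Bd) <= r ^+ 2 * q2 by rewrite ler_wpM2l.
  have h2 : K * r ^+ 3 <= K * r.
    by rewrite ler_wpM2l// exprS ler_piMr ?(ltW r_gt0)// (le_trans r2).
  have h3 : r ^+ 2 * Bd <= r * Bd by rewrite ler_wpM2r.
  lra.
have h7 : r ^+ 2 * (c + eps) * (- (r * (Bd + K))) <=
    r ^+ 2 * (c + eps) * (r ^+ 2 * q2 - K * r ^+ 3).
  by rewrite ler_wpM2l// mulr_ge0.
have e3 : r ^+ 3 = r ^+ 2 * r by rewrite exprSr.
rewrite e3 in h7 *; lra.
Qed.

Lemma vaddE (I : Type) (x y : I -> R) i : (x + y) i = x i + y i. Proof. by []. Qed.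
Lemma voppE (I : Type) (x : I -> R) i : (- x) i = - x i. Proof. by []. Qed.
Lemma vscaleE (I : Type) (a : R) (x : I -> R) i : (a *: x) i = a * x i. Proof. by []. Qed.

Section Fixed.
Context {I J : finType}.
Implicit Types (x y u : I -> R) (us vs : seq (I -> R)).

Definition cov us (i i' : I) : R := \sum_(u <- us) u i * u i'.

(** Sup bound on one step: steps of the walk are bounded, so an estimate near the current point
    suffices ([step_le_on]). *)
Definition l1 us (i : I) : R := \sum_(u <- us) `|u i|.

Lemma cov_cat us vs i i' : cov (us ++ vs) i i' = cov us i i' + cov vs i i'.
Proof. by rewrite /cov big_cat. Qed.

Lemma cov_scale (a : R) us i i' : cov [seq a *: u | u <- us] i i' = a ^+ 2 * cov us i i'.
Proof.
rewrite /cov big_map mulr_sumr; apply: eq_bigr => u _.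
by rewrite !vscaleE; ring.
Qed.

Lemma l1_ge0 us i : 0 <= l1 us i.
Proof. by apply: sumr_ge0. Qed.

Lemma l1_cat us vs i : l1 (us ++ vs) i = l1 us i + l1 vs i.
Proof. by rewrite /l1 big_cat. Qed.

Lemma cov_l1 us (A : R) i i' : (forall i, l1 us i <= A) -> `|cov us i i'| <= A ^+ 2.
Proof.
move=> H; rewrite expr2; apply: le_trans (ler_pM _ _ (H i) (H i')); rewrite ?l1_ge0//.
rewrite /l1 big_distrlr/=; apply: (le_trans (ler_norm_sum _ _ _)).
elim: us {H} => [|u us IH]; first by rewrite !big_nil.
rewrite !big_cons normrM -addrA lerD2l.
apply: le_trans IH _; rewrite ler_wpDl//.
  by apply: sumr_ge0 => v _; rewrite mulr_ge0.
by apply: ler_sum => v _; rewrite big_cons ler_wpDl ?mulr_ge0.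
Qed.

Lemma step_moments us (c : R) (a : I -> R) (B : I -> I -> R) x :
  step us (fun y => c + \sum_i a i * y i + \sum_i \sum_i' B i i' * (y i * y i')) x =
  c + \sum_i a i * x i + \sum_i \sum_i' B i i' * (x i * x i')
    + \sum_i \sum_i' B i i' * cov us i i'.
Proof.
elim: us x => [|u us IH] x /=.
  rewrite [X in _ = _ + X]big1 ?addr0// => i _.
  by rewrite big1// => i' _; rewrite /cov big_nil mulr0.
rewrite /halfstep !IH.
rewrite (_ : \sum_i \sum_i' B i i' * cov (u :: us) i i' =
   \sum_i \sum_i' B i i' * (u i * u i') + \sum_i \sum_i' B i i' * cov us i i'); last first.
  rewrite -big_split/=; apply: eq_bigr => i _; rewrite -big_split/=.
  by apply: eq_bigr => i' _; rewrite /cov big_cons mulrDr.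
have e1 : \sum_i a i * (x + u) i + \sum_i a i * (x - u) i = 2 * \sum_i a i * x i.
  rewrite -big_split mulr_sumr/=; apply: eq_bigr => i _.
  by rewrite !vaddE ?voppE; ring.
have e2 : \sum_i \sum_i' B i i' * ((x + u) i * (x + u) i')
  + \sum_i \sum_i' B i i' * ((x - u) i * (x - u) i') =
  2 * \sum_i \sum_i' B i i' * (x i * x i') + 2 * \sum_i \sum_i' B i i' * (u i * u i').
  rewrite -mulrDr -!big_split mulr_sumr/=; apply: eq_bigr => i _.
  rewrite -!big_split mulr_sumr/=; apply: eq_bigr => i' _.
  by rewrite !vaddE ?voppE; ring.
move: e1 e2; set a1 := \sum_i a i * (x + u) i; set a2 := \sum_i a i * (x - u) i.
set b1 := \sum_i \sum_i' B i i' * ((x + u) i * (x + u) i').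
set b2 := \sum_i \sum_i' B i i' * ((x - u) i * (x - u) i').
by move=> e1 e2; lra.
Qed.

Lemma step_le_on us (F G : (I -> R) -> R) x :
  (forall y, (forall i, `|y i| <= l1 us i) -> F (x + y) <= G (x + y)) ->
  step us F x <= step us G x.
Proof.
elim: us x => [|u us IH] x /= H.
  by have := H 0; rewrite addr0; apply => i; rewrite normr0 l1_ge0.
rewrite ler_pM2r// lerD//; apply: IH => y Hy; rewrite -addrA; apply: H => i.
  rewrite /l1 big_cons; apply: (le_trans (ler_normD _ _)); rewrite lerD2l.
  exact: Hy.
rewrite /l1 big_cons; apply: (le_trans (ler_normD _ _)).
by rewrite [X in `|X| + _](_ : _ = - u i)// normrN lerD2l; exact: Hy.
Qed.

Variables (m : J -> R) (W : J -> I -> R).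
Hypothesis W0 : forall j i, 0 <= W j i.
Hypothesis W1 : forall j, exists i, 0 < W j i.

Definition partition_fun j x : R := \sum_i W j i * expR (x i).

(** Exponents of both signs and one weight vector per factor let a single expansion serve the
    smoothed maximum (one factor, small exponent) as well as the ratio of two independent partition
    functions behind concentration. *)
Definition power_fun x : R := expR (\sum_j m j * ln (partition_fun j x)).

Definition gibbs x j i : R := W j i * expR (x i) / partition_fun j x.

Lemma partition_gt0 j x : 0 < partition_fun j x.
Proof.
have [i Wi] := W1 j; rewrite /partition_fun (bigD1 i)//= ltr_pwDl ?mulr_gt0 ?expR_gt0//.
by apply: sumr_ge0 => k _; rewrite mulr_ge0 ?expR_ge0.
Qed.

Lemma gibbs_ge0 x j i : 0 <= gibbs x j i.
Proof. by rewrite divr_ge0 ?mulr_ge0 ?expR_ge0// ltW ?partition_gt0. Qed.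

Lemma gibbs_sum x j : \sum_i gibbs x j i = 1.
Proof. by rewrite -mulr_suml divff// gt_eqF ?partition_gt0. Qed.

Lemma power_fun_gt0 x : 0 < power_fun x.
Proof. exact: expR_gt0. Qed.

Lemma power_fun_ratio x u (v : R) : power_fun (x + v *: u) =
  power_fun x * expR (\sum_j m j * ln (\sum_i gibbs x j i * expR (v * u i))).
Proof.
rewrite -expRD -big_split/=; congr expR; apply: eq_bigr => j _.
rewrite -mulrDr -lnM ?posrE ?partition_gt0//; last first.
  exact: expansion_mass_gt0 (gibbs_ge0 x) (gibbs_sum x) _ _.
congr (_ * ln _); rewrite mulr_sumr; apply: eq_bigr => i _.
rewrite (_ : (x + v *: u) i = x i + v * u i)// expRD /gibbs.
by field; rewrite gt_eqF ?partition_gt0.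
Qed.

(** [power_fun x * quad x us] is the generator of the walk with directions [us] applied to
    [power_fun]: half the Hessian contracted with the covariance. *)
Definition quad x us : R :=
  \sum_i \sum_i' hess_coef m (gibbs x) i i' * cov us i i'.

Variables (A Mm : R).
Hypothesis A1 : 1 <= A.
Hypothesis mM : \sum_j `|m j| <= Mm.

Definition rem_cst : R := expansion_cst A Mm * expR (Mm * A).

Lemma rem_cst_ge0 : 0 <= rem_cst.
Proof.
exact: mulr_ge0 (expansion_cst_ge0 mM A1) (expR_ge0 _).
Qed.

(** Within the reach of one step [power_fun] differs from its quadratic Taylor polynomial by O(r^3)
    relative to its value, and the mean of that polynomial over the step is exact by
    [step_moments]. *)
Lemma one_step us x (r : R) : (forall i, l1 us i <= A) -> 0 < r <= 1 ->
  `|step [seq r *: u | u <- us] power_fun x - power_fun x * (1 + r ^+ 2 * quad x us)|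
    <= power_fun x * (rem_cst * r ^+ 3).
Proof.
move=> usA /andP[r0 r1].
have Mm0 : 0 <= Mm by apply: le_trans mM; apply: sumr_ge0.
pose a i : R := power_fun x * \sum_j m j * gibbs x j i.
pose B i i' : R := power_fun x * hess_coef m (gibbs x) i i'.
pose G (c : R) y := c + \sum_i a i * y i + \sum_i \sum_i' B i i' * (y i * y i').
have l1r i : l1 [seq r *: u | u <- us] i <= r * A.
  rewrite /l1 big_map; apply: le_trans (ler_wpM2l (ltW r0) (usA i)).
  rewrite mulr_sumr; apply: ler_sum => u _.
  by rewrite (_ : (r *: u) i = r * u i)// normrM (gtr0_norm r0).
have key y : (forall i, `|y i| <= l1 [seq r *: u | u <- us] i) ->
    `|power_fun (x + y) - G (power_fun x) y| <= power_fun x * (rem_cst * r ^+ 3).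
  move=> Hy; pose u := r^-1 *: y.
  have uA i : `|u i| <= A.
    rewrite (_ : u i = r^-1 * y i)// normrM gtr0_norm ?invr_gt0//.
    by rewrite ler_pdivrMl// (le_trans (Hy i)).
  have -> : y = r *: u by rewrite scalerA divff ?gt_eqF// scale1r.
  have := power_expansion (gibbs_ge0 x) (gibbs_sum x) uA mM A1 r.
  rewrite power_fun_ratio (gtr0_norm r0); set E := expR (\sum_j _).
  have -> : G (power_fun x) (r *: u) = power_fun x * (1 + r * (\sum_j m j * \sum_i gibbs x j i * u i)
      + r ^+ 2 * (\sum_i \sum_i' hess_coef m (gibbs x) i i' * (u i * u i'))).
    rewrite /G !mulrDr mulr1; congr (_ + _ + _).
      under [X in r * X]eq_bigr do rewrite mulr_sumr.
      rewrite exchange_big/= !mulr_sumr; apply: eq_bigr => i _.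
      rewrite /a (_ : (r *: u) i = r * u i)// mulr_sumr mulr_suml !mulr_sumr.
      by apply: eq_bigr => j _; ring.
    rewrite !mulr_sumr; apply: eq_bigr => i _.
    rewrite !mulr_sumr; apply: eq_bigr => i' _.
    by rewrite /B (_ : (r *: u) i = r * u i)// (_ : (r *: u) i' = r * u i')//; ring.
  move=> H; rewrite -mulrBr normrM (gtr0_norm (power_fun_gt0 x)).
  rewrite ler_wpM2l ?(ltW (power_fun_gt0 x))//.
  rewrite !opprD !addrA in H *; apply: (le_trans H).
  rewrite /rem_cst mulrAC ler_wpM2r ?exprn_ge0 ?(ltW r0)//.
  rewrite ler_wpM2l ?(expansion_cst_ge0 mM A1)// ler_expR.
  by rewrite ler_piMr ?mulr_ge0// (le_trans _ A1).
have mom c : step [seq r *: u | u <- us] (G c) 0 = c + power_fun x * (r ^+ 2 * quad x us).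
  rewrite step_moments big1 ?addr0 => [|i _]; last by rewrite mulr0.
  rewrite big1 ?addr0 => [|i _]; last by rewrite big1// => i' _; rewrite mulr0 mulr0.
  congr (_ + _); rewrite /quad !mulr_sumr; apply: eq_bigr => i _.
  rewrite !mulr_sumr; apply: eq_bigr => i' _.
  by rewrite cov_scale /B; ring.
have shiftE : step [seq r *: u | u <- us] power_fun x =
    step [seq r *: u | u <- us] (fun y => power_fun (x + y)) 0.
  have := congr1 (fun f => f 0) (step_shift [seq r *: u | u <- us] power_fun x).
  by rewrite /= addr0.
have GD c d y : G (c + d) y = G c y + d by rewrite /G -!addrA [d + _]addrC !addrA.
rewrite shiftE mulrDr mulr1; rewrite ler_distl; apply/andP; split.
  rewrite addrAC -mom; apply: step_le_on => y Hy; rewrite !add0r GD.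
  have := key _ Hy; rewrite ler_distl => /andP[+ _].
  by rewrite lerBlDr.
rewrite addrAC -mom; apply: step_le_on => y Hy; rewrite !add0r GD.
by have := key _ Hy; rewrite ler_distl => /andP[_].
Qed.

Let Bd : R := #|I|%:R ^+ 2 * ((2 * Mm + Mm ^+ 2) * A ^+ 2).

Lemma quad_bound x us : (forall i, l1 us i <= A) -> `|quad x us| <= Bd.
Proof.
move=> usA.
have Mm0 : 0 <= Mm by apply: le_trans mM; apply: sumr_ge0.
have g1 j i : gibbs x j i <= 1.
  rewrite -(gibbs_sum x j) (bigD1 i)//= lerDl; apply: sumr_ge0 => k _.
  exact: gibbs_ge0.
have gg j j' i i' : `|gibbs x j i * gibbs x j' i'| <= 1.
  rewrite ger0_norm; last exact: mulr_ge0 (gibbs_ge0 _ _ _) (gibbs_ge0 _ _ _).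
  by apply: mulr_ile1; rewrite ?gibbs_ge0.
have hb : forall i i', `|hess_coef m (gibbs x) i i'| <= 2 * Mm + Mm ^+ 2.
  move=> i i'.
  rewrite /hess_coef normrM (@ger0_norm _ (2^-1)) ?invr_ge0//.
  rewrite ler_pdivrMr//; apply: (le_trans (ler_normD _ _)).
  have a1 : `|\sum_j m j * ((i == i')%:R * gibbs x j i - gibbs x j i * gibbs x j i')| <= 2 * Mm.
    apply: (le_trans (ler_norm_sum _ _ _)); apply: (le_trans _ (ler_wpM2l _ mM)) => //.
    rewrite mulr_sumr; apply: ler_sum => j _; rewrite normrM mulrC ler_wpM2r//.
    apply: (le_trans (ler_normB _ _)); rewrite -[leRHS]/(1 + 1) lerD ?gg//.
    rewrite ger0_norm; last exact: mulr_ge0 (ler0n _ _) (gibbs_ge0 _ _ _).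
    by apply: mulr_ile1; rewrite ?gibbs_ge0 ?ler0n//; case: (i == i').
  have a2 : `|\sum_j \sum_j' m j * m j' * (gibbs x j i * gibbs x j' i')| <= Mm ^+ 2.
    rewrite expr2; apply: le_trans (ler_pM _ _ mM mM); rewrite ?sumr_ge0//.
    apply: (le_trans (ler_norm_sum _ _ _)); rewrite big_distrlr/=; apply: ler_sum => j _.
    apply: (le_trans (ler_norm_sum _ _ _)); apply: ler_sum => j' _.
    by rewrite normrM normrM ler_piMr ?mulr_ge0.
  have := sqr_ge0 Mm; lra.
have -> : Bd = \sum_(i : I) \sum_(i' : I) ((2 * Mm + Mm ^+ 2) * A ^+ 2).
  by rewrite !sumr_const -mulrnA -[RHS]mulr_natl natrM expr2.
apply: (le_trans (ler_norm_sum _ _ _)); apply: ler_sum => i _.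
apply: (le_trans (ler_norm_sum _ _ _)); apply: ler_sum => i' _.
by rewrite normrM ler_pM// cov_l1.
Qed.

(** The generator inequality holds at every point, so no interpolating path is needed. The threshold
    depends on [us] and [vs] only through [A], and not on [x]; this matters where the dominating
    field is chosen after the means [x]. *)
Theorem walk_compare (c eps : R) : 0 <= c -> 0 < eps ->
  exists n0, forall n, (n0 <= n)%N -> forall us vs,
    (forall i, l1 us i <= A) -> (forall i, l1 vs i <= A) ->
    (forall x, quad x us <= quad x vs + c) ->
    forall x, gE n us (fun y => power_fun (x + y)) <=
       expR (c + eps) * gE n vs (fun y => power_fun (x + y)).
Proof.
move=> c0 e0.
have Mm0 : 0 <= Mm by apply: le_trans mM; apply: sumr_ge0.
have K0 := rem_cst_ge0.
have Bd0 : 0 <= Bd by rewrite mulr_ge0 ?exprn_ge0 ?mulr_ge0 ?addr_ge0 ?mulr_ge0 ?exprn_ge0 ?(le_trans _ A1)//.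
have [r0 /andP[r00 r01] Hr0] := second_order_compare K0 Bd0 c0 e0.
have [n0 Hn0] := large_invsqrt r00; exists n0 => n /Hn0 [n_gt0 rr] us vs usA vsA Huv x.
set r := (Num.sqrt n%:R)^-1 in rr *.
have r_gt0 : 0 < r by rewrite invr_gt0 sqrtr_gt0 ltr0n.
have one x' : step [seq r *: u | u <- us] power_fun x' <=
    expR (r ^+ 2 * (c + eps)) * step [seq r *: u | u <- vs] power_fun x'.
  have rI : 0 < r <= 1 by rewrite r_gt0 (le_trans rr).
  have := one_step x' usA rI; have := one_step x' vsA rI.
  rewrite !ler_distl => /andP[lo _] /andP[_ up].
  apply: (le_trans up); apply: (le_trans _ (ler_wpM2l (expR_ge0 _) lo)).
  have P0 := power_fun_gt0 x'.
  rewrite -mulrDr -mulrBr [leRHS]mulrCA ler_pM2l//.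
  by apply: Hr0 => //; [rewrite r_gt0|exact: quad_bound].
rewrite !gE_shift; apply: (le_trans (iter_step_compare n (expR_ge0 _) one x)).
rewrite -expRM_natl mulrA (_ : n%:R * r ^+ 2 = 1) ?mul1r//.
by rewrite exprVn sqr_sqrtr ?ler0n// divff// pnatr_eq0 -lt0n.
Qed.

End Fixed.
End OneStep.

(** * Gaussian comparison and concentration for maxima *)
Section Maxima.
Context {R : realType}.

Section ExpMax.
Context {I : finType}.
Implicit Types (x y : I -> R) (s : R).

(** The neutral element 0 is seen only for an empty index type, all exponentials being positive. *)
Definition expmax s x : R := \big[Num.max/0]_(i : I) expR (s * x i).

Lemma expmax_ge s x i : expR (s * x i) <= expmax s x.
Proof. exact: le_bigmax. Qed.

Lemma expmax_le s x (c : R) : 0 <= c -> (forall i, expR (s * x i) <= c) ->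
  expmax s x <= c.
Proof. by move=> c0 H; apply: bigmax_le. Qed.

Lemma expmax_ge0 s x : 0 <= expmax s x.
Proof. exact: bigmax_ge_id. Qed.

Lemma expmax_empty s x : #|I| = 0%N -> expmax s x = 0.
Proof. by move=> I0; rewrite /expmax big_pred0// => i; have := fintype0 i I0. Qed.

(** Once m ln|I| is small, the power Z^m of the partition function at inverse temperature s/m is
    within a factor e^eps of the maximum of e^{s x}; for a fixed index set smoothing is free. *)
Lemma smooth_parameter (eps : R) : 0 < eps ->
  exists m : R, 0 < m <= 1 /\ m * ln #|I|%:R <= eps.
Proof.
move=> e0; pose l := `|ln #|I|%:R : R|.
have l0 : 0 < l + 1 by rewrite ltr_wpDl ?normr_ge0.
exists (Num.min 1 (eps / (l + 1))); split.
  by rewrite lt_min ltr01 divr_gt0// ge_min lexx.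
apply: (@le_trans _ _ (eps / (l + 1) * (l + 1))); last by rewrite divfK// gt_eqF.
apply: (@le_trans _ _ (Num.min 1 (eps / (l + 1)) * (l + 1))).
  rewrite ler_wpM2l//; last by rewrite (le_trans (ler_norm _))// lerDl.
  by rewrite le_min ler01 divr_ge0 ?ltW.
by rewrite ler_wpM2r ?ge_min ?lexx ?orbT// ltW.
Qed.

Lemma sum_expR_gt0 (i0 : I) x : 0 < \sum_i expR (x i).
Proof. by rewrite (bigD1 i0)//= ltr_pwDl ?expR_gt0// sumr_ge0// => i _; rewrite expR_ge0. Qed.

Lemma expmax_le_smooth (m beta : R) x (i0 : I) : 0 <= m ->
  expmax (m * beta) x <= expR (m * ln (\sum_i expR (beta * x i))).
Proof.
move=> m0; apply: expmax_le => [|i]; first exact: expR_ge0.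
rewrite ler_expR -mulrA ler_wpM2l// -[leLHS]expRK.
rewrite ler_ln ?posrE ?expR_gt0 ?(sum_expR_gt0 i0 (beta *: x))//.
by rewrite (bigD1 i)//= lerDl sumr_ge0// => k _; rewrite expR_ge0.
Qed.

Lemma smooth_le_expmax (m beta eps : R) x (i0 : I) : 0 <= m -> 0 <= beta ->
  m * ln #|I|%:R <= eps ->
  expR (m * ln (\sum_i expR (beta * x i))) <= expR eps * expmax (m * beta) x.
Proof.
move=> m0 b0 me.
have [k Hk] : exists k, forall i, x i <= x k.
  exists [arg max_(i > i0) x i]%O; case: arg_maxP => // k _ Hk i; exact: Hk.
apply: (le_trans _ (ler_wpM2l (expR_ge0 _) (expmax_ge _ _ k))).
rewrite -expRD ler_expR.
apply: (@le_trans _ _ (m * (ln #|I|%:R + beta * x k))); last first.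
  by rewrite mulrDr mulrA lerD2r.
have I0 : (0 < #|I|)%N by apply/card_gt0P; exists i0.
rewrite ler_wpM2l// -[X in _ + X]expRK -lnM ?posrE ?ltr0n ?expR_gt0//.
rewrite ler_ln ?posrE ?(sum_expR_gt0 i0 (beta *: x)) ?mulr_gt0 ?ltr0n ?expR_gt0//.
rewrite (_ : #|I|%:R * _ = \sum_(i : I) expR (beta * x k)); last by rewrite sumr_const mulr_natl.
by apply: ler_sum => i _; rewrite ler_expR ler_wpM2l.
Qed.

End ExpMax.

Lemma l1_scale (I : finType) (a : R) (us : seq (I -> R)) i :
  l1 [seq a *: u | u <- us] i = `|a| * l1 us i.
Proof.
by rewrite /l1 big_map mulr_sumr; apply: eq_bigr => u _; rewrite vscaleE normrM.
Qed.

Lemma gE_scale (I : finType) n (a : R) (us : seq (I -> R)) (F : (I -> R) -> R) :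
  gE n us (fun y => F (a *: y)) = gE n [seq a *: u | u <- us] F.
Proof.
apply: (gE_map n us F) => [x y|b x]; first by rewrite scalerDr.
by rewrite !scalerA mulrC.
Qed.

(* Sudakov-Fernique, for exponential moments of maxima and arbitrary means [x]. *)
Theorem compare_expmax (I : finType) (s D eps A : R) : 0 < s -> 0 <= D -> 0 < eps -> 0 <= A ->
  exists n0, forall n, (n0 <= n)%N -> forall us vs : seq (I -> R),
    (forall i, l1 us i <= A) -> (forall i, l1 vs i <= A) ->
    (forall i j, cov us i i + cov us j j - 2 * cov us i j <=
                 cov vs i i + cov vs j j - 2 * cov vs i j) ->
    (forall i j, cov us i j <= cov vs i j + D) ->
    forall x, gE n us (fun y => expmax s (x + y)) <=
       expR (s ^+ 2 * D / 2 + eps) * gE n vs (fun y => expmax s (x + y)).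
Proof.
move=> s0 D0 e0 A0.
have [I0|[i0 _]] : #|I| = 0%N \/ exists i : I, i \in I.
- by case: (posnP #|I|) => [->|/card_gt0P[i Ii]]; [left|right; exists i].
  exists 0%N => n _ us vs _ _ _ _ x.
  have -> : (fun y : I -> R => expmax s (x + y)) = fun _ => 0.
    by apply/funext => y; rewrite expmax_empty.
  by rewrite !gE_cst mulr0.
have e20 : 0 < eps / 2 by rewrite divr_gt0.
have [m [/andP[m0 m1] me]] := smooth_parameter (I := I) e20.
pose beta := s / m; have b0 : 0 < beta by rewrite divr_gt0.
have mb : m * beta = s by rewrite mulrC divfK// gt_eqF.
pose W (_ : unit) (_ : I) : R := 1; pose mm (_ : unit) := m.
have W0 j i : 0 <= W j i by [].
have W1 j : exists i, 0 < W j i by exists i0; exact: ltr01.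
have sumU (f : unit -> R) : \sum_j f j = f tt.
  by rewrite (bigD1 tt)//= big1 ?addr0// => -[].
have mM : \sum_j `|mm j| <= m by rewrite sumU ger0_norm// ltW.
have A1 : 1 <= 1 + beta * A by rewrite lerDl mulr_ge0// ltW.
have c0 : 0 <= s ^+ 2 * D / 2 by rewrite divr_ge0// mulr_ge0// exprn_ge0// ltW.
have [n0 Hn0] := walk_compare W0 W1 A1 mM c0 e20.
exists n0 => n nn0 us vs usA vsA Hinc HD x.
pose F y := power_fun mm W (beta *: y).
have FE y : F y = expR (m * ln (\sum_i expR (beta * y i))).
  rewrite /F /power_fun sumU; congr (expR (m * ln _)).
  by apply: eq_bigr => i _; rewrite mul1r.
have Fsc ws : gE n ws (fun y => F (x + y)) =
    gE n [seq beta *: u | u <- ws] (fun y => power_fun mm W (beta *: x + y)).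
  rewrite -(gE_scale n beta ws (fun y => power_fun mm W (beta *: x + y))).
  apply: (congr1 (gE n ws)); apply/funext => y.
  by rewrite /F scalerDr; reflexivity.
apply: (@le_trans _ _ (gE n us (fun y => F (x + y)))).
  by apply: gE_le => y; rewrite FE -mb expmax_le_smooth ?ltW.
have l1b (ws : seq (I -> R)) : (forall i, l1 ws i <= A) -> forall i, l1 [seq beta *: u | u <- ws] i <= 1 + beta * A.
  move=> wA i; rewrite l1_scale gtr0_norm//; apply: (@le_trans _ _ (beta * A)).
    by rewrite ler_pM2l.
  by rewrite lerDr.
have HQ x' : quad mm W x' [seq beta *: u | u <- us] <=
    quad mm W x' [seq beta *: u | u <- vs] + s ^+ 2 * D / 2.
  rewrite -lerBlDl.
  pose V i i' := cov us i i' - cov vs i i'.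
  pose p i := gibbs W x' tt i.
  have p0 i : 0 <= p i by exact: gibbs_ge0.
  have p1 : \sum_i p i = 1 by exact: gibbs_sum.
  have -> : quad mm W x' [seq beta *: u | u <- us] - quad mm W x' [seq beta *: u | u <- vs] =
     beta ^+ 2 * \sum_i \sum_i' hess_coef mm (gibbs W x') i i' * V i i'.
    rewrite /quad -sumrB mulr_sumr; apply: eq_bigr => i _; rewrite -sumrB mulr_sumr.
    by apply: eq_bigr => i' _; rewrite !cov_scale /V; ring.
  have -> : \sum_i \sum_i' hess_coef mm (gibbs W x') i i' * V i i' =
      m / 2 * (\sum_i p i * V i i - (1 - m) * \sum_i \sum_i' p i * p i' * V i i').
    rewrite [in RHS]mulr_sumr -sumrB mulr_sumr; apply: eq_bigr => i _.
    rewrite [X in _ = _ * (X - _)](_ : _ = \sum_i' (i == i')%:R * p i * V i i'); last first.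
      rewrite (bigD1 i)//= eqxx mul1r big1 ?addr0// => k /negbTE ne.
      by rewrite eq_sym ne !mul0r.
    rewrite mulr_sumr -sumrB mulr_sumr; apply: eq_bigr => i' _.
    rewrite /hess_coef !sumU /mm -/(p i) -/(p i').
    by field.
  (* As a sum over pairs the diagonal joins the off-diagonal part: (V_ii + V_jj)/2 - V_ij <= 0 is
     the increment hypothesis, and only m V_ij <= m D is left, which with the prefactor beta^2 m / 2
     gives s^2 D / 2. *)
  have e1 : \sum_i p i * V i i = \sum_i \sum_i' p i * p i' * ((V i i + V i' i') / 2).
    have a1 : \sum_i \sum_i' p i * p i' * V i i = \sum_i p i * V i i.
      by apply: eq_bigr => i _; rewrite -mulr_suml -mulr_sumr p1 mulr1.
    have a2 : \sum_i \sum_i' p i * p i' * V i' i' = \sum_i p i * V i i.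
      by rewrite exchange_big -a1; apply: eq_bigr => i _; apply: eq_bigr => i' _; ring.
    rewrite (_ : \sum_i p i * V i i = (\sum_i p i * V i i + \sum_i p i * V i i) / 2); last by field.
    rewrite -{1}a1 -a2 -big_split/= mulr_suml; apply: eq_bigr => i _.
    by rewrite -big_split/= mulr_suml; apply: eq_bigr => i' _; field.
  rewrite e1 mulr_sumr -sumrB !mulr_sumr.
  have -> : s ^+ 2 * D / 2 = \sum_i \sum_i' p i * p i' * (s ^+ 2 * D / 2).
    under eq_bigr do rewrite -mulr_suml -mulr_sumr p1 mulr1.
    by rewrite -mulr_suml p1 mul1r.
  apply: ler_sum => i _; rewrite mulr_sumr -sumrB !mulr_sumr; apply: ler_sum => i' _.
  rewrite -{1}mb.
  have h1 := Hinc i i'; have h2 := HD i i'.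
  have h3 : (V i i + V i' i') / 2 - (1 - m) * V i i' <= m * D.
    have : m * V i i' <= m * D by rewrite ler_pM2l// lerBlDl.
    by rewrite /V in h1 h2 *; lra.
  have pp : 0 <= p i * p i' by rewrite mulr_ge0.
  have -> : beta ^+ 2 * (m / 2 * (p i * p i' * ((V i i + V i' i') / 2) - (1 - m) * (p i * p i' * V i i'))) =
     (beta ^+ 2 * (m / 2) * (p i * p i')) * ((V i i + V i' i') / 2 - (1 - m) * V i i') by field.
  have -> : p i * p i' * ((m * beta) ^+ 2 * D / 2) =
     (beta ^+ 2 * (m / 2) * (p i * p i')) * (m * D) by field.
  by rewrite ler_wpM2l// mulr_ge0// mulr_ge0 ?sqr_ge0// divr_ge0// ltW.
apply: (@le_trans _ _ (expR (s ^+ 2 * D / 2 + eps / 2) * gE n vs (fun y => F (x + y)))).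
  rewrite (Fsc us) (Fsc vs).
  exact: (Hn0 n nn0 _ _ (l1b _ usA) (l1b _ vsA) HQ (beta *: x)).
rewrite (_ : s ^+ 2 * D / 2 + eps = s ^+ 2 * D / 2 + eps / 2 + eps / 2); last by field.
rewrite [in leRHS]expRD -[leRHS]mulrA ler_pM2l ?expR_gt0// -gE_mull; apply: gE_le => y.
rewrite FE -mb; apply: smooth_le_expmax => //; exact: ltW.
Qed.

(* Concentration: [Z^m Z'^-m] for independent copies is compared with the same
   function evaluated at two equal copies, which is constant. *)
Theorem concentration_smooth (I : finType) (i0 : I) (s v eps A : R) :
  0 < s -> 0 <= v -> 0 < eps -> 0 <= A ->
  exists m beta : R, [/\ 0 < m, 0 < beta, m * beta = s, m * ln #|I|%:R <= eps &
  exists n0, forall n, (n0 <= n)%N -> forall us : seq (I -> R),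
    (forall i, l1 us i <= A) -> (forall i j, cov us i j <= v) ->
    gE n us (fun y => expmax s y) *
    gE n us (fun y => expR (- m * ln (\sum_i expR (beta * y i)))) <=
       expR (2 * s ^+ 2 * v + eps)].
Proof.
move=> s0 v0 e0 A0.
have [m [/andP[m0 m1] me]] := smooth_parameter (I := I) e0.
pose beta := s / m; have b0 : 0 < beta by rewrite divr_gt0.
have mb : m * beta = s by rewrite mulrC divfK// gt_eqF.
exists m, beta; split=> //.
(* Indices are (copy, point): factor [true] is the partition function of the first copy to the power
   m, factor [false] that of the second to the power -m. Below, [L1] and [L2] feed independent
   fields to the copies, [L0] the same field to both, where the product is 1. *)
pose W (j : bool) (k : bool * I) : R := (k.1 == j)%:R.
pose mm (j : bool) := if j then m else - m.
have W0 j k : 0 <= W j k by rewrite ler0n.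
have W1 j : exists k, 0 < W j k by exists (j, i0); rewrite /W eqxx ltr01.
have sumB (f : bool -> R) : \sum_j f j = f true + f false.
  by rewrite (bigD1 true)//= (bigD1 false)//= big1 ?addr0// => -[].
have mM : \sum_j `|mm j| <= 2 * m.
  by rewrite sumB/= normrN gtr0_norm//; lra.
have A1 : 1 <= 1 + beta * A by rewrite lerDl mulr_ge0// ltW.
have c0 : 0 <= 2 * s ^+ 2 * v by rewrite mulr_ge0// mulr_ge0// exprn_ge0// ltW.
have [n0 Hn0] := walk_compare W0 W1 A1 mM c0 e0.
exists n0 => n nn0 us usA usv.
pose L0 (y : I -> R) (k : bool * I) := y k.2.
pose L1 (y : I -> R) (k : bool * I) := if k.1 then y k.2 else 0.
pose L2 (y : I -> R) (k : bool * I) := if k.1 then 0 else y k.2.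
have L1D x y : L1 (x + y) = L1 x + L1 y.
  by apply/funext => -[[] i]; rewrite vaddE /L1 ?addr0.
have L1Z a x : L1 (a *: x) = a *: L1 x.
  by apply/funext => -[[] i]; rewrite vscaleE /L1 ?mulr0.
have L2D x y : L2 (x + y) = L2 x + L2 y.
  by apply/funext => -[[] i]; rewrite vaddE /L2 ?addr0.
have L2Z a x : L2 (a *: x) = a *: L2 x.
  by apply/funext => -[[] i]; rewrite vscaleE /L2 ?mulr0.
pose us' := [seq beta *: u | u <- us].
have us'A i : l1 us' i <= 1 + beta * A.
  rewrite l1_scale gtr0_norm//; apply: (@le_trans _ _ (beta * A)).
    by rewrite ler_pM2l.
  by rewrite lerDr.
have PE y z : power_fun mm W (L1 y + L2 z) =
    expR (m * ln (\sum_i expR (y i))) * expR (- m * ln (\sum_i expR (z i))).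
  rewrite /power_fun sumB expRD /mm /partition_fun /W; congr (expR (_ * ln _) * expR (_ * ln _)).
    rewrite -(pair_bigA _ (fun b i => (b == true)%:R * expR ((L1 y + L2 z) (b, i)))) /= sumB/=.
    rewrite [X in _ + X]big1 ?addr0 => [|i _]; last by rewrite mul0r.
    by apply: eq_bigr => i _; rewrite mul1r vaddE /L1 /L2/= addr0.
  rewrite -(pair_bigA _ (fun b i => (b == false)%:R * expR ((L1 y + L2 z) (b, i)))) /= sumB/=.
  rewrite big1 ?add0r => [|i _]; last by rewrite mul0r.
  by apply: eq_bigr => i _; rewrite mul1r vaddE /L1 /L2/= add0r.
have PE0 y : power_fun mm W (L0 y) = 1.
  have -> : L0 y = L1 y + L2 y.
    by apply/funext => -[[] i]; rewrite vaddE /L0 /L1 /L2/= ?addr0 ?add0r.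
  by rewrite PE mulNr expRN divff// gt_eqF ?expR_gt0.
pose ws := [seq L1 u | u <- us'] ++ [seq L2 u | u <- us'].
pose ss := [seq L0 u | u <- us'].
have l1w k : l1 ws k <= 1 + beta * A.
  rewrite /l1 big_cat (big_map L1) (big_map L2)/=; case: k => -[] i.
    rewrite (_ : \sum_(u <- us') `|L2 u (true, i)| = 0) ?addr0; first exact: us'A.
    by apply: big1 => u _; rewrite /L2/= normr0.
  rewrite (_ : \sum_(u <- us') `|L1 u (false, i)| = 0) ?add0r; first exact: us'A.
  by apply: big1 => u _; rewrite /L1/= normr0.
have l1s k : l1 ss k <= 1 + beta * A by rewrite /l1 big_map; exact: us'A.
have covs k k' : cov ss k k' = cov us' k.2 k'.2 by rewrite /cov big_map.
have covw k k' : cov ws k k' = if k.1 == k'.1 then cov us' k.2 k'.2 else 0.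
  rewrite /cov big_cat (big_map L1) (big_map L2)/=; case: k k' => -[] i [[] i'] /=; rewrite /L1 /L2/=.
  - by rewrite [X in _ + X = _]big1 ?addr0// => u _; rewrite mulr0.
  - by rewrite !big1 ?addr0// => u _; rewrite ?mul0r ?mulr0.
  - by rewrite !big1 ?addr0// => u _; rewrite ?mul0r ?mulr0.
  - by rewrite big1 ?add0r// => u _; rewrite mulr0.
(* Only pairs from different copies contribute: there [ws] has covariance 0, and in [ss] the
   coefficient of [cov us] is negative because the exponents have opposite signs. The Gibbs weights
   of the two factors sum to 4, whence 2 s^2 v. *)
have HQ x : quad mm W x ws <= quad mm W x ss + 2 * s ^+ 2 * v.
  rewrite -lerBlDl /quad -sumrB.
  pose p j k := gibbs W x j k.
  have p0 j k : 0 <= p j k by exact: gibbs_ge0.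
  have p1 j : \sum_k p j k = 1 by exact: gibbs_sum.
  have psupp j b i : b != j -> p j (b, i) = 0.
    by move=> /negbTE bj; rewrite /p /gibbs /W/= bj !mul0r.
  have -> : 2 * s ^+ 2 * v = \sum_k \sum_k' (\sum_j \sum_j' (p j k * p j' k')) * (s ^+ 2 * v / 2).
    under eq_bigr do rewrite -mulr_suml.
    rewrite -mulr_suml.
    have -> : \sum_k \sum_k' \sum_j \sum_j' (p j k * p j' k') = 4.
      transitivity ((\sum_j \sum_k p j k) * (\sum_j \sum_k p j k)).
        rewrite [in RHS]exchange_big/= big_distrlr/=; apply: eq_bigr => k _.
        by apply: eq_bigr => k' _; rewrite big_distrlr.
      by rewrite !sumB !p1; ring.
    by field.
  apply: ler_sum => -[b i] _; rewrite -sumrB; apply: ler_sum => -[b' i'] _.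
  rewrite -mulrBr covs covw/=; have [->|bb'] := eqVneq b b'.
    rewrite subrr mulr0 mulr_ge0 ?divr_ge0 ?mulr_ge0 ?exprn_ge0 ?(ltW s0)//.
    by apply: sumr_ge0 => j _; apply: sumr_ge0 => j' _; rewrite mulr_ge0.
  rewrite sub0r /hess_coef xpair_eqE (negbTE bb')/= mulrN -mulNr -mulNr.
  rewrite (_ : \sum_j mm j * _ = 0); last first.
    apply: big1 => j _; rewrite -/(p j (b, i)) -/(p j (b', i')) mul0r sub0r.
    have [bj|bj] := eqVneq b j; last by rewrite (psupp _ _ _ bj) mul0r oppr0 mulr0.
    by rewrite (psupp j b') ?mulr0 ?oppr0 ?mulr0// -bj eq_sym.
  rewrite add0r -sumrN.
  have -> : (\sum_j - \sum_j' mm j * mm j' * (gibbs W x j (b, i) * gibbs W x j' (b', i'))) =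
     m ^+ 2 * \sum_j \sum_j' p j (b, i) * p j' (b', i').
    rewrite mulr_sumr; apply: eq_bigr => j _; rewrite -sumrN mulr_sumr; apply: eq_bigr => j' _.
    rewrite -/(p j (b, i)) -/(p j' (b', i')).
    have [bj|bj] := eqVneq b j; last by rewrite (psupp _ _ _ bj) mul0r !mulr0 oppr0.
    have [bj'|bj'] := eqVneq b' j'; last by rewrite (psupp _ _ _ bj') mulr0 !mulr0 oppr0.
    move: bb'; rewrite bj bj' /mm; case: (j); case: (j') => //= _; ring.
  set S := \sum_j _.
  have S0 : 0 <= S by apply: sumr_ge0 => j _; apply: sumr_ge0 => j' _; rewrite mulr_ge0.
  rewrite /us' cov_scale -mb.
  rewrite [leLHS](_ : _ = S * ((m * beta) ^+ 2 * cov us i i' / 2)); last by field.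
  rewrite ler_wpM2l// ler_pM2r// ler_wpM2l ?sqr_ge0//; exact: usv.
have := Hn0 n nn0 _ _ l1w l1s HQ 0.
have -> : gE n ss (fun y => power_fun mm W (0 + y)) = 1.
  rewrite -[RHS](gE_cst n us' 1) -gE_map//.
  by apply: (congr1 (gE n us')); apply/funext => y; rewrite /= add0r PE0.
rewrite mulr1 addrC; apply: le_trans.
rewrite gE_cat -(gE_map n us' _ L1D L1Z).
have -> : gE n us' ((fun x => gE n [seq L2 u | u <- us'] (fun y => power_fun mm W (0 + (x + y)))) \o L1) =
   gE n us' (fun y => expR (m * ln (\sum_i expR (y i)))) * gE n us' (fun y => expR (- m * ln (\sum_i expR (y i)))).
  rewrite mulrC -gE_mull; apply: (congr1 (gE n us')); apply/funext => y.
  rewrite [RHS]mulrC -gE_mull -[LHS](gE_map n us' _ L2D L2Z).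
  by apply: (congr1 (gE n us')); apply/funext => z /=; rewrite add0r PE; reflexivity.
rewrite /us' -(gE_scale n beta us (fun y => expR (m * ln (\sum_i expR (y i))))).
rewrite -(gE_scale n beta us (fun y => expR (- m * ln (\sum_i expR (y i))))).
apply: ler_pM => //.
- by apply: gE_ge0 => y; exact: expmax_ge0.
- by apply: gE_ge0 => y; exact: expR_ge0.
- apply: gE_le => y; rewrite -mb; apply: expmax_le_smooth => //; exact: ltW.
Qed.

End Maxima.

(** * One-dimensional Gaussian integrals *)
Section Gauss1.
Context {R : realType}.
Notation mu := (@lebesgue_measure R).
Implicit Types (s t x y : R).

Lemma normal_pdf_gt0E s m y : s != 0 ->
  normal_pdf m s y = normal_peak s * expR (- (y - m) ^+ 2 / (s ^+ 2 *+ 2)).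
Proof. by move=> s0; rewrite normal_pdfE. Qed.

Lemma gauss_mgf s t : 0 < s ->
  (\int[mu]_y (expR (t * y) * normal_pdf 0 s y)%:E = (expR (t ^+ 2 * s ^+ 2 / 2))%:E)%E.
Proof.
move=> s0; have sn0 : s != 0 by rewrite gt_eqF.
transitivity (\int[mu]_y ((expR (t ^+ 2 * s ^+ 2 / 2))%:E * (normal_pdf (t * s ^+ 2) s y)%:E))%E.
  apply: eq_integral => y _; rewrite -EFinM; congr EFin.
  rewrite !normal_pdf_gt0E// mulrCA [RHS]mulrCA -!expRD; congr (_ * expR _).
  by field.
rewrite ge0_integralZl//=.
- by rewrite integral_normal_pdf mule1.
- by apply/measurable_EFinP; exact: measurable_normal_pdf.
- by move=> y _; rewrite lee_fin normal_pdf_ge0.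
Qed.

Lemma measurable_gauss_exp s t :
  measurable_fun setT (fun y : R => expR (t * y) * normal_pdf 0 s y).
Proof.
apply: measurable_funM; last exact: measurable_normal_pdf.
by apply: measurableT_comp => //; exact: measurable_funM.
Qed.

Lemma integrable_gauss_exp s t : 0 < s ->
  mu.-integrable setT (fun y => (expR (t * y) * normal_pdf 0 s y)%:E).
Proof.
move=> s0; apply/integrableP; split.
  by apply/measurable_EFinP; exact: measurable_gauss_exp.
under eq_integral do rewrite gee0_abs ?lee_fin ?mulr_ge0 ?expR_ge0 ?normal_pdf_ge0//.
by rewrite gauss_mgf// ltry.
Qed.

(** Sums of exponentials are the integrands that can be evaluated exactly; the Gaussian step and
    tail bounds below dominate their integrands by such sums. *)
Lemma gauss_expsum s (l : seq (R * R)) : 0 < s ->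
  mu.-integrable setT
    (fun y => ((\sum_(q <- l) q.1 * expR (q.2 * y)) * normal_pdf 0 s y)%:E) /\
  (\int[mu]_y ((\sum_(q <- l) q.1 * expR (q.2 * y)) * normal_pdf 0 s y)%:E =
   (\sum_(q <- l) q.1 * expR (q.2 ^+ 2 * s ^+ 2 / 2))%:E)%E.
Proof.
move=> s0; elim: l => [|[c t] l [IHi IHe]].
  rewrite big_nil; have -> : (fun y => ((\sum_(q <- [::]) q.1 * expR (q.2 * y)) *
      normal_pdf 0 s y)%:E) = cst 0%E.
    by apply/funext => y; rewrite big_nil mul0r.
  by split; [exact: integrable0|rewrite integral0].
have -> : (fun y => ((\sum_(q <- (c, t) :: l) q.1 * expR (q.2 * y)) * normal_pdf 0 s y)%:E) =
  ((fun y => (c%:E * (expR (t * y) * normal_pdf 0 s y)%:E)) \+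
   (fun y => ((\sum_(q <- l) q.1 * expR (q.2 * y)) * normal_pdf 0 s y)%:E))%E.
  by apply/funext => y /=; rewrite big_cons mulrDl EFinD -EFinM mulrA.
have i1 := integrable_gauss_exp t s0.
have i2 : mu.-integrable setT (fun y => (c%:E * (expR (t * y) * normal_pdf 0 s y)%:E)%E).
  exact: integrableZl.
split; first exact: integrableD.
rewrite integralD//= IHe integralZl// gauss_mgf// big_cons EFinD EFinM.
by [].
Qed.

(* [pdf(w - y) pdf(y)] is the density of variance [2 s^2] at [w] times a normal density in [y]. *)
Lemma normal_pdf_conv s w y : 0 < s ->
  normal_pdf 0 s (w - y) * normal_pdf 0 s y =
  normal_pdf 0 (Num.sqrt 2 * s) w * normal_pdf (w / 2) (s / Num.sqrt 2) y.
Proof.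
move=> s0; have sn0 : s != 0 by rewrite gt_eqF.
have q0 : 0 < Num.sqrt (2 : R) by rewrite sqrtr_gt0.
have qn0 : Num.sqrt (2 : R) != 0 by rewrite gt_eqF.
have q2 : Num.sqrt (2 : R) ^+ 2 = 2 by rewrite sqr_sqrtr.
rewrite !normal_pdf_gt0E ?mulf_neq0 ?invr_eq0//.
rewrite mulrACA [RHS]mulrACA -!expRD; congr (_ * expR _).
  rewrite /normal_peak -!invfM; congr (_^-1).
  have pg (a : R) : 0 <= a ^+ 2 * pi *+ 2 by rewrite mulrn_wge0// mulr_ge0 ?sqr_ge0 ?pi_ge0.
  rewrite -(sqrtrM _ (pg _)) -(sqrtrM _ (pg _)).
  have -> // : s ^+ 2 * pi *+ 2 * (s ^+ 2 * pi *+ 2) =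
    (Num.sqrt 2 * s) ^+ 2 * pi *+ 2 * ((s / Num.sqrt 2) ^+ 2 * pi *+ 2).
  by rewrite !exprMn exprVn q2; field.
rewrite !exprMn exprVn q2; field.
by rewrite ?qn0 ?sn0.
Qed.

Lemma integral_translate (G : R -> R) x : continuous G -> (forall y, 0 <= G y) ->
  (\int[mu]_y (G y)%:E = \int[mu]_y (G (y - x))%:E)%E.
Proof.
move=> cG G0.
have dF (y : R) : is_derive y (1 : R) (fun y : R => y - x) 1.
  by apply: is_derive_eq; rewrite ?subr0.
have dFE : derive1 (fun y : R => y - x) = cst 1.
  by apply/funext => y; rewrite derive1E; case: (dF y).
rewrite (@increasing_ge0_integration_by_substitutionT _ (fun y => y - x) G)//.
- by apply: eq_integral => y _; rewrite dFE /= !fctE /= mulr1.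
- by move=> a b ab; rewrite ltrD2r.
- by rewrite dFE => y; exact: cvg_cst.
- by rewrite dFE; exact: is_cvg_cst.
- by rewrite dFE; exact: is_cvg_cst.
- exact: cvg_addrr_Ny.
- exact: cvg_addrr.
Qed.

(** Convolving the law of variance s^2 with itself suffices: variances are only ever doubled, which
    is why walks of 2^l steps are the ones compared with Gaussian disorder. *)
Lemma gauss_semigroup (G : R -> R) s : 0 < s -> continuous G -> (forall y, 0 <= G y) ->
  (\int[mu]_y (G y * normal_pdf 0 (Num.sqrt 2 * s) y)%:E =
   \int[mu]_y ((\int[mu]_w (G (y + w) * normal_pdf 0 s w)%:E) * (normal_pdf 0 s y)%:E))%E.
Proof.
move=> s0 cG G0; have sn0 : s != 0 by rewrite gt_eqF.
have mG : measurable_fun setT G by exact: continuous_measurable_fun.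
have mp m' s' : measurable_fun setT (@normal_pdf R m' s') by exact: measurable_normal_pdf.
pose f (q : R * R) : \bar R := (G q.2 * (normal_pdf 0 s (q.2 - q.1) * normal_pdf 0 s q.1))%:E.
have mf : measurable_fun setT f.
  apply/measurable_EFinP; apply: measurable_funM.
    by apply: measurableT_comp => //; exact: measurable_snd.
  apply: measurable_funM.
    apply: measurableT_comp => //; apply: measurable_funB; [exact: measurable_snd|exact: measurable_fst].
  by apply: measurableT_comp => //; exact: measurable_fst.
have f0 q : (0 <= f q)%E by rewrite lee_fin !mulr_ge0 ?normal_pdf_ge0.
transitivity (\int[mu]_w \int[mu]_y f (y, w))%E.
  apply: eq_integral => w _ /=.
  transitivity (\int[mu]_y ((G w * normal_pdf 0 (Num.sqrt 2 * s) w)%:E *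
      (normal_pdf (w / 2) (s / Num.sqrt 2) y)%:E))%E.
    rewrite ge0_integralZl//=.
    - by rewrite integral_normal_pdf mule1.
    - by apply/measurable_EFinP; exact: mp.
    - by move=> y _; rewrite lee_fin normal_pdf_ge0.
    - by rewrite lee_fin mulr_ge0 ?normal_pdf_ge0.
  apply: eq_integral => y _; rewrite /f/= normal_pdf_conv// -EFinM.
  by rewrite mulrA.
apply: (etrans (esym (@fubini_tonelli _ _ _ _ R mu mu f mf f0))).
apply: eq_integral => y _ /=.
transitivity (\int[mu]_w (G (y + w) * normal_pdf 0 s w * normal_pdf 0 s y)%:E)%E; last first.
  under eq_integral do rewrite EFinM.
  rewrite ge0_integralZr//=.
  - apply/measurable_EFinP/measurable_funM; last exact: mp.
    by apply: (measurableT_comp mG); exact: measurable_funD.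
  - by move=> w _; rewrite lee_fin mulr_ge0 ?normal_pdf_ge0.
  - by rewrite lee_fin normal_pdf_ge0.
rewrite [RHS](@integral_translate _ y).
- apply: eq_integral => w _; rewrite /f/= (addrC y) subrK mulrA.
  by [].
- move=> w; apply: cvgM; last exact: cvg_cst.
  apply: cvgM; last exact: continuous_normal_pdf.
  apply: (@continuous_comp _ _ _ (fun w => y + w) G); last exact: cG.
  by apply: cvgD; [exact: cvg_cst|exact: cvg_id].
- by move=> w; rewrite !mulr_ge0 ?normal_pdf_ge0.
Qed.

End Gauss1.

(** * Gaussian integrals versus random walks *)
Section GaussWalk.
Context {R : realType}.
Notation mu := (@lebesgue_measure R).

(** The expansion of powers of partition functions specialized to one-point types; 13 = 1 + 6 + 6 is
    [expansion_cst] there. *)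
Lemma expR_taylor2 (v : R) : `|expR v - 1 - v - v ^+ 2 / 2| <= 13 * (`|v| ^+ 3 * expR `|v|).
Proof.
have sumU (f : unit -> R) : \sum_j f j = f tt.
  by rewrite (bigD1 tt)//= big1 ?addr0// => -[].
have h1 (j : unit) : \sum_(i : unit) (1 : R) = 1 by exact: sumU.
have h2 (i : unit) : `|1 : R| <= 1 by rewrite normr1.
have h3 : \sum_(j : unit) `|1 : R| <= 1 by rewrite sumU normr1.
have := @power_expansion R unit unit (fun=> 1) (fun _ _ => 1) (fun=> 1) 1
  (fun _ _ => ler01) h1 h2 1 h3 (lexx 1) v.
rewrite !sumU /hess_coef !sumU eqxx !mulr1 !mul1r expRK subrr add0r.
rewrite /expansion_cst !expr1n !mulr1.
by rewrite [in X in _ -> X]mulrA (_ : 1 + 6 + 6 = 13 :> R) ?div1r//; ring.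
Qed.

(** Trades a cubic remainder for exponentials at scale 1/rho: under the centered Gaussian law of
    standard deviation [rho] these have bounded mean, and the factor rho^3 is kept. *)
Lemma cube_exp_le (v K rho : R) : 0 <= K -> 0 < rho <= 1 ->
  `|v| ^+ 3 * expR (K * `|v|) <=
  6 * rho ^+ 3 * (expR ((K + 1) / rho * v) + expR (- ((K + 1) / rho) * v)).
Proof.
move=> K0 /andP[r0 r1]; set y := `|v| / rho.
have y0 : 0 <= y by rewrite divr_ge0// ltW.
have vE : `|v| = rho * y by rewrite mulrC divfK ?gt_eqF.
have y3 : y ^+ 3 <= 6 * expR y.
  have := expR_ge1Dxn 2 y0; rewrite (_ : 3`!%:R = 6)// => H.
  have : y ^+ 3 / 6 <= expR y by apply: le_trans H; rewrite lerDr.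
  by rewrite ler_pdivrMr// mulrC.
have e1 : expR (K * `|v|) <= expR (K * y).
  by rewrite ler_expR ler_wpM2l// vE ler_piMl.
have e2 : expR ((K + 1) * y) <= expR ((K + 1) / rho * v) + expR (- ((K + 1) / rho) * v).
  have [v0|v0] := leP 0 v.
    have -> : (K + 1) * y = (K + 1) / rho * v by rewrite /y ger0_norm//; ring.
    by rewrite lerDl expR_ge0.
  have -> : (K + 1) * y = - ((K + 1) / rho) * v by rewrite /y ltr0_norm//; ring.
  by rewrite lerDr expR_ge0.
set S := expR _ + expR _ in e2 *; rewrite (_ : 6 * rho ^+ 3 * S = rho ^+ 3 * (6 * S)); last by ring.
rewrite {1}vE exprMn -mulrA ler_wpM2l ?exprn_ge0 ?(ltW r0)//.
apply: (@le_trans _ _ (6 * expR y * expR (K * y))).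
  by apply: ler_pM; rewrite ?exprn_ge0 ?expR_ge0.
by rewrite -mulrA -expRD ler_pM2l// (_ : y + K * y = (K + 1) * y)//; ring.
Qed.

Section Smooth.
Context {I J : finType}.
Variables (m : J -> R) (W : J -> I -> R).
Hypothesis W0 : forall j i, 0 <= W j i.
Hypothesis W1 : forall j, exists i, 0 < W j i.
Variables (A Mm : R).
Hypothesis A1 : 1 <= A.
Hypothesis mM : \sum_j `|m j| <= Mm.
Implicit Types (x u : I -> R).
Notation Phi := (power_fun m W).

Definition gauss_avg u (rho : R) (F : (I -> R) -> R) x : \bar R :=
  (\int[mu]_y (F (x + y *: u) * normal_pdf 0 rho y)%:E)%E.

Lemma continuous_power_fun x u : continuous (fun t : R => Phi (x + t *: u)).
Proof.
move=> t; apply: differentiable_continuous; apply/derivable1_diffP.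
have : is_derive t (1 : R) (fun t : R => Phi (x + t *: u))
   (Phi (x + t *: u) * (\sum_j m j * ((partition_fun W j (x + t *: u))^-1
     * \sum_i (W j i * (u i * expR (x i + t * u i)))))).
  apply: is_derive1_comp; apply: (@is_derive_bigsum _ _ _ _ (fun j t =>
    m j * ((partition_fun W j (x + t *: u))^-1 *
       \sum_i (W j i * (u i * expR (x i + t * u i))))) _) => j.
  apply: is_derive_mulcl.
  apply: (is_derive1_comp (is_derive1_ln (partition_gt0 W0 W1 j _))).
  apply: (@is_derive_bigsum _ _ _ _ (fun i t => W j i * (u i * expR (x i + t * u i))) _) => i.
  apply: is_derive_mulcl; rewrite mulrC.
  apply: (is_derive1_comp (g := fun t => x i + t * u i)).
  have H := is_deriveD (is_derive_cst (x i) t (1 : R)) (is_derive_mulcl (u i) (is_derive_id t (1 : R))).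
  rewrite (_ : (fun t => x i + t * u i) = cst (x i) + (fun y => u i * y)).
    by apply: (is_derive_eq H); rewrite add0r mulr1.
  by apply/funext => y; rewrite /= mulrC.
by case.
Qed.

(** Gaussian and Rademacher steps of equal variance agree up to third order, relative to the value
    of [Phi]; the slack [eps] per unit of variance absorbs the remainder. *)
Lemma gauss_one_step (eps : R) : 0 < eps -> exists2 r0 : R, 0 < r0 & forall rho u x,
  0 < rho <= r0 -> (forall i, `|u i| <= A) ->
  (gauss_avg u rho Phi x <= (expR (rho ^+ 2 * eps) * halfstep (rho *: u) Phi x)%:E)%E.
Proof.
move=> e0.
have Mm0 : 0 <= Mm by apply: le_trans mM; apply: sumr_ge0.
have A0 : 0 <= A by exact: le_trans A1.
pose Bd : R := #|I|%:R ^+ 2 * ((2 * Mm + Mm ^+ 2) * A ^+ 2).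
have Bd0 : 0 <= Bd.
  by rewrite mulr_ge0 ?exprn_ge0// mulr_ge0 ?exprn_ge0// addr_ge0 ?mulr_ge0 ?exprn_ge0.
pose C2 := expansion_cst A Mm + 13 * (Mm * A) + 26 * Bd.
have X0 := expansion_cst_ge0 mM A1.
have MA0 : 0 <= Mm * A by rewrite mulr_ge0.
have C20 : 0 <= C2 by rewrite /C2; lra.
pose L := Mm * A + 1 + 1.
pose K := rem_cst A Mm + (20 * Bd + 12 * C2 * expR (L ^+ 2 / 2)).
have rc0 := rem_cst_ge0 A1 mM.
have K30 : 0 <= 20 * Bd + 12 * C2 * expR (L ^+ 2 / 2).
  apply: addr_ge0; first exact: mulr_ge0.
  by apply: mulr_ge0; [exact: mulr_ge0|exact: expR_ge0].
have K0 : 0 <= K by exact: addr_ge0.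
have [r0 /andP[r00 r01] Hr0] := second_order_compare K0 Bd0 (lexx 0) e0.
exists r0 => // rho u x /andP[rho0 rhor] uA.
have rho1 : rho <= 1 by exact: le_trans r01.
have rhoI : 0 < rho <= 1 by rewrite rho0.
have usA i : l1 [:: u] i <= A by rewrite /l1 big_seq1.
have P0 := power_fun_gt0 m W x.
pose b := quad m W x [:: u].
have bB : `|b| <= Bd by exact: quad_bound.
pose a := \sum_j m j * \sum_i gibbs W x j i * u i.
have aB : `|a| <= Mm * A.
  apply: (le_trans (ler_norm_sum _ _ _)); apply: le_trans (ler_wpM2r A0 mM).
  rewrite mulr_suml; apply: ler_sum => j _; rewrite normrM ler_wpM2l//.
  apply: (le_trans (ler_norm_sum _ _ _)).
  rewrite -[leRHS]mul1r -(gibbs_sum W0 W1 x j) mulr_suml; apply: ler_sum => i _.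
  by rewrite normrM (ger0_norm (gibbs_ge0 W0 W1 x j i)) ler_wpM2l// gibbs_ge0.
pose T := 6 * C2 * rho ^+ 3.
(* The terms a v and b v^2 are replaced by a sinh v and 2 b (cosh v - 1), the remainder by two
   exponentials at scale 1/rho, so that the majorant has an exact Gaussian mean. *)
pose l := [:: (1 - 2 * b, 0); (a / 2 + b, 1); (b - a / 2, -1);
   (T, L / rho); (T, - (L / rho))].
have [li le] := gauss_expsum l rho0.
have up v : Phi (x + v *: u) <= Phi x * \sum_(q <- l) q.1 * expR (q.2 * v).
  rewrite power_fun_ratio// ler_pM2l//.
  have := power_expansion (gibbs_ge0 W0 W1 x) (gibbs_sum W0 W1 x) uA mM A1 v.
  have -> : \sum_i \sum_i' hess_coef m (gibbs W x) i i' * (u i * u i') = b.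
    by apply: eq_bigr => i _; apply: eq_bigr => i' _; rewrite /cov big_seq1.
  rewrite -/a; set E := expR _; rewrite ler_norml => /andP[_ H].
  rewrite !big_cons big_nil /= mul0r expR0 mul1r mulN1r.
  have t1 := expR_taylor2 v; have t2 := expR_taylor2 (- v).
  rewrite normrN sqrrN in t2.
  set q := `|v| ^+ 3 * expR `|v| in t1 t2.
  have q0 : 0 <= q by rewrite mulr_ge0 ?exprn_ge0 ?expR_ge0.
  have cub := cube_exp_le v (addr_ge0 MA0 ler01) rhoI.
  rewrite -/L -/(L / rho) in cub.
  set c1 := expR (L / rho * v) in cub *; set c2 := expR (- (L / rho) * v) in cub *.
  set e1 := expR v in t1 *; set e2 := expR (- v) in t2 *.
  set Q := `|v| ^+ 3 * expR ((Mm * A + 1) * `|v|) in cub.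
  have qQ : q <= Q.
    rewrite ler_wpM2l ?exprn_ge0// ler_expR -[leLHS]mul1r ler_wpM2r//.
    by rewrite lerDr.
  have eQ : `|v| ^+ 3 * expR (Mm * A * `|v|) <= Q.
    rewrite ler_wpM2l ?exprn_ge0// ler_expR ler_wpM2r//.
    by rewrite lerDl.
  move: t1 t2; rewrite !ler_norml => /andP[t1a t1b] /andP[t2a t2b].
  have s1 : a * v <= a * ((e1 - e2) / 2) + (Mm * A) * (13 * q).
    rewrite -lerBlDl -mulrBr; apply: (le_trans (ler_norm _)); rewrite normrM.
    apply: ler_pM; [exact: normr_ge0|exact: normr_ge0|by []|].
    by rewrite ler_norml; apply/andP; split; lra.
  have s2 : b * v ^+ 2 <= b * (e1 + e2 - 2) + Bd * (26 * q).
    rewrite -lerBlDl -mulrBr; apply: (le_trans (ler_norm _)); rewrite normrM.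
    apply: ler_pM; [exact: normr_ge0|exact: normr_ge0|by []|].
    by rewrite ler_norml; apply/andP; split; lra.
  have s3 : expansion_cst A Mm * `|v| ^+ 3 * expR (Mm * A * `|v|) <= expansion_cst A Mm * Q.
    by rewrite -mulrA ler_wpM2l.
  have s4 : (Mm * A) * (13 * q) + Bd * (26 * q) <= (Mm * A) * (13 * Q) + Bd * (26 * Q).
    by rewrite lerD// ler_wpM2l// ler_pM2l.
  have s5 : C2 * Q <= C2 * (6 * rho ^+ 3 * (c1 + c2)) by rewrite ler_wpM2l.
  move: s1 s2 s3 s4 s5 H; rewrite /T /C2; set X := expansion_cst A Mm.
  set Y := X * `|v| ^+ 3 * expR _; move: (Mm * A) => MA.
  clearbody E a b e1 e2 c1 c2 q Q X Y Bd; clear; move=> *; lra.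
have Pc : continuous (fun t : R => Phi (x + t *: u)) by exact: continuous_power_fun.
have mPhi : measurable_fun setT (fun y : R => Phi (x + y *: u)).
  exact: continuous_measurable_fun.
apply: (@le_trans _ _ (\int[mu]_y ((Phi x)%:E *
   ((\sum_(q <- l) q.1 * expR (q.2 * y)) * normal_pdf 0 rho y)%:E))%E).
  apply: ge0_le_integral => //=.
  - move=> y _; rewrite lee_fin.
    exact: mulr_ge0 (ltW (power_fun_gt0 _ _ _)) (normal_pdf_ge0 _ _ _).
  - apply/measurable_EFinP/measurable_funM => //; exact: measurable_normal_pdf.
  - by apply: measurable_funeM; case/integrableP: li.
  - move=> y _; have := ler_wpM2r (normal_pdf_ge0 0 rho y) (up y).
    by rewrite -[leRHS]mulrA -lee_fin [X in (_ <= X)%E]EFinM; exact.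
rewrite integralZl// le -EFinM lee_fin.
have rE (c : R) : (c / rho) ^+ 2 * rho ^+ 2 / 2 = c ^+ 2 / 2.
  by field; rewrite gt_eqF.
rewrite !big_cons big_nil /= !sqrrN !rE expr0n /= !mul0r expR0 !mulr1 expr1n mul1r.
set w := rho ^+ 2 / 2; set eL := expR (L ^+ 2 / 2).
have w0 : 0 <= w by rewrite divr_ge0 ?exprn_ge0 ?(ltW rho0).
have rr1 : rho ^+ 2 <= 1 by rewrite exprn_ile1// ltW.
have w1 : w <= 2^-1 by rewrite ler_pdivrMr// mulVf.
have ew : `|expR w - 1 - w| <= 40 * w ^+ 2.
  have := expR_taylor2 w; rewrite (ger0_norm w0) mulrA => h.
  have e3 : expR w <= 3.
    have := expR_ge1Dx (- w); rewrite expRN => h1.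
    have : 2^-1 <= (expR w)^-1 by apply: le_trans h1; lra.
    by rewrite lef_pV2 ?posrE ?expR_gt0// => h2; apply: (le_trans h2); lra.
  have h3 : 13 * w ^+ 3 * expR w <= 39 * w ^+ 2.
    have hh : w * expR w <= 2^-1 * 3 by rewrite ler_pM ?expR_ge0.
    have w20 : 0 <= 13 * w ^+ 2 by rewrite mulr_ge0// exprn_ge0.
    have := ler_wpM2l w20 hh; rewrite (_ : 13 * w ^+ 3 * expR w = 13 * w ^+ 2 * (w * expR w)); last by ring.
    lra.
  move: h; rewrite !ler_norml => /andP[h1 h2].
  have := exprn_ge0 2 w0 => w20.
  by apply/andP; split; lra.
have bw : 2 * b * (expR w - 1) <= b * rho ^+ 2 + 20 * Bd * rho ^+ 3.
  have -> : b * rho ^+ 2 = 2 * b * w by rewrite /w; field.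
  rewrite -lerBlDl -mulrBr -mulrA [expR w - 1 - w]lock -lock.
  have h : b * (expR w - 1 - w) <= Bd * (40 * w ^+ 2).
    by apply: (le_trans (ler_norm _)); rewrite normrM ler_pM.
  have h' : Bd * (40 * w ^+ 2) <= Bd * (10 * rho ^+ 3).
    rewrite ler_wpM2l// /w (_ : 40 * (rho ^+ 2 / 2) ^+ 2 = 10 * rho ^+ 3 * rho); last by field.
    by rewrite ler_piMr// mulr_ge0// exprn_ge0// ltW.
  lra.
have Hle := Hr0 rho b b (introT andP (conj rho0 rhor)).
have {}Hle := Hle (_ : b <= b + 0) bB; rewrite addr0 lexx add0r in Hle.
have := one_step W0 W1 A1 mM x usA rhoI; rewrite ler_distl => /andP[lo _].
rewrite -/b /= in lo.
apply: (@le_trans _ _ (Phi x * (expR (rho ^+ 2 * eps) * (1 + rho ^+ 2 * b - K * rho ^+ 3)))).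
  rewrite ler_pM2l//; apply: le_trans (Hle isT).
  have -> : K * rho ^+ 3 = rem_cst A Mm * rho ^+ 3 + 20 * Bd * rho ^+ 3 + 2 * (T * eL).
    by rewrite /K /T -/eL; ring.
  have := mulr_ge0 rc0 (exprn_ge0 3 (ltW rho0)).
  lra.
rewrite mulrCA ler_wpM2l ?expR_ge0//; apply: le_trans lo.
rewrite -mulrBr ler_pM2l// lerB// ler_wpM2r ?exprn_ge0 ?(ltW rho0)//.
by rewrite /K lerDl.
Qed.

End Smooth.
End GaussWalk.

(** * Doubling the variance of a Gaussian average *)

Section GaussDouble.
Context {R : realType} {I : finType}.
Notation mu := (@lebesgue_measure R).
Implicit Types (x u w : I -> R) (F B : (I -> R) -> R).

(** Averages are taken over one Gaussian direction at a time, so continuity along lines gives all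
    the measurability required. *)
Definition line_continuous F := forall x u, continuous (fun t : R => F (x + t *: u)).

Lemma line_continuous_halfstep w F : line_continuous F -> line_continuous (halfstep w F).
Proof.
move=> cF x u t.
have -> : (fun t : R => halfstep w F (x + t *: u)) =
   (fun t => (F ((x + w) + t *: u) + F ((x - w) + t *: u)) / 2).
  by apply/funext => s; rewrite /halfstep addrAC (addrAC x _ (- w)).
apply: cvgM; last exact: cvg_cst.
by apply: cvgD; exact: cF.
Qed.

Lemma line_continuous_iter n us F : line_continuous F ->
  line_continuous (iter n (step us) F).
Proof.
move=> cF; elim: n => //= n; move: (iter n _ _) => G cG.
by elim: us => //= w us IH; exact: line_continuous_halfstep.
Qed.

Lemma iter_step_ge0 n us F : (forall x, 0 <= F x) -> forall x, 0 <= iter n (step us) F x.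
Proof.
move=> F0 x; have := iter_step_le n us (F := fun _ => 0) F0 x.
rewrite (_ : iter n (step us) (fun _ => 0) = fun _ => 0)//.
elim: n {x} => //= n ->; elim: us => //= w us ->.
by apply/funext => x; rewrite /halfstep addr0 mul0r.
Qed.

Lemma gauss_avg_halfstep u w (rho : R) F B : line_continuous F -> (forall x, 0 <= F x) ->
  (forall x, gauss_avg u rho F x <= (B x)%:E)%E ->
  forall x, (gauss_avg u rho (halfstep w F) x <= (halfstep w B x)%:E)%E.
Proof.
move=> cF F0 H x; rewrite /gauss_avg.
have mF y : measurable_fun setT (fun t : R => (F (y + t *: u) * normal_pdf 0 rho t)%:E).
  apply/measurable_EFinP/measurable_funM; last exact: measurable_normal_pdf.
  by apply: continuous_measurable_fun; exact: cF.
have f0 y t : (0 <= (F (y + t *: u) * normal_pdf 0 rho t)%:E)%E.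
  by rewrite lee_fin mulr_ge0 ?normal_pdf_ge0.
have -> : (\int[mu]_y (halfstep w F (x + y *: u) * normal_pdf 0 rho y)%:E =
  \int[mu]_y ((2^-1)%:E * ((F ((x + w) + y *: u) * normal_pdf 0 rho y)%:E +
     (F ((x - w) + y *: u) * normal_pdf 0 rho y)%:E)))%E.
  apply: eq_integral => y _; rewrite -EFinD -EFinM; congr EFin.
  by rewrite /halfstep addrAC (addrAC x _ (- w)); ring.
rewrite ge0_integralZl//=; first last.
- by move=> y _; apply: adde_ge0; exact: f0.
- by apply: emeasurable_funD; exact: mF.
rewrite ge0_integralD//=; try by [exact: mF|move=> y _; exact: f0].
rewrite /halfstep mulrC EFinM lee_wpmul2l ?lee_fin// EFinD; apply: leeD; exact: H.
Qed.

Lemma gauss_avg_iter u (rho : R) us n F B : line_continuous F -> (forall x, 0 <= F x) ->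
  (forall x, gauss_avg u rho F x <= (B x)%:E)%E ->
  forall x, (gauss_avg u rho (iter n (step us) F) x <= (iter n (step us) B x)%:E)%E.
Proof.
move=> cF F0 H; elim: n => //= n IH.
move: (@line_continuous_iter n us _ cF) (@iter_step_ge0 n us _ F0) IH.
move: (iter n _ F) (iter n _ B) => {cF F0 H} F' B' cF F0 H.
have : [/\ line_continuous (step us F'), forall x, 0 <= step us F' x &
  forall x, (gauss_avg u rho (step us F') x <= (step us B' x)%:E)%E]; last by case.
elim: us => //= w us [c0 p0 h0]; split.
- exact: line_continuous_halfstep.
- by move=> x; rewrite divr_ge0// addr_ge0.
- exact: gauss_avg_halfstep.
Qed.

(** Half of the variance is averaged inside, where the hypothesis turns it into [k] steps. These
    commute with the outer average, to which the hypothesis applies again; the constant is squared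
    and the number of steps doubled. *)
Lemma gauss_avg_double u (rho c : R) us k F : 0 < rho -> 0 <= c ->
  line_continuous F -> (forall x, 0 <= F x) ->
  (forall x, gauss_avg u rho F x <= (c * iter k (step us) F x)%:E)%E ->
  forall x, (gauss_avg u (Num.sqrt 2 * rho)%R F x <= (c ^+ 2 * iter (k + k) (step us) F x)%:E)%E.
Proof.
move=> r0 c0 cF F0 H x.
have cx : continuous (fun t : R => F (x + t *: u)) by move=> t; exact: cF.
rewrite {1}/gauss_avg (gauss_semigroup r0 cx (fun t => F0 _)).
have E y : (\int[mu]_w (F (x + (y + w) *: u) * normal_pdf 0 rho w)%:E =
    gauss_avg u rho F (x + y *: u)%R)%E.
  by apply: eq_integral => w _; rewrite scalerDl addrA.
under eq_integral do rewrite E.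
have cI := @line_continuous_iter k us _ cF.
have I0 := @iter_step_ge0 k us _ F0.
have mI y : measurable_fun setT (fun t : R => iter k (step us) F (y + t *: u)).
  by apply: continuous_measurable_fun; exact: cI.
apply: (@le_trans _ _ (\int[mu]_y (c%:E * (iter k (step us) F (x + y *: u) * normal_pdf 0 rho y)%:E))%E).
  apply: ge0_le_integral => //=.
  - move=> y _; rewrite mule_ge0 ?lee_fin ?normal_pdf_ge0//.
    by apply: integral_ge0 => t _; rewrite lee_fin mulr_ge0 ?normal_pdf_ge0.
  - apply: emeasurable_funM; last by apply/measurable_EFinP; exact: measurable_normal_pdf.
    have -> : (fun y : R => gauss_avg u rho F (x + y *: u)) = fubini_F mu
      (fun q : measurableTypeR R * measurableTypeR R =>
         (F (x + (q.1 + q.2) *: u) * normal_pdf 0 rho q.2)%:E).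
      by apply/funext => y; rewrite -E.
    apply: measurable_fun_fubini_tonelli_F.
      apply/measurable_EFinP/measurable_funM; last first.
        by apply: measurableT_comp; [exact: measurable_normal_pdf|exact: measurable_snd].
      apply: (@measurableT_comp _ _ _ _ _ _ (fun t : R => F (x + t *: u))).
        by apply: continuous_measurable_fun; exact: cF.
      by apply: measurable_funD; [exact: measurable_fst|exact: measurable_snd].
    by move=> q; rewrite lee_fin mulr_ge0 ?normal_pdf_ge0.
  - apply: measurable_funeM; apply/measurable_EFinP/measurable_funM; first exact: mI.
    exact: measurable_normal_pdf.
  - move=> y _; have p0 : (0 <= (normal_pdf 0 rho y)%:E)%E by rewrite lee_fin normal_pdf_ge0.
    apply: (le_trans (lee_wpmul2r p0 (H (x + y *: u)))).
    by rewrite -!EFinM mulrA lexx.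
rewrite ge0_integralZl//=; first last.
- by move=> y _; rewrite lee_fin mulr_ge0 ?normal_pdf_ge0.
- by apply/measurable_EFinP/measurable_funM; [exact: mI|exact: measurable_normal_pdf].
rewrite expr2 -mulrA EFinM lee_wpmul2l ?lee_fin//.
have := @gauss_avg_iter _ _ us k _ _ cF F0 H x.
by rewrite iter_step_mull iterD.
Qed.

End GaussDouble.

(** * Gaussian averages and grid averages bounded by walks *)

Section GaussLink.
Context {R : realType} {I J : finType}.
Notation mu := (@lebesgue_measure R).
Variables (m : J -> R) (W : J -> I -> R).
Hypothesis W0 : forall j i, 0 <= W j i.
Hypothesis W1 : forall j, exists i, 0 < W j i.
Variables (A Mm : R).
Hypothesis A1 : 1 <= A.
Hypothesis mM : \sum_j `|m j| <= Mm.
Notation Phi := (power_fun m W).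
Implicit Types (x u : I -> R).

(** At the scale s / sqrt(2^l) a Gaussian average is compared with a single Rademacher step; l
    doublings bring it to standard deviation [s]. The slack was chosen as eps / s^2 per unit of
    variance, so it totals [eps]. *)
Lemma gauss_le_walk (s eps : R) : 0 < s -> 0 < eps -> exists l0, forall l, (l0 <= l)%N ->
  forall u x, (forall i, `|u i| <= A) ->
  (gauss_avg u s Phi x <= (expR eps *
     iter (2 ^ l) (step [:: (Num.sqrt (2 ^ l)%:R)^-1 *: (s *: u)]) Phi x)%:E)%E.
Proof.
move=> s0 e0.
have e1 : 0 < eps / s ^+ 2 by rewrite divr_gt0// exprn_gt0.
have [r0 r00 Hr0] := gauss_one_step W0 W1 A1 mM e1.
have rs0 : 0 < r0 / s by rewrite divr_gt0.
have [n0 Hn0] := large_invsqrt rs0.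
exists n0 => l ll0 u x uA.
have n0l : (n0 <= 2 ^ l)%N by apply: (leq_trans ll0); rewrite ltnW// ltn_expl.
have [n_gt0 Hn] := Hn0 _ n0l.
pose rho := (Num.sqrt (2 ^ l)%:R)^-1 * s.
have rho0 : 0 < rho by rewrite mulr_gt0// invr_gt0 sqrtr_gt0 ltr0n.
have rhor : rho <= r0 by rewrite -ler_pdivlMr.
have cP : line_continuous Phi by move=> y w; exact: continuous_power_fun.
have P0 y : 0 <= Phi y by rewrite ltW// power_fun_gt0.
have q0 : 0 < Num.sqrt (2 : R) by rewrite sqrtr_gt0.
have key j : forall y, (gauss_avg u (Num.sqrt 2 ^+ j * rho)%R Phi y <=
   (expR (rho ^+ 2 * (eps / s ^+ 2)) ^+ (2 ^ j) * iter (2 ^ j) (step [:: rho *: u]) Phi y)%:E)%E.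
  elim: j => [|j IH] y.
    by rewrite expn0 !expr1 expr0 mul1r; apply: Hr0 => //; rewrite rho0.
  rewrite exprS -mulrA.
  have := gauss_avg_double (mulr_gt0 (exprn_gt0 j q0) rho0)
    (exprn_ge0 (2 ^ j) (expR_ge0 _)) cP P0 IH y.
  by rewrite -exprM -expnSr addnn -mul2n -expnS.
have := key l x.
have -> : Num.sqrt 2 ^+ l * rho = s.
  have sE k : Num.sqrt ((2 : R) ^+ k) = Num.sqrt 2 ^+ k.
    by elim: k => [|k IH]; rewrite ?expr0 ?sqrtr1// !exprS sqrtrM// IH.
  by rewrite /rho natrX sE mulrA divff ?mul1r// gt_eqF// exprn_gt0.
have -> : expR (rho ^+ 2 * (eps / s ^+ 2)) ^+ (2 ^ l) = expR eps.
  rewrite -expRM_natl; congr expR; rewrite /rho exprMn exprVn sqr_sqrtr ?ler0n//.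
  by field; rewrite gt_eqF// gt_eqF// ltr0n.
by rewrite scalerA.
Qed.

Lemma power_fun_lip x u (t t' : R) : (forall i, `|u i| <= A) ->
  Phi (x + t *: u) <= expR (Mm * A * `|t - t'|) * Phi (x + t' *: u).
Proof.
move=> uA.
have -> : x + t *: u = (x + t' *: u) + (t - t') *: u.
  by rewrite -addrA -scalerDl (addrC t') subrK.
rewrite (power_fun_ratio _ W0 W1) [leLHS]mulrC; apply: ler_wpM2r.
  exact: ltW (power_fun_gt0 _ _ _).
exact: power_growth (gibbs_ge0 W0 W1 _) (gibbs_sum W0 W1 _) uA _ mM A1 _.
Qed.

Definition grid_cell (c d : R) : set R := `[c, c + d[%classic.

(** On a cell, [Phi] at the left endpoint exceeds its other values by at most the factor in
    [power_fun_lip], and the disjoint cells together carry at most the full integral. *)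
Lemma grid_le_gauss (s d : R) (G : nat) (c : nat -> R) u x : 0 < d ->
  (forall g, c g.+1 = c g + d) -> (forall i, `|u i| <= A) ->
  (\sum_(g < G) (Phi (x + c g *: u))%:E * normal_prob 0 s (grid_cell (c g) d) <=
   (expR (Mm * A * d))%:E * gauss_avg u s Phi x)%E.
Proof.
move=> d0 cS uA.
have mP : measurable_fun setT (fun t : R => Phi (x + t *: u)).
  by apply: continuous_measurable_fun; exact: continuous_power_fun.
have mp : measurable_fun setT (@normal_pdf R 0 s) by exact: measurable_normal_pdf.
have P0 y : 0 <= Phi y by rewrite ltW// power_fun_gt0.
pose f (y : R) := ((expR (Mm * A * d))%:E * (Phi (x + y *: u) * normal_pdf 0 s y)%:E)%E.
have mf : measurable_fun setT f.
  by apply: measurable_funeM; apply/measurable_EFinP/measurable_funM.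
have f0 y : (0 <= f y)%E by rewrite mule_ge0// lee_fin ?expR_ge0// mulr_ge0 ?normal_pdf_ge0.
apply: (@le_trans _ _ (\int[mu]_y f y)%E); last first.
  rewrite ge0_integralZl//=.
  - by apply/measurable_EFinP/measurable_funM.
  - by move=> y _; rewrite lee_fin mulr_ge0 ?normal_pdf_ge0.
apply: (@le_trans _ _ (\sum_(g < G) \int[mu]_(y in grid_cell (c g) d) f y)%E).
  apply: lee_sum => g _.
  have mc : measurable (grid_cell (c g) d) by exact: measurable_itv.
  have -> : ((Phi (x + c g *: u))%:E * normal_prob 0 s (grid_cell (c g) d) =
    \int[mu]_(y in grid_cell (c g) d) ((Phi (x + c g *: u))%:E * (normal_pdf 0 s y)%:E))%E.
    rewrite ge0_integralZl//=.
    - by apply/measurable_EFinP; exact: measurable_funTS.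
    - by move=> y _; rewrite lee_fin normal_pdf_ge0.
    - by rewrite lee_fin; exact: P0.
  apply: ge0_le_integral => //=.
  - by move=> y _; rewrite mule_ge0// lee_fin ?normal_pdf_ge0//; exact: P0.
  - by apply: measurable_funeM; apply/measurable_EFinP; exact: measurable_funTS.
  - exact: measurable_funTS.
  - move=> y; rewrite /grid_cell/= in_itv/= => /andP[cy yc].
    rewrite /f -!EFinM lee_fin (mulrA (expR _)).
    apply: ler_wpM2r; first exact: normal_pdf_ge0.
    apply: (le_trans (power_fun_lip x (c g) y uA)); apply: ler_wpM2r; first exact: P0.
    rewrite ler_expR; apply: ler_wpM2l.
      apply: mulr_ge0; last exact: le_trans A1.
      by apply: le_trans mM; apply: sumr_ge0.
    by rewrite distrC ger0_norm ?subr_ge0//; lra.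
have cE g : c g = c 0%N + g%:R * d.
  elim: g => [|g IH]; first by rewrite mul0r addr0.
  by rewrite cS IH -natr1; ring.
have tri : trivIset [set` index_enum 'I_G] (fun g : 'I_G => grid_cell (c g) d).
  apply/trivIsetP => g h _ _ gh; apply/seteqP; split=> // y [].
  rewrite /grid_cell/= !in_itv/= => /andP[g1 g2] /andP[h1 h2].
  have step_le (a b : nat) : (a < b)%N -> c a + d <= c b.
    by move=> ab; rewrite -cS (cE a.+1) (cE b) lerD2l ler_pM2r// ler_nat.
  have : (g < h)%N || (h < g)%N by rewrite -neq_ltn.
  case/orP => /step_le hh.
    by have := lt_le_trans g2 (le_trans hh h1); rewrite ltxx.
  by have := lt_le_trans h2 (le_trans hh g1); rewrite ltxx.
rewrite -(@ge0_integral_bigsetU _ _ _ mu 'I_G (fun g => grid_cell (c g) d) f (index_enum _))//.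
- apply: ge0_subset_integral => //.
  by apply: bigsetU_measurable => g _; exact: measurable_itv.
- by move=> g; exact: measurable_itv.
- exact: index_enum_uniq.
- exact: measurable_funTS.
Qed.

(* [gridop u] averages over the discretized Gaussian law of standard deviation [s]. *)
Definition gridop (s d : R) (G : nat) (c : nat -> R) u (F : (I -> R) -> R) x : R :=
  \sum_(g < G) F (x + c g *: u) * fine (normal_prob 0 s (grid_cell (c g) d)).

Lemma gridop_step s d G c u us F :
  gridop s d G c u (step us F) = step us (gridop s d G c u F).
Proof.
have H w F' : gridop s d G c u (halfstep w F') = halfstep w (gridop s d G c u F').
  apply/funext => x; rewrite /gridop /halfstep -big_split mulr_suml; apply: eq_bigr => g _.
  by rewrite /= addrAC (addrAC x _ (- w)); ring.
by elim: us => //= w us IH; rewrite H IH.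
Qed.

Lemma gridop_iter s d G c u us F n :
  gridop s d G c u (iter n (step us) F) = iter n (step us) (gridop s d G c u F).
Proof. by elim: n => //= n IH; rewrite gridop_step IH. Qed.

Lemma gridop_le s d G c u F F' : (forall x, F x <= F' x) ->
  forall x, gridop s d G c u F x <= gridop s d G c u F' x.
Proof.
by move=> H x; apply: ler_sum => g _; rewrite ler_wpM2r// fine_ge0.
Qed.

Lemma gridop_mull s d G c u (a : R) F x :
  gridop s d G c u (fun y => a * F y) x = a * gridop s d G c u F x.
Proof. by rewrite /gridop mulr_sumr; apply: eq_bigr => g _; rewrite mulrA. Qed.

(** Grid averages stand in for a multivariate Gaussian integral. They commute with walk steps, so
    directions are converted one at a time, each at the price of [2 * eps]. *)
Theorem grid_le_walk (s eps : R) (us : seq (I -> R)) : 0 < s -> 0 < eps ->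
  (forall u, u \in us -> forall i, `|u i| <= A) ->
  exists l0, forall l, (l0 <= l)%N -> forall d G c,
  0 < d -> Mm * A * d <= eps -> (forall g, c g.+1 = c g + d) ->
  foldr (gridop s d G c) Phi us 0 <=
    expR (2 * eps * (size us)%:R) * gE (2 ^ l) [seq s *: u | u <- us] Phi.
Proof.
move=> s0 e0 usA; have [l0 Hl0] := gauss_le_walk s0 e0.
exists l0 => l ll0 d G c d0 de cS.
have one u x : u \in us -> gridop s d G c u Phi x <=
    expR (2 * eps) * iter (2 ^ l) (step [:: (Num.sqrt (2 ^ l)%:R)^-1 *: (s *: u)]) Phi x.
  move=> uus; have uA := usA u uus.
  have h1 := grid_le_gauss s G x d0 cS uA; have h2 := Hl0 l ll0 u x uA.
  rewrite -lee_fin /gridop -sumEFin.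
  apply: (@le_trans _ _ (\sum_(g < G) (Phi (x + c g *: u))%:E * normal_prob 0 s (grid_cell (c g) d))%E).
    apply: lee_sum => g _; rewrite EFinM fineK//.
    by rewrite fin_num_measure//; exact: measurable_itv.
  apply: (le_trans h1).
  have h3 : (0 <= (expR (Mm * A * d))%:E)%E by rewrite lee_fin expR_ge0.
  apply: (le_trans (lee_wpmul2l h3 h2)); rewrite -EFinM lee_fin mulrA; apply: ler_wpM2r.
    by apply: iter_step_ge0 => y; exact: ltW (power_fun_gt0 _ _ _).
  by rewrite -expRD ler_expR; lra.
have gen : forall vs, {subset vs <= us} -> forall x, foldr (gridop s d G c) Phi vs x <=
    expR (2 * eps * (size vs)%:R) *
    iter (2 ^ l) (step [seq (Num.sqrt (2 ^ l)%:R)^-1 *: v | v <- [seq s *: u | u <- vs]]) Phi x.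
  elim=> [|u vs IH] sub x /=.
    rewrite mulr0 expR0 mul1r (_ : iter (2 ^ l) (step [::]) Phi = Phi)//.
    by elim: (2 ^ l)%N => //= n ->.
  have sub' : {subset vs <= us} by move=> w wv; apply: sub; rewrite inE wv orbT.
  apply: (le_trans (gridop_le _ _ _ _ _ (IH sub') x)).
  rewrite gridop_mull gridop_iter.
  have uus : u \in us by apply: sub; rewrite inE eqxx.
  have h := iter_step_le (2 ^ l) [seq (Num.sqrt (2 ^ l)%:R)^-1 *: v | v <- [seq s *: u | u <- vs]]
     (fun y => one u y uus) x.
  apply: (le_trans (ler_wpM2l (expR_ge0 _) h)); rewrite iter_step_mull mulrA -expRD.
  rewrite (_ : 2 * eps * (size vs)%:R + 2 * eps = 2 * eps * (size vs).+1%:R); last first.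
    by rewrite -natr1; ring.
  apply: ler_wpM2l; first exact: expR_ge0.
  rewrite -iter_step_cat.
  have -> // : forall n (a : I -> R) bs F, iter n (step (bs ++ [:: a])) F = iter n (step (a :: bs)) F.
  by move=> n a bs F; rewrite iter_step_cat -[a :: bs]cat1s iter_step_cat iter_stepC.
exact: (gen us (fun _ h => h) 0).
Qed.

End GaussLink.

(** * From Gaussian disorder to random walks *)
Section Disorder.
Context {R : realType}.

Section GridSum.
Context {T I : finType}.
Variables (G : nat) (op : 'I_G.+1 -> R) (c : 'I_G.+1 -> R) (w : T -> I -> R).

Definition upd (y : {ffun T -> 'I_G.+1}) (f : T) (g : 'I_G.+1) : {ffun T -> 'I_G.+1} :=
  [ffun h => if h == f then g else y h].

(** Iterated one-dimensional averages become one sum over boxes of disorder values. Coordinates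
    outside [fs] are frozen at [ord0] so that each choice on [fs] is counted once. *)
Lemma foldr_grid_sum (fs : seq T) (F : (I -> R) -> R) x : uniq fs ->
  foldr (fun f (H : (I -> R) -> R) x => \sum_(g < G.+1) H (x + c g *: w f) * op g) F fs x =
  \sum_(y : {ffun T -> 'I_G.+1} | [forall f, (f \notin fs) ==> (y f == ord0)])
     F (x + \sum_(f <- fs) c (y f) *: w f) * \prod_(f <- fs) op (y f).
Proof.
elim: fs x => [|f fs IH] x /=.
  move=> _; rewrite (bigD1 [ffun=> ord0])/=; last first.
    by apply/forallP => f; rewrite ffunE.
  rewrite [X in _ = _ + X]big1 ?addr0; last first.
    move=> y /andP[/forallP H /eqP ne].
    by case: ne; apply/ffunP => f; rewrite ffunE; apply/eqP; exact: (H f).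
  by rewrite !big_nil addr0 mulr1.
move=> /andP[ffs us].
rewrite [RHS](partition_big (fun y : {ffun T -> 'I_G.+1} => y f) predT)//=.
apply: eq_bigr => g _; rewrite IH// mulr_suml.
rewrite [RHS](reindex_onto (fun y => upd y f g) (fun y => upd y f ord0)) /=; last first.
  move=> y /andP[_ /eqP yf]; apply/ffunP => h; rewrite !ffunE.
  by case: eqP => // ->.
apply: eq_big => [y|y /forallP Hy].
  apply/idP/idP => [/forallP H|/andP[/andP[/forallP H _] /eqP e]].
    rewrite ffunE eqxx eqxx andbT; apply/andP; split.
      apply/forallP => h; apply/implyP; rewrite inE negb_or => /andP[hf hfs].
      by rewrite ffunE (negbTE hf); have := H h; rewrite hfs.
    apply/eqP/ffunP => h; rewrite !ffunE; case: eqP => // ->.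
    by apply/esym/eqP; have := H f; rewrite ffs.
  apply/forallP => h; apply/implyP => hfs.
  have [->|hf] := eqVneq h f; first by rewrite -e !ffunE eqxx.
  by have := H h; rewrite inE negb_or hf hfs/= ffunE (negbTE hf).
have E h : h \in fs -> upd y f g h = y h.
  by move=> hfs; rewrite ffunE; case: eqP => // hf; rewrite -hf hfs in ffs.
rewrite !big_cons ffunE eqxx -mulrA [op g * _]mulrC addrA; congr (F (_ + _) * (_ * _)).
  by apply: eq_big_seq => h hfs; rewrite E.
by apply: eq_big_seq => h hfs; rewrite E.
Qed.

End GridSum.

Section Law.
Context {d : measure_display} {Omega : measurableType d} (P : probability Omega R).

Lemma boole (K : Type) (r : seq K) (Q : pred K) (A : K -> set Omega) :
  (forall k, Q k -> measurable (A k)) ->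
  (P (\big[setU/set0]_(k <- r | Q k) A k) <= \sum_(k <- r | Q k) P (A k))%E.
Proof.
move=> mA; elim: r => [|k r IH]; first by rewrite !big_nil measure0.
rewrite !big_cons; case: ifPn => // Qk.
have mU : measurable (\big[setU/set0]_(k <- r | Q k) A k) by exact: bigsetU_measurable.
set U := \big[setU/set0]_(k <- r | Q k) A k in IH mU *.
have -> : A k `|` U = A k `|` (U `\` A k).
  apply/seteqP; split=> x [] hx; first by left.
  - by have [?|?] := pselect (A k x); [left|right].
  - by left.
  - by right; case: hx.
rewrite measureU//; last first.
- by apply/seteqP; split=> // x [? []].
- by apply: measurableD => //; exact: mA.
- exact: mA.
rewrite leeD2l//; apply: le_trans IH; apply: le_measure; rewrite ?inE//.
by apply: measurableD => //; exact: mA.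
Qed.

Variables (p N : nat) (J : {ffun 'I_p -> 'I_N} -> Omega -> R).
Hypothesis HJ : gaussian_disorder P J.
Hypothesis N_gt0 : (0 < N)%N.
Notation T := {ffun 'I_p -> 'I_N}.
Notation sd := (sdev R p N).

Lemma sdev_gt0 : 0 < sd.
Proof. by rewrite sqrtr_gt0 invr_gt0 exprn_gt0// ltr0n. Qed.

Definition tail_set (k : R) : set R := ~` `]- k, k[%classic.

Lemma normal_tail (s k : R) : 0 < s ->
  (normal_prob 0 s (tail_set k) <= (2 * expR (s ^+ 2 / 2) * expR (- k))%:E)%E.
Proof.
move=> s0; pose l : seq (R * R) := [:: (expR (- k), 1); (expR (- k), -1)].
have [li le] := gauss_expsum l s0.
have -> : 2 * expR (s ^+ 2 / 2) * expR (- k) = \sum_(q <- l) q.1 * expR (q.2 ^+ 2 * s ^+ 2 / 2).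
  by rewrite !big_cons big_nil/= sqrrN expr1n mul1r; ring.
have f0 y : 0 <= (\sum_(q <- l) q.1 * expR (q.2 * y)) * normal_pdf 0 s y.
  rewrite mulr_ge0 ?normal_pdf_ge0// !big_cons big_nil/=.
  by rewrite !addr_ge0// mulr_ge0// expR_ge0.
have mC : measurable (tail_set k : set (measurableTypeR R)).
  by apply: measurableC; exact: measurable_itv.
rewrite -le; apply: (@le_trans _ _ (\int[lebesgue_measure]_(y in tail_set k)
   ((\sum_(q <- l) q.1 * expR (q.2 * y)) * normal_pdf 0 s y)%:E)%E).
  apply: ge0_le_integral => //=.
  - by move=> y _; rewrite lee_fin normal_pdf_ge0.
  - by apply/measurable_EFinP/measurable_funTS; exact: measurable_normal_pdf.
  - by apply: measurable_funTS; case/integrableP: li.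
  - move=> y; rewrite /tail_set/= in_itv/= => /negP; rewrite negb_and -!leNgt => yk.
    rewrite lee_fin ler_peMl ?normal_pdf_ge0// !big_cons big_nil/= mul1r mulN1r addr0.
    rewrite -!expRD; case/orP: yk => yk.
      by rewrite ler_wpDl ?expR_ge0// -[leLHS]expR0 ler_expR; lra.
    by rewrite ler_wpDr ?expR_ge0// -[leLHS]expR0 ler_expR; lra.
apply: ge0_subset_integral => //=; first by case/integrableP: li.
by move=> y _; rewrite lee_fin; exact: f0.
Qed.

Lemma disorder_tail (eps : R) : 0 < eps -> exists Rm : R, 0 < Rm /\
  exists B : set Omega, [/\ measurable B, (P B <= eps%:E)%E &
    forall om, ~ B om -> forall f, incr f -> `|J f om| < Rm].
Proof.
move=> e0; case: HJ => mJ [lawJ _].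
pose C : R := #|T|%:R * (2 * expR (sd ^+ 2 / 2)).
have C0 : 0 <= C by rewrite mulr_ge0// mulr_ge0// expR_ge0.
pose k : R := (C / eps) + 1.
have k0 : 0 < k by rewrite ltr_wpDl// divr_ge0// ltW.
exists k; split=> //.
have mk : measurable (tail_set k).
  by apply: measurableC; exact: measurable_itv.
exists (\big[setU/set0]_(f : T | incr f) (J f @^-1` (tail_set k))); split.
- apply: bigsetU_measurable => f fi; rewrite -[X in measurable X]setTI.
  exact: mJ.
- apply: (le_trans (boole _ _)) => [f fi|].
    by rewrite -[X in measurable X]setTI; exact: mJ.
  apply: (@le_trans _ _ (\sum_(f : T) (2 * expR (sd ^+ 2 / 2) * expR (- k))%:E)%E).
    rewrite big_mkcond/=; apply: lee_sum => f _; case: ifPn => [fi|_].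
      by rewrite lawJ//; apply: normal_tail; exact: sdev_gt0.
    by rewrite lee_fin mulr_ge0 ?expR_ge0// mulr_ge0// expR_ge0.
  rewrite sumEFin lee_fin sumr_const.
  have -> : 2 * expR (sd ^+ 2 / 2) * expR (- k) *+ #|T| = C / expR k.
    by rewrite -[LHS]mulr_natl expRN /C mulrA.
  rewrite ler_pdivrMr ?expR_gt0// mulrC -ler_pdivrMr//.
  by apply: le_trans (expR_ge1Dx _); rewrite /k; lra.
- move=> om nB f fi; rewrite ltNge; apply/negP => h; apply: nB.
  rewrite big_mkcond -bigcup_seq; exists f; first exact: mem_index_enum.
  rewrite fi /preimage /tail_set/= in_itv/= => /andP[h1 h2].
  by move: h; rewrite leNgt ltr_norml h1 h2.
Qed.

(** A Markov inequality for the disorder. Independence is given for boxes only and [E] need not be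
    measurable, so [B] is the union of the grid boxes meeting [E]; on each of them the functional is
    compared with its value at the corner. *)
Theorem disorder_le_walk (I K : finType) (w : T -> I -> R) (m : K -> R) (W : K -> I -> R)
    (Rm b eps : R) (E : set Omega) :
  (forall j i, 0 <= W j i) -> (forall j, exists i, 0 < W j i) ->
  0 < Rm -> 0 < b -> 0 < eps ->
  (forall om, E om -> forall f, incr f -> `|J f om| < Rm) ->
  (forall om, E om -> b <= power_fun m W (\sum_(f | incr f) J f om *: w f)) ->
  exists l0, forall l, (l0 <= l)%N -> exists B : set Omega,
    [/\ measurable B, E `<=` B & (b%:E * P B <= (expR eps *
       gE (2 ^ l) [seq sd *: w f | f <- enum T & incr f] (power_fun m W))%:E)%E].
Proof.
move=> W0 W1 Rm0 b0 e0 EJ Eb; case: HJ => mJ [lawJ indJ].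
pose A : R := 1 + \sum_f \sum_i `|w f i|.
have A1 : 1 <= A by rewrite lerDl; apply: sumr_ge0 => f _; apply: sumr_ge0.
have wA f i : `|w f i| <= A.
  rewrite /A (bigD1 f)//= (bigD1 i)//=.
  have h1 : 0 <= \sum_(i0 | i0 != i) `|w f i0| by apply: sumr_ge0.
  have h2 : 0 <= \sum_(i0 | i0 != f) \sum_i1 `|w i0 i1|.
    by apply: sumr_ge0 => ? _; apply: sumr_ge0.
  by move: h1 h2; set a := \sum_(_ | _) _; set c := \sum_(_ | _) _; lra.
pose Mm : R := \sum_j `|m j|; have mM : \sum_j `|m j| <= Mm by [].
have Mm0 : 0 <= Mm by apply: sumr_ge0.
pose fs := [seq f <- enum T | incr f].
have ufs : uniq fs by rewrite filter_uniq// enum_uniq.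
have memfs f : (f \in fs) = incr f by rewrite mem_filter mem_enum andbT.
pose us := [seq w f | f <- fs].
pose q : R := (size fs)%:R + 1.
have q0 : 0 < q by rewrite ltr_wpDl.
pose e1 : R := eps / (4 * q).
have e10 : 0 < e1 by rewrite divr_gt0// mulr_gt0.
have usA u : u \in us -> forall i, `|u i| <= A by move=> /mapP[f _ ->] i.
have [l0 Hl0] := grid_le_walk W0 W1 A1 mM sdev_gt0 e10 usA.
exists l0 => l ll0.
pose dd : R := e1 / (1 + Mm * A).
have MA0 : 0 <= Mm * A by rewrite mulr_ge0// (le_trans _ A1).
have dd0 : 0 < dd by rewrite divr_gt0// ltr_pwDl.
have MAd : Mm * A * dd <= e1.
  by rewrite /dd mulrC mulrAC ler_pdivrMr ?ltr_pwDl// ler_pM2l// lerDr.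
(* Starting from the corner [- Rm], the [G + 1] cells of width [dd] cover [-Rm, Rm]. *)
pose G := Num.truncn (2 * Rm / dd).
pose c (g : nat) : R := - Rm + g%:R * dd.
have cS g : c g.+1 = c g + dd by rewrite /c -natr1; ring.
pose cell (g : 'I_G.+1) := grid_cell (c g) dd.
have mcell g : measurable (cell g) by exact: measurable_itv.
pose box (y : {ffun T -> 'I_G.+1}) : set Omega :=
  \bigcap_(f in [set f | incr f]) (J f @^-1` cell (y f)).
have mbox y : measurable (box y).
  apply: fin_bigcap_measurable; first exact: finite_finset.
  by move=> f fi; rewrite -[X in measurable X]setTI; exact: mJ.
pose dflt (y : {ffun T -> 'I_G.+1}) := [forall f, (f \notin fs) ==> (y f == ord0)].
pose bad (y : {ffun T -> 'I_G.+1}) := dflt y && `[< exists om, E om /\ box y om >].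
exists (\big[setU/set0]_(y | bad y) box y); split.
- by apply: bigsetU_measurable.
- move=> om Eom; rewrite big_mkcond -bigcup_seq/=.
  pose y : {ffun T -> 'I_G.+1} :=
    [ffun f => if incr f then inord (Num.truncn ((J f om + Rm) / dd)) else ord0].
  have boxy : box y om.
    move=> f /= fi; have := EJ _ Eom f fi; rewrite ltr_norml => /andP[j1 j2].
    have z0 : 0 <= (J f om + Rm) / dd by rewrite divr_ge0 ?(ltW dd0)//; lra.
    have kG : (Num.truncn ((J f om + Rm) / dd) < G.+1)%N.
      rewrite ltnS /G; apply: le_truncn; rewrite ler_pM2r ?invr_gt0//; lra.
    rewrite /cell /grid_cell/= in_itv/= ffunE fi inordK// /c.
    have := truncn_itv z0 => /andP[t1 t2].
    move: t1 t2; rewrite ler_pdivlMr// ltr_pdivrMr// -natr1 => t1 t2.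
    by apply/andP; split; lra.
  exists y => /=; first exact: mem_index_enum.
  suff -> : bad y by [].
  apply/andP; split; last by apply/asboolP; exists om.
  by apply/forallP => f; apply/implyP; rewrite memfs ffunE => /negbTE ->.
pose F := power_fun m W.
pose gam (g : 'I_G.+1) := fine (normal_prob 0 sd (cell g)).
have gam0 g : 0 <= gam g by exact: fine_ge0.
pose corner (y : {ffun T -> 'I_G.+1}) : I -> R := \sum_(f <- fs) c (y f) *: w f.
have Hbox y : bad y -> (b%:E * P (box y) <=
    (expR (e1 * (size fs)%:R) * (F (0 + corner y) * \prod_(f <- fs) gam (y f)))%:E)%E.
  move=> /andP[_ /asboolP[om [Eom Bom]]].
  have -> : P (box y) = (\prod_(f <- fs) gam (y f))%:E.
    rewrite indJ// big_filter big_enum_cond/= -prodEFin; apply: eq_bigr => f fi.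
    rewrite /gam -(lawJ _ fi)// fineK//; apply: fin_num_measure.
    by rewrite -[X in measurable X]setTI; exact: mJ.
  rewrite -EFinM lee_fin mulrA; apply: ler_wpM2r; first exact: prodr_ge0.
  apply: (le_trans (Eb _ Eom)).
  have -> : \sum_(f | incr f) J f om *: w f = \sum_(f <- fs) J f om *: w f.
    by rewrite big_filter big_enum_cond.
  have gen : forall hs x, {subset hs <= fs} ->
    F (x + \sum_(f <- hs) J f om *: w f) <=
      expR (e1 * (size hs)%:R) * F (x + \sum_(f <- hs) c (y f) *: w f).
    elim=> [|f hs IH] x sub; first by rewrite !big_nil mulr0 expR0 mul1r.
    rewrite !big_cons /= addrA.
    have sub' : {subset hs <= fs} by move=> h hh; apply: sub; rewrite inE hh orbT.
    apply: (le_trans (IH _ sub')).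
    have -> : expR (e1 * (size hs).+1%:R) = expR (e1 * (size hs)%:R) * expR e1.
      by rewrite -expRD -natr1; congr expR; ring.
    rewrite -mulrA; apply: ler_wpM2l; first exact: expR_ge0.
    rewrite addrAC (addrA x) [in leRHS]addrAC.
    apply: (le_trans (power_fun_lip W0 W1 A1 mM _ _ (c (y f)) (wA f))).
    apply: ler_wpM2r; first exact: ltW (power_fun_gt0 _ _ _).
    rewrite ler_expR; apply: le_trans MAd; apply: ler_wpM2l => //.
    have fi : incr f by rewrite -memfs; apply: sub; rewrite inE eqxx.
    have := Bom f fi; rewrite /cell /grid_cell/= in_itv/= => /andP[h1 h2].
    by rewrite ger0_norm ?subr_ge0//; lra.
  have := gen fs 0 (fun _ h => h); rewrite add0r; exact.
apply: (@le_trans _ _ (\sum_(y | bad y) (b%:E * P (box y)))%E).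
  rewrite -ge0_sume_distrr//.
  by apply: lee_wpmul2l; [rewrite lee_fin ltW|apply: boole].
apply: (@le_trans _ _ (\sum_(y | bad y) (expR (e1 * (size fs)%:R) *
    (F (0 + corner y) * \prod_(f <- fs) gam (y f)))%:E)%E).
  by apply: lee_sum => y; exact: Hbox.
rewrite sumEFin lee_fin -mulr_sumr.
have F0 y : 0 <= F y by exact: ltW (power_fun_gt0 _ _ _).
apply: (@le_trans _ _ (expR (e1 * (size fs)%:R) * foldr (gridop sd dd G.+1 c) F us 0)).
  apply: ler_wpM2l; first exact: expR_ge0.
  have -> : foldr (gridop sd dd G.+1 c) F us 0 = \sum_(y | dflt y)
      F (0 + corner y) * \prod_(f <- fs) gam (y f).
    by rewrite -(foldr_grid_sum gam (fun g => c g) w F 0 ufs) /us foldr_map.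
  rewrite [leLHS]big_mkcond [leRHS]big_mkcond; apply: ler_sum => y _.
  rewrite /bad; case: (dflt y) => //=; case: ifP => // _.
  by apply: mulr_ge0 => //; apply: prodr_ge0.
have := Hl0 l ll0 dd G.+1 c dd0 MAd cS => H.
apply: (le_trans (ler_wpM2l (expR_ge0 _) H)); rewrite mulrA -expRD -map_comp.
apply: ler_wpM2r; first by apply: gE_ge0.
rewrite ler_expR size_map.
have sq : (size fs)%:R <= q by rewrite lerDl.
have : e1 * (size fs)%:R <= e1 * q by rewrite ler_pM2l.
have e1q : e1 * q = eps / 4 by rewrite /e1; field; rewrite gt_eqF.
by rewrite e1q; lra.
Qed.

End Law.
End Disorder.

(** * Asymptotic comparison of exponential moments *)
Section Asymptotic.
Context {R : realType}.

(* Inequality up to factors that tend to [1], uniformly in [t]. *)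
Definition asle {T : Type} (F G : nat -> T -> R) : Prop :=
  forall eps : R, 0 < eps ->
    exists n0, forall n, (n0 <= n)%N -> forall t, F n t <= expR eps * G n t.

Section Preorder.
Context {T : Type}.
Implicit Types F G H : nat -> T -> R.

Lemma asle_trans G F H : asle F G -> asle G H -> asle F H.
Proof.
move=> FG GH eps e0; have e2 : 0 < eps / 2 by rewrite divr_gt0.
have [n0 h0] := FG _ e2; have [n1 h1] := GH _ e2.
exists (maxn n0 n1) => n; rewrite geq_max => /andP[k0 k1] t.
apply: (le_trans (h0 n k0 t)).
have -> : expR eps = expR (eps / 2) * expR (eps / 2) by rewrite -expRD -splitr.
by rewrite -mulrA ler_wpM2l ?expR_ge0// h1.
Qed.

Lemma asle_le F G : (forall n t, 0 <= F n t) -> (forall n t, F n t <= G n t) -> asle F G.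
Proof.
move=> F0 FG eps e0; exists 0%N => n _ t; apply: (le_trans (FG n t)).
by rewrite ler_peMl ?(le_trans (F0 n t) (FG n t))// -expR0 ler_expR ltW.
Qed.

Lemma asle_mull (c : R) F G : 0 <= c -> asle F G ->
  asle (fun n t => c * F n t) (fun n t => c * G n t).
Proof.
move=> c0 FG eps e0; have [n0 h0] := FG _ e0; exists n0 => n nn t.
by rewrite mulrCA ler_wpM2l// h0.
Qed.

Lemma asle_trans_cst (b c : R) F G H : 0 <= b -> asle F (fun n t => b * G n t) ->
  asle G (fun n t => c * H n t) -> asle F (fun n t => (b * c) * H n t).
Proof.
move=> b0 FG GH; apply: (asle_trans FG).
have := asle_mull b0 GH; rewrite /asle => h eps e0; have [n0 hn] := h _ e0.
by exists n0 => n nn t; rewrite -mulrA; exact: hn.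
Qed.

End Preorder.

Section Fields.
Context {K : finType}.
Implicit Types (us vs ws : seq (K -> R)) (x y : K -> R).

Definition Emax (s : R) us n x : R := gE n us (fun y => expmax s (x + y)).

Lemma Emax_ge0 s us n x : 0 <= Emax s us n x.
Proof. by apply: gE_ge0 => y; exact: expmax_ge0. Qed.

Lemma Emax_cat s us vs n x :
  Emax s (us ++ vs) n x = gE n us (fun y => Emax s vs n (x + y)).
Proof.
rewrite /Emax gE_cat; apply: (congr1 (gE n us)); apply/funext => y.
by apply: (congr1 (gE n vs)); apply/funext => z; rewrite addrA.
Qed.

Lemma Emax_catC s us vs : Emax s (us ++ vs) = Emax s (vs ++ us).
Proof. by apply/funext => n; apply/funext => x; rewrite /Emax gE_catC. Qed.

Lemma Emax_nil s n x : Emax s [::] n x = expmax s x.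
Proof. by rewrite /Emax gE_nil addr0. Qed.

(** A field common to both sides is conditioned on and becomes part of the mean [x]; this is what
    uniformity in the mean is for. *)
Lemma asle_cat s us vs ws (c : R) :
  asle (Emax s vs) (fun n x => c * Emax s ws n x) ->
  asle (Emax s (us ++ vs)) (fun n x => c * Emax s (us ++ ws) n x).
Proof.
move=> h eps e0; have [n0 hn] := h _ e0; exists n0 => n nn x; rewrite !Emax_cat.
rewrite -gE_mull -gE_mull; apply: gE_le => y; exact: hn.
Qed.

Lemma cov_var us (V : R) i j : (forall i, cov us i i <= V) -> `|cov us i j| <= V.
Proof.
move=> hV; have h (e : R) : e ^+ 2 = 1 -> e * cov us i j <= V.
  move=> e2; have hi := hV i; have hj := hV j.
  have : 2 * (e * cov us i j) <= cov us i i + cov us j j.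
    rewrite /cov !mulr_sumr -big_split/=; apply: ler_sum => u _.
    have := sqr_ge0 (u i - e * u j); rewrite sqrrB exprMn e2 mul1r -!expr2.
    by rewrite -mulrnAl mulr2n; lra.
  by lra.
rewrite ler_norml; apply/andP; split; last by have := h 1; rewrite expr1n mul1r; apply.
by have := h (-1); rewrite sqrrN expr1n mulN1r => /(_ erefl); lra.
Qed.

Definition incr_le us vs := forall i j,
  cov us i i + cov us j j - 2 * cov us i j <= cov vs i i + cov vs j j - 2 * cov vs i j.

Lemma compare_var (s V A eps : R) : 0 < s -> 0 <= V -> 0 < eps -> 0 <= A ->
  exists n0, forall n, (n0 <= n)%N -> forall us vs,
    (forall i, l1 us i <= A) -> (forall i, l1 vs i <= A) ->
    (forall i, cov us i i <= V) -> (forall i, cov vs i i <= V) ->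
    incr_le us vs ->
    forall x, Emax s us n x <= expR (s ^+ 2 * V + eps) * Emax s vs n x.
Proof.
move=> s0 V0 e0 A0.
have V2 : 0 <= 2 * V by rewrite mulr_ge0.
have [n0 h] := compare_expmax K s0 V2 e0 A0.
exists n0 => n nn us vs ua va uV vV i12 x.
have -> : s ^+ 2 * V = s ^+ 2 * (2 * V) / 2 by field.
apply: h => // i j.
have := cov_var i j uV; have := cov_var i j vV; rewrite !ler_norml => /andP[? ?] /andP[? ?].
by lra.
Qed.

Lemma l1_bound us : exists A : R, forall i, l1 us i <= A.
Proof.
exists (\sum_i l1 us i) => i; rewrite (bigD1 i)//= lerDl; apply: sumr_ge0 => k _.
exact: l1_ge0.
Qed.

Lemma l1_bound2 us vs : exists A : R, [/\ 0 <= A, forall i, l1 us i <= A & forall i, l1 vs i <= A].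
Proof.
have [a ha] := l1_bound us; have [b hb] := l1_bound vs.
exists (`|a| + `|b|); split=> [|i|i]; first by rewrite addr_ge0.
  by apply: (le_trans (ha i)); rewrite (le_trans (ler_norm a))// lerDl.
by apply: (le_trans (hb i)); rewrite (le_trans (ler_norm b))// lerDr.
Qed.

Lemma Emax_compare (s V : R) us vs : 0 < s -> 0 <= V ->
  (forall i, cov us i i <= V) -> (forall i, cov vs i i <= V) -> incr_le us vs ->
  asle (Emax s us) (fun n x => expR (s ^+ 2 * V) * Emax s vs n x).
Proof.
move=> s0 V0 uV vV i12 eps e0; have [A [A0 ua va]] := l1_bound2 us vs.
have [n0 h] := compare_var s0 V0 e0 A0.
exists n0 => n nn x; rewrite mulrA -expRD (addrC eps).
exact: h.
Qed.

(** A walk depends on the vectors themselves, its limit only on their covariance. Rotations and sign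
    changes that preserve overlaps are exploited through this lemma. *)
Lemma Emax_same (s : R) us vs : 0 < s -> (forall i j, cov us i j = cov vs i j) ->
  asle (Emax s us) (Emax s vs).
Proof.
move=> s0 e eps e0; have [A [A0 ua va]] := l1_bound2 us vs.
have [n0 h] := compare_expmax K s0 (lexx 0) e0 A0.
exists n0 => n nn x; have := h n nn us vs ua va _ _ x; rewrite mulr0 mul0r add0r; apply.
  by move=> i j; rewrite !e.
by move=> i j; rewrite e addr0.
Qed.

End Fields.

Lemma Emax_sub (K K' : finType) (phi : K' -> K) (s : R) (us : seq (K -> R)) n x :
  Emax s [seq (u \o phi : K' -> R) | u <- us] n (x \o phi) <= Emax s us n x.
Proof.
rewrite /Emax -(@gE_map R (K -> R) (K' -> R) n (fun y => y \o phi) us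
  (fun y => expmax s ((x \o phi) + y)))//.
apply: gE_le => y /=; apply: expmax_le => [|k]; first exact: expmax_ge0.
exact: (expmax_ge s (x + y) (phi k)).
Qed.

Lemma Emax_prod (K L : finType) (s : R) (us : seq (K -> R)) (vs : seq (L -> R)) n (x : K -> R) (y : L -> R) :
  Emax s ([seq (u \o fst : K * L -> R) | u <- us] ++ [seq (u \o snd : K * L -> R) | u <- vs]) n
    ((x \o fst) + (y \o snd)) <= Emax s us n x * Emax s vs n y.
Proof.
rewrite Emax_cat {2}/Emax mulrC -gE_mull.
rewrite -(@gE_map R (K -> R) (K * L -> R) n (fun y => y \o fst) us
  (fun z => Emax s [seq (u \o snd : K * L -> R) | u <- vs] n ((x \o fst) + (y \o snd) + z)))//.
apply: gE_le => z /=; rewrite /Emax mulrC -gE_mull.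
rewrite -(@gE_map R (L -> R) (K * L -> R) n (fun y => y \o snd) vs
  (fun w => expmax s ((x \o fst) + (y \o snd) + (z \o fst) + w)))//.
apply: gE_le => w /=; apply: expmax_le => [|[k l]]; first by rewrite mulr_ge0 ?expmax_ge0.
apply: (le_trans _ (ler_pM (expR_ge0 _) (expR_ge0 _) (expmax_ge s _ k) (expmax_ge s _ l))).
rewrite -expRD ler_expR -mulrDr !vaddE/=.
have -> : x k + y l + z k + w l = x k + z k + (y l + w l) by ring.
exact: lexx.
Qed.

Lemma Emax_scale (K : finType) (s a : R) (us : seq (K -> R)) n x :
  Emax (s * a) us n x = Emax s [seq a *: u | u <- us] n (a *: x).
Proof.
rewrite /Emax -(gE_scale n a us (fun y => expmax s (a *: x + y))).
apply: (congr1 (gE n us)); apply/funext => y; rewrite /expmax; apply: eq_bigr => k _.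
by rewrite !vaddE !vscaleE -mulrDr mulrA.
Qed.

End Asymptotic.

(** * Tensor sums *)
Section Tensor.
Context {R : realType}.
Variables p N : nat.
Notation T := {ffun 'I_p -> 'I_N}.

Definition fperm (f : T) (s : 'S_p) : T := [ffun i => f (s i)].

Definition sym_fun (G : T -> R) := forall f s, G (fperm f s) = G f.

Lemma fpermM f s t : fperm (fperm f s) t = fperm f (t * s)%g.
Proof. by apply/ffunP => i; rewrite !ffunE permM. Qed.

Lemma fperm1 f : fperm f 1%g = f.
Proof. by apply/ffunP => i; rewrite !ffunE perm1. Qed.

Lemma incrP (f : T) : reflect (forall i j : 'I_p, (i < j)%N -> (f i < f j)%N) (incr f).
Proof.
apply: (iffP idP) => [/forallP h i j ij|h].
  by have /forallP/(_ j)/implyP := h i; apply.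
by apply/forallP => i; apply/forallP => j; apply/implyP; exact: h.
Qed.

Lemma incr_inj (f : T) : incr f -> injective f.
Proof.
move=> /incrP h i j e; apply/val_inj/eqP; case: (ltngtP i j) => // ij.
  by have := h _ _ ij; rewrite e ltnn.
by have := h _ _ ij; rewrite e ltnn.
Qed.

Lemma perm_increasing (s : 'S_p) : (forall i j : 'I_p, (i < j)%N -> (s i < s j)%N) -> s = 1%g.
Proof.
have ge (t : 'S_p) : (forall i j : 'I_p, (i < j)%N -> (t i < t j)%N) ->
    forall i : 'I_p, (i <= t i)%N.
  move=> h [m mp]; elim: m mp => // m IH mp.
  have mp' := ltn_trans (ltnSn m) mp.
  by apply: leq_ltn_trans (IH mp') (h (Ordinal mp') (Ordinal mp) _) => /=.
move=> h; have h' (i j : 'I_p) : (i < j)%N -> (s^-1%g i < s^-1%g j)%N.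
  move=> ij; rewrite ltnNge; apply/negP; rewrite leq_eqVlt => /orP[/eqP/val_inj/perm_inj e|].
    by rewrite e ltnn in ij.
  by move/h; rewrite !permKV => /ltnW; rewrite leqNgt ij.
apply/permP => i; rewrite perm1; apply/val_inj/eqP; rewrite eqn_leq (ge _ h) andbT.
by have := ge _ h' (s i); rewrite permK.
Qed.

Lemma sorting_perm (f : T) : injective f -> exists s : 'S_p, incr (fperm f s).
Proof.
move=> fi; pose le_ := fun i j : 'I_N => (i <= j)%N.
pose t : p.-tuple 'I_N := [tuple f i | i < p].
pose u : p.-tuple 'I_N := [tuple of sort le_ t].
have : perm_eq u t by rewrite perm_sort.
case/tuple_permP => s e; exists s.
have sorted_u : sorted le_ u by apply: sort_sorted => i j; exact: leq_total.
have le_tr : transitive le_ by move=> a b c; exact: leq_trans.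
apply/incrP => i j ij; rewrite !ffunE.
have eu (k : 'I_p) : f (s k) = nth (f i) u k by rewrite e -tnth_nth !tnth_mktuple.
have le_ij : le_ (f (s i)) (f (s j)).
  by rewrite !eu; apply: (sorted_ltn_nth le_tr) => //; rewrite inE size_tuple.
rewrite ltn_neqAle; apply/andP; split => //; apply/eqP => /val_inj/fi/perm_inj e'.
by rewrite e' ltnn in ij.
Qed.

Lemma sum_incr (G : T -> R) : sym_fun G ->
  \sum_(f : T | injectiveb f) G f = p`!%:R * \sum_(f | incr f) G f.
Proof.
move=> sG.
pose sp (f : T) : 'S_p := odflt 1%g [pick s : 'S_p | incr (fperm f s)].
have spP (f : T) : injective f -> incr (fperm f (sp f)).
  move=> /sorting_perm[s hs]; rewrite /sp; case: pickP => [t //|/(_ s)].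
  by rewrite hs.
have spE g s : incr g -> fperm (fperm g s) (sp (fperm g s)) = g.
  move=> gi.
  have fi : injective (fperm g s).
    by move=> i j; rewrite !ffunE => /(incr_inj gi)/perm_inj.
  have := spP _ fi; rewrite fpermM => /incrP h.
  have -> : (sp (fperm g s) * s)%g = 1%g; last exact: fperm1.
  apply: perm_increasing => i j ij; rewrite ltnNge; apply/negP => le_.
  have := h _ _ ij; rewrite !ffunE; move: le_; rewrite leq_eqVlt.
  case/orP => [/eqP/val_inj ->|lt_]; first by rewrite ltnn.
  by have /incrP/(_ _ _ lt_)/ltnW := gi; rewrite leqNgt => /negP h' /h'.
rewrite (partition_big (fun f => fperm f (sp f)) (@incr p N))/=; last first.
  by move=> f /injectiveP; exact: spP.
rewrite mulr_sumr; apply: eq_bigr => g gi.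
rewrite (eq_bigr (fun _ => G g)); last first.
  by move=> f /andP[_ /eqP <-]; rewrite sG.
rewrite sumr_const -[LHS]mulr_natl; congr (_%:R * _).
have fgi : injective (fperm g).
  move=> s t /ffunP e; apply/permP => i; apply: (incr_inj gi).
  by have := e i; rewrite !ffunE.
rewrite -(card_Sn p) -cardsT -(card_imset _ fgi) -[in RHS]cardsE; apply: eq_card => f.
rewrite inE [LHS]/(_ \in _)/=; apply/idP/imsetP => [/andP[_ /eqP e]|[s _ ->]].
  by exists (sp f)^-1%g => //; rewrite -e fpermM mulVg fperm1.
rewrite spE// eqxx andbT; apply/injectiveP => i j.
by rewrite !ffunE => /(incr_inj gi)/perm_inj.
Qed.

Lemma sum_incr_le (G : T -> R) : sym_fun G -> (forall f, 0 <= G f) ->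
  \sum_(f | incr f) G f <= p`!%:R^-1 * \sum_f G f.
Proof.
move=> sG G0; rewrite ler_pdivlMl ?ltr0n ?fact_gt0// -sum_incr//.
by rewrite [leRHS](bigID (fun f : T => injectiveb f))/= lerDl sumr_ge0.
Qed.

Definition mono (z : 'I_N -> R) (f : T) : R := \prod_(j < p) z (f j).

Lemma mono_sym z : sym_fun (mono z).
Proof.
move=> f s; rewrite /mono [RHS](reindex_inj (@perm_inj _ s)).
by apply: eq_bigr => i _; rewrite ffunE.
Qed.

Lemma sum_mono z z' : \sum_f mono z f * mono z' f = inner z z' ^+ p.
Proof.
rewrite /inner -[in RHS](card_ord p) -prodr_const bigA_distr_bigA/=.
by apply: eq_bigr => f _; rewrite /mono -big_split.
Qed.

(** Two tied coordinates leave only one free sum: the factor at [j'] is estimated by its maximum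
    [M], and the others are summed freely. *)
Lemma diag_sum (phi : 'I_p -> 'I_N -> R) (j j' : 'I_p) (M : R) : j != j' ->
  (forall i k, 0 <= phi i k) -> (forall k, phi j' k <= M) ->
  \sum_(f : T | f j == f j') \prod_i phi i (f i) <=
    M * \prod_(i | i != j') \sum_k phi i k.
Proof.
move=> jj phi0 phiM.
(* Indicators pin both coordinates [j] and [j'] to the value [k], so the constrained sum becomes a
   sum over [k] of unconstrained product sums. *)
pose psi k i x : R := phi i x * (((i == j) || (i == j')) ==> (x == k))%:R.
have -> : \sum_(f : T | f j == f j') \prod_i phi i (f i) =
    \sum_k \sum_(f : T) \prod_i psi k i (f i).
  rewrite exchange_big big_mkcond/=; apply: eq_bigr => f _.
  rewrite (bigD1 (f j))//= [X in _ = _ + X]big1 ?addr0; last first.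
    move=> k kf; rewrite (bigD1 j)//= /psi eqxx/= eq_sym (negbTE kf).
    by rewrite mulr0 mul0r.
  case: ifPn => [/eqP e|ne].
    apply: eq_bigr => i _; rewrite /psi; case: eqP => [->|_]/=; first by rewrite eqxx mulr1.
    by case: eqP => [->|_]/=; rewrite ?e ?eqxx mulr1.
  rewrite (bigD1 j')//= /psi eqxx orbT/= eq_sym (negbTE ne).
  by rewrite mulr0 mul0r.
have S0 i : 0 <= \sum_k phi i k by apply: sumr_ge0.
have P0 : 0 <= \prod_(i | (i != j') && (i != j)) \sum_k phi i k by apply: prodr_ge0.
rewrite (bigD1 j)//=.
apply: (@le_trans _ _ (\sum_k M * (phi j k * \prod_(i | (i != j') && (i != j)) \sum_k phi i k))).
  apply: ler_sum => k _; rewrite -(bigA_distr_bigA (fun i x => psi k i x))/=.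
  rewrite (bigD1 j')//= (bigD1 j)//=.
  have e (i : 'I_p) : (i == j) || (i == j') -> \sum_x psi k i x = phi i k.
    move=> hi; rewrite (bigD1 k)//= /psi hi eqxx mulr1 big1 ?addr0// => x xk.
    by rewrite /= (negbTE xk) mulr0.
  rewrite !e ?eqxx ?orbT//.
  have -> : \prod_(i | (i != j') && (i != j)) \sum_x psi k i x =
            \prod_(i | (i != j') && (i != j)) \sum_x phi i x.
    apply: eq_bigr => i /andP[i1 i2]; apply: eq_bigr => x _.
    by rewrite /psi (negbTE i1) (negbTE i2) mulr1.
  by apply: ler_wpM2r => //; apply: mulr_ge0.
by rewrite -mulr_sumr -mulr_suml.
Qed.

Lemma sqr_sum_le (I : finType) (x : I -> R) : (\sum_i x i) ^+ 2 <= #|I|%:R * \sum_i x i ^+ 2.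
Proof.
have -> : #|I|%:R * \sum_i x i ^+ 2 = \sum_i \sum_j (x i ^+ 2 + x j ^+ 2) / 2.
  have -> : \sum_i \sum_j (x i ^+ 2 + x j ^+ 2) / 2 =
      \sum_i (#|I|%:R * x i ^+ 2 + \sum_j x j ^+ 2) / 2.
    apply: eq_bigr => i _; rewrite -mulr_suml big_split/= sumr_const.
    by rewrite -[_ *+ #|I|]mulr_natl.
  by rewrite -mulr_suml big_split/= sumr_const -[_ *+ #|I|]mulr_natl -mulr_sumr; field.
rewrite expr2 big_distrlr/=; apply: ler_sum => i _; apply: ler_sum => j _.
by have := sqr_ge0 (x i - x j); rewrite sqrrB; lra.
Qed.

Definition hyb (a b : 'I_p -> R) (l i : 'I_p) : R :=
  if (i < l)%N then b i else if i == l then a i - b i else a i.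

Lemma prod_telescope (a b : 'I_p -> R) :
  \prod_i a i - \prod_i b i = \sum_l \prod_i hyb a b l i.
Proof.
pose t (l : nat) : R := \prod_(i < p) (if (i < l)%N then b i else a i).
have -> : \prod_i a i = t 0%N by apply: eq_bigr.
have -> : \prod_i b i = t p by apply: eq_bigr => i _; rewrite ltn_ord.
rewrite -opprB -(telescope_sumr t (leq0n p)) big_mkord -sumrN.
apply: eq_bigr => l _; rewrite opprB /t !(bigD1 (P := predT) l)//= ltnn ltnSn /hyb ltnn eqxx.
rewrite mulrBl; congr (_ * _ - _ * _); apply: eq_bigr => i il.
  by rewrite (negbTE il).
rewrite ltnS leq_eqVlt (negbTE il).
by case: eqP => // /val_inj e; rewrite e eqxx in il.
Qed.

(** Telescoping the difference of monomials gives p terms and Cauchy-Schwarz a factor p; a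
    non-injective tuple has one of at most p^2 ties, whence p^4. A tied coordinate contributes [M]
    in place of a full sum, the telescoped one the squared distance. *)
Lemma noninj_sum (z z' : 'I_N -> R) (M : R) : 0 <= M ->
  (forall k, z k ^+ 2 <= M) -> (forall k, z' k ^+ 2 <= M) ->
  inner z z = N%:R -> inner z' z' = N%:R ->
  \sum_(f : T | ~~ injectiveb f) (mono z f - mono z' f) ^+ 2 <=
    p%:R ^+ 4 * M * N%:R ^+ p.-2 * inner (z - z') (z - z').
Proof.
move=> M0 zM z'M nz nz'.
pose phi (l i : 'I_p) (k : 'I_N) : R := if (i < l)%N then z' k ^+ 2 else
  if i == l then (z k - z' k) ^+ 2 else z k ^+ 2.
have phi0 l i k : 0 <= phi l i k by rewrite /phi; do 2?case: ifP => _; exact: sqr_ge0.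
pose D2 := inner (z - z') (z - z').
have D0 : 0 <= D2 by apply: sumr_ge0 => i _; rewrite -expr2 sqr_ge0.
pose B := M * (N%:R ^+ p.-2 * D2).
have sphi (l i : 'I_p) : \sum_k phi l i k = if i == l then D2 else N%:R.
  rewrite /phi; case: ltngtP => [il|il|/val_inj ->]; rewrite ?eqxx.
  - case: eqP => [e|_]; first by rewrite e ltnn in il.
    by rewrite -nz'; apply: eq_bigr.
  - case: eqP => [e|_]; first by rewrite e ltnn in il.
    by rewrite -nz; apply: eq_bigr.
  - by apply: eq_bigr.
have key (l j j' : 'I_p) : j != j' ->
    \sum_(f : T | f j == f j') \prod_i phi l i (f i) <= B.
  (* A tie is symmetric, so the coordinate estimated by its maximum can be taken different from the
     telescoped coordinate [l], whose full sum is the squared distance. *)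
  wlog jl : j j' / j' != l.
    move=> W jj; have [e|ne] := eqVneq j' l; last exact: W.
    rewrite (eq_bigl (fun f : T => f j' == f j)) => [|f]; last by rewrite eq_sym.
    by apply: W; [rewrite -e|rewrite eq_sym].
  move=> jj; apply: (le_trans (diag_sum jj (phi0 l) (M := M) _)).
    by move=> k; rewrite /phi (negbTE jl); case: ifP.
  rewrite /B; apply: ler_wpM2l => //.
  rewrite (bigD1 l)/=; last by rewrite eq_sym.
  rewrite sphi eqxx mulrC; apply: ler_wpM2r => //.
  rewrite (eq_bigr (fun _ => N%:R)); last by move=> i /andP[_ il]; rewrite sphi (negbTE il).
  rewrite prodr_const; set c := #|_|.
  suff -> : c = p.-2 by [].
  have := cardC (mem [set j'; l]%SET); rewrite cards2 jl card_ord.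
  rewrite /c; have -> : #|[predC [set j'; l]%SET]| = #|(fun i => (i != j') && (i != l))|.
    by apply: eq_card => i; rewrite !inE negb_or.
  by move/(congr1 (fun m => m.-2)).
rewrite (le_trans (_ : _ <= \sum_(f : T) \sum_(l : 'I_p) \sum_(jj : 'I_p * 'I_p | jj.1 != jj.2)
    (f jj.1 == f jj.2)%:R * (p%:R * \prod_i phi l i (f i))))//.
  rewrite [leLHS]big_mkcond/=; apply: ler_sum => f _.
  have h0 (l : 'I_p) : 0 <= p%:R * \prod_i phi l i (f i) by rewrite mulr_ge0// prodr_ge0.
  case: ifPn => [/injectivePn[j [j' jj e]]|_]; last first.
    by apply: sumr_ge0 => l _; apply: sumr_ge0 => jj _; rewrite mulr_ge0.
  apply: (@le_trans _ _ (\sum_(l < p) p%:R * \prod_i phi l i (f i))); last first.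
    apply: ler_sum => l _; rewrite (bigD1 (j, j'))//= e eqxx mul1r lerDl.
    by apply: sumr_ge0 => ? _; rewrite mulr_ge0.
  rewrite -mulr_sumr /mono prod_telescope.
  apply: (le_trans (sqr_sum_le _)); rewrite card_ord; apply: ler_wpM2l => //; apply: ler_sum => l _.
  rewrite -prodrXl (eq_bigr (fun i => phi l i (f i)))// => i _.
  by rewrite /hyb /phi; do 2?case: ifP => _.
have -> : p%:R ^+ 4 * M * N%:R ^+ p.-2 * D2 = \sum_(l < p) \sum_(jj : 'I_p * 'I_p) p%:R * B.
  rewrite !sumr_const card_prod !card_ord -mulrnA -[RHS]mulr_natl !natrM /B; ring.
rewrite exchange_big; apply: ler_sum => l _; rewrite exchange_big/=.
rewrite [leLHS]big_mkcond/=; apply: ler_sum => -[j j'] _ /=.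
have B0 : 0 <= B by rewrite /B !mulr_ge0// exprn_ge0.
case: ifPn => [jj|_]; last by rewrite mulr_ge0.
rewrite (eq_bigr (fun f : T => p%:R * (if f j == f j' then \prod_i phi l i (f i) else 0))); last first.
  by move=> f _; case: eqP => _; rewrite ?mul1r// mul0r mulr0.
by rewrite -mulr_sumr -big_mkcond; apply: ler_wpM2l => //; exact: key.
Qed.

End Tensor.

(** * Elementary moment bounds *)
Section Moments.
Context {R : realType}.

Lemma cosh_le (x : R) : (expR x + expR (- x)) / 2 <= expR (2 * x ^+ 2).
Proof.
have [h|h] := leP (x ^+ 2) (2^-1).
  have x1 : -1 < x < 1.
    by rewrite -ltr_norml -(@ltr_pXn2r _ 2) ?nnegrE// real_normK ?num_real// expr1n; lra.
  have b (y : R) : -1 < y < 1 -> expR y <= (1 - y)^-1.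
    move=> /andP[y1 y2]; rewrite -[expR y]invrK lef_pV2 ?posrE ?invr_gt0 ?expR_gt0 ?subr_gt0//.
    by rewrite -expRN; exact: (expR_ge1Dx (- y)).
  have h1 := b x x1; have h2 : expR (- x) <= (1 + x)^-1.
    by have := b (- x); rewrite opprK; apply; lra.
  apply: le_trans (expR_ge1Dx _).
  have p1 : 0 < 1 - x by lra.
  have p2 : 0 < 1 + x by lra.
  apply: (@le_trans _ _ (((1 - x)^-1 + (1 + x)^-1) / 2)); first by lra.
  have -> : ((1 - x)^-1 + (1 + x)^-1) / 2 = (1 - x ^+ 2)^-1.
    have -> : 1 - x ^+ 2 = (1 - x) * (1 + x) by ring.
    by field; rewrite (gt_eqF p1) (gt_eqF p2).
  have p3 : 0 < 1 - x ^+ 2 by lra.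
  rewrite -(ler_pM2r p3) mulVf ?gt_eqF//.
  by have := sqr_ge0 x; move: h; set y := x ^+ 2; nra.
have le1 (y : R) : y ^+ 2 = x ^+ 2 -> expR y <= expR (2 * x ^+ 2).
  move=> e; rewrite ler_expR -e; rewrite -e in h.
  by have := sqr_ge0 (y - 1); rewrite sqrrB mulr1 expr1n; nra.
have := le1 x erefl; have := le1 (- x); rewrite sqrrN => /(_ erefl); lra.
Qed.

Section Lin.
Context {I : finType}.
Implicit Types (b x y : I -> R) (us : seq (I -> R)).

Definition dotp b x : R := \sum_i b i * x i.

Lemma dotpD b x y : dotp b (x + y) = dotp b x + dotp b y.
Proof. by rewrite /dotp -big_split; apply: eq_bigr => i _; rewrite mulrDr. Qed.

Lemma dotpN b x : dotp b (- x) = - dotp b x.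
Proof. by rewrite /dotp -sumrN; apply: eq_bigr => i _; rewrite voppE mulrN. Qed.

Lemma dotpZ b a x : dotp b (a *: x) = a * dotp b x.
Proof. by rewrite /dotp mulr_sumr; apply: eq_bigr => i _; rewrite vscaleE mulrCA. Qed.

Lemma step_explin us b x :
  step us (fun z => expR (dotp b z)) x <=
    expR (2 * \sum_(u <- us) dotp b u ^+ 2) * expR (dotp b x).
Proof.
elim: us x => [|u us IH] x /=; first by rewrite big_nil mulr0 expR0 mul1r.
rewrite /halfstep big_cons mulrDr expRD.
apply: (@le_trans _ _ (expR (2 * \sum_(u <- us) dotp b u ^+ 2) * expR (dotp b x) *
   ((expR (dotp b u) + expR (- dotp b u)) / 2))).
  have := lerD (IH (x + u)) (IH (x - u)); rewrite !dotpD dotpN !expRD.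
  move: (expR (2 * _)) (expR (dotp b x)) (expR (dotp b u)) (expR (- _)) => a1 a2 a3 a4.
  by move: (step _ _ _) (step _ _ _) => a5 a6; lra.
rewrite -(mulrA (expR (2 * dotp b u ^+ 2))) [leRHS]mulrC; apply: ler_wpM2l.
  by rewrite mulr_ge0// expR_ge0.
exact: cosh_le.
Qed.

Lemma iter_step_bound n us (a : R) (F : (I -> R) -> R) : 0 <= a ->
  (forall x, step us F x <= a * F x) -> forall x, iter n (step us) F x <= a ^+ n * F x.
Proof.
move=> a0 h x; have := @iter_step_compare R (I -> R) n us [::] a F a0 h x.
by have -> : iter n (step [::]) F x = F x by elim: n {h} => //= n; rewrite /step.
Qed.

Lemma invsqrt_sqr n : (0 < n)%N -> n%:R * (Num.sqrt n%:R)^-1 ^+ 2 = 1 :> R.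
Proof.
move=> n0; rewrite exprVn sqr_sqrtr ?ler0n// divff// pnatr_eq0.
by rewrite -lt0n.
Qed.

Lemma gE_explin n us b :
  gE n us (fun z => expR (dotp b z)) <= expR (2 * \sum_(u <- us) dotp b u ^+ 2).
Proof.
have [->|n0] := posnP n.
  rewrite /gE/= -[X in X <= _]mul1r.
  have -> : dotp b 0 = 0 by rewrite /dotp big1// => i _; rewrite mulr0.
  rewrite expR0 mul1r -expR0 ler_expR mulr_ge0// sumr_ge0// => u _; exact: sqr_ge0.
rewrite /gE; set vs := map _ _.
apply: (le_trans (iter_step_bound n (expR_ge0 _) (step_explin vs b) 0)).
have -> : dotp b 0 = 0 by rewrite /dotp big1// => i _; rewrite mulr0.
rewrite expR0 mulr1 -expRM_natl ler_expR /vs big_map.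
rewrite (eq_bigr (fun u => (Num.sqrt n%:R)^-1 ^+ 2 * dotp b u ^+ 2)); last first.
  by move=> u _; rewrite dotpZ exprMn.
rewrite -mulr_sumr.
set c := \sum_(u <- us) _; set a := (Num.sqrt _)^-1.
have -> : n%:R * (2 * (a ^+ 2 * c)) = n%:R * a ^+ 2 * (2 * c) by ring.
by rewrite invsqrt_sqr// mul1r.
Qed.

End Lin.

(* A single Gaussian direction costs only the constant factor [2] and its variance. *)
Lemma Emax_single (K : finType) (s cc : R) (u : K -> R) n x : 0 <= s ->
  (forall k, `|u k| <= cc) ->
  Emax s [:: u] n x <= 2 * expR (2 * (s * cc) ^+ 2) * expmax s x.
Proof.
move=> s0 uc; rewrite /Emax.
pose L (g : 'I_1 -> R) : K -> R := g ord0 *: u.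
have -> : [:: u] = [seq L g | g <- [:: (fun _ => 1) : 'I_1 -> R]].
  by rewrite /= /L scale1r.
rewrite -(@gE_map R ('I_1 -> R) (K -> R) n L _ (fun y => expmax s (x + y))); last 2 first.
- by move=> g h; rewrite /L scalerDl.
- by move=> a g; rewrite /L scalerA.
pose b (e : R) : 'I_1 -> R := fun _ => e * (s * cc).
apply: (@le_trans _ _ (gE n [:: (fun _ => 1) : 'I_1 -> R] (fun g => expmax s x *
    (expR (dotp (b 1) g) + expR (dotp (b (-1)) g))))).
  apply: gE_le => g /=; apply: expmax_le => [|k].
    by rewrite mulr_ge0 ?expmax_ge0// addr_ge0// expR_ge0.
  rewrite vaddE mulrDr expRD; apply: ler_pM; rewrite ?expR_ge0//; first exact: expmax_ge.
  rewrite /L vscaleE /dotp /b !big_ord1 mul1r.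
  have h : s * (g ord0 * u k) <= s * cc * `|g ord0|.
    rewrite -mulrA ler_wpM2l// (le_trans (ler_norm _))// normrM mulrC.
    by rewrite ler_wpM2r.
  apply: (@le_trans _ _ (expR (s * cc * `|g ord0|))); first by rewrite ler_expR.
  case: (ger0P (g ord0)) => g0; first by rewrite lerDl expR_ge0.
  have -> : s * cc * - g ord0 = -1 * (s * cc) * g ord0 by ring.
  by rewrite lerDr expR_ge0.
rewrite gE_mull gE_add mulrC; apply: ler_wpM2r; first exact: expmax_ge0.
have h e : e ^+ 2 = 1 -> gE n [:: (fun _ => 1) : 'I_1 -> R] (fun g => expR (dotp (b e) g))
    <= expR (2 * (s * cc) ^+ 2).
  move=> e2; apply: (le_trans (gE_explin _ _ _)).
  by rewrite big_seq1 /dotp big_ord1 /b mulr1 exprMn e2 mul1r.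
have := h 1 (expr1n _ _); have := h (-1); rewrite sqrrN expr1n => /(_ erefl).
by move: (gE _ _ _) (gE _ _ _) (expR _) => a1 a2 a3; lra.
Qed.

Lemma Emax_mono (K : finType) (s : R) (us : seq (K -> R)) n x x' : 0 <= s ->
  (forall k, x k <= x' k) -> Emax s us n x <= Emax s us n x'.
Proof.
move=> s0 xx; apply: gE_le => y; apply: expmax_le => [|k]; first exact: expmax_ge0.
by apply: le_trans (expmax_ge _ _ k); rewrite ler_expR ler_wpM2l// !vaddE lerD2r.
Qed.

Definition scl {K : Type} (a : R) (us : seq (K -> R)) : seq (K -> R) := [seq a *: u | u <- us].

(** Convexity of the exponential at the midpoint of 2 y and 2 z separates two fields at the price of
    doubling each; this is affordable where only the order of their strengths matters. *)
Lemma Emax_split (K : finType) (s : R) (us vs : seq (K -> R)) n x : 0 <= s ->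
  Emax s (us ++ vs) n x <= (Emax s (scl 2 us) n x + Emax s (scl 2 vs) n x) / 2.
Proof.
move=> s0; rewrite /Emax gE_cat -(gE_scale n 2 us (fun y => expmax s (x + y))).
rewrite -(gE_scale n 2 vs (fun y => expmax s (x + y))).
rewrite mulrDl -(gE_cst n us (gE n vs _ / 2)).
rewrite [X in _ <= X + _]mulrC -gE_mull -gE_add; apply: gE_le => y.
rewrite [X in _ <= _ + X]mulrC -gE_mull -[X in _ <= X + _](gE_cst n vs) -gE_add.
apply: gE_le => z; apply: expmax_le => [|k].
  by rewrite addr_ge0// mulr_ge0// expmax_ge0.
have := expmax_ge s (x + 2 *: y) k; have := expmax_ge s (x + 2 *: z) k.
rewrite !vaddE !vscaleE => h1 h2.
apply: (@le_trans _ _ (2^-1 * expR (s * (x k + 2 * y k)) + 2^-1 * expR (s * (x k + 2 * z k)))).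
  have -> : s * (x k + (y k + z k)) = s * (x k + 2 * y k) / 2 + s * (x k + 2 * z k) / 2 by field.
  have e (w : R) : expR w = expR (w / 2) ^+ 2 by rewrite -expRM_natl; congr expR; field.
  rewrite expRD (e (s * (x k + 2 * y k))) (e (s * (x k + 2 * z k))).
  by have := sqr_ge0 (expR (s * (x k + 2 * y k) / 2) - expR (s * (x k + 2 * z k) / 2)); lra.
by apply: lerD; rewrite ler_pM2l.
Qed.

(** The added N keeps the root at least sqrt N. Near [g] the root lies below its tangent, so the
    exponent is dominated by an affine function of the step plus a small square, and [step_explin]
    applies. *)
Lemma step_exp_norm (N : nat) (t h : R) (g : 'I_N -> R) : (0 < N)%N -> 0 <= t ->
  step [seq h *: (fun i => (i == j)%:R) | j <- enum 'I_N]
    (fun z => expR (t * Num.sqrt (dotp z z + N%:R))) g <=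
  expR (h ^+ 2 * (t * Num.sqrt N%:R / 2 + 2 * t ^+ 2)) *
     expR (t * Num.sqrt (dotp g g + N%:R)).
Proof.
move=> N0 t0; set us := map _ _; set S := Num.sqrt (dotp g g + N%:R).
have gg0 : 0 <= dotp g g by apply: sumr_ge0 => i _; rewrite -expr2 sqr_ge0.
have NR : 0 < N%:R :> R by rewrite ltr0n.
have gN : 0 < dotp g g + N%:R by rewrite ltr_wpDl.
have S0 : 0 < S by rewrite sqrtr_gt0.
have S2 : S ^+ 2 = dotp g g + N%:R by rewrite sqr_sqrtr// ltW.
have l1us i : l1 us i = `|h|.
  rewrite /l1 /us big_map big_enum/= (bigD1 i)//= vscaleE eqxx mulr1 big1 ?addr0//.
  by move=> j ji; rewrite vscaleE eq_sym (negbTE ji) mulr0 normr0.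
pose b : 'I_N -> R := (t / S) *: g.
pose cst := expR (t * S + t * (N%:R * h ^+ 2) / (2 * S) - dotp b g).
apply: (@le_trans _ _ (step us (fun z => cst * expR (dotp b z)) g)).
  apply: step_le_on => y hy; rewrite /cst -expRD ler_expR (dotpD b g y).
  have -> : t * S + t * (N%:R * h ^+ 2) / (2 * S) - dotp b g + (dotp b g + dotp b y) =
     t * (S + (N%:R * h ^+ 2) / (2 * S) + dotp g y / S).
    have -> : dotp b y = t / S * dotp g y.
      by rewrite /dotp mulr_sumr; apply: eq_bigr => i _; rewrite /b vscaleE mulrA.
    by field; rewrite gt_eqF.
  rewrite ler_wpM2l//.
  have yy : dotp y y <= N%:R * h ^+ 2.
    rewrite /dotp (le_trans (_ : _ <= \sum_(i < N) h ^+ 2))//.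
      apply: ler_sum => i _; have := hy i; rewrite l1us => hi.
      by rewrite -expr2 -(real_normK (num_real (y i))) -(real_normK (num_real h)) lerXn2r ?nnegrE.
    by rewrite sumr_const card_ord -[_ *+ N]mulr_natl.
  have e : dotp (g + y) (g + y) = dotp g g + 2 * dotp g y + dotp y y.
    rewrite /dotp mulr_sumr -!big_split/=; apply: eq_bigr => i _; rewrite !vaddE; ring.
  have X0 : 0 <= dotp (g + y) (g + y) + N%:R.
    by rewrite addr_ge0// sumr_ge0// => i _; rewrite -expr2 sqr_ge0.
  pose r := Num.sqrt (dotp (g + y) (g + y) + N%:R); rewrite -/r.
  have r2 : r ^+ 2 = dotp g g + 2 * dotp g y + dotp y y + N%:R by rewrite sqr_sqrtr// e.
  rewrite -(ler_pM2r (_ : 0 < 2 * S)) ?mulr_gt0//.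
  have -> : (S + N%:R * h ^+ 2 / (2 * S) + dotp g y / S) * (2 * S) =
     2 * S ^+ 2 + N%:R * h ^+ 2 + 2 * dotp g y by field; rewrite gt_eqF.
  have := sqr_ge0 (r - S); rewrite sqrrB r2 S2; move: yy; clear.
  move: r S (dotp g g) (dotp g y) (dotp y y) (N%:R * h ^+ 2) (N%:R : R) => *; lra.
rewrite step_mull; apply: (le_trans (ler_wpM2l (expR_ge0 _) (step_explin _ _ _))).
rewrite /cst -!expRD ler_expR.
have -> : \sum_(u <- us) dotp b u ^+ 2 = h ^+ 2 * dotp b b.
  rewrite /us big_map big_enum/= /dotp mulr_sumr; apply: eq_bigr => j _.
  rewrite (bigD1 j)//= vscaleE eqxx mulr1 big1 ?addr0; first by ring.
  by move=> i ij; rewrite vscaleE (negbTE ij) !mulr0.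
have -> : dotp b b = t ^+ 2 * (dotp g g / S ^+ 2).
  rewrite /dotp mulr_suml mulr_sumr; apply: eq_bigr => i _; rewrite /b vscaleE; field.
  by rewrite gt_eqF.
have h1 : dotp g g / S ^+ 2 <= 1 by rewrite S2 ler_pdivrMr// mul1r lerDl ltW.
have h2 : N%:R / (2 * S) <= Num.sqrt N%:R / 2.
  rewrite ler_pdivrMr ?mulr_gt0//.
  have : Num.sqrt N%:R <= S by rewrite ler_wsqrtr// lerDr.
  have := sqr_sqrtr (ltW NR); have : 0 < Num.sqrt N%:R :> R by rewrite sqrtr_gt0.
  move: (Num.sqrt _) => r r0 e rS; rewrite -e.
  by have := ler_wpM2l (ltW r0) rS; rewrite -expr2; lra.
have hh : 0 <= h ^+ 2 by exact: sqr_ge0.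
have tt : 0 <= t ^+ 2 by exact: sqr_ge0.
have h3 := ler_wpM2l hh (ler_wpM2l tt h1).
have h4 := ler_wpM2l hh (ler_wpM2l t0 h2).
have e1 : t * (N%:R * h ^+ 2) / (2 * S) = h ^+ 2 * (t * (N%:R / (2 * S))).
  by field; rewrite gt_eqF.
rewrite e1; move: h3 h4; clear.
move: (h ^+ 2 * (t * (N%:R / (2 * S)))) (dotp g g / S ^+ 2) (dotp b g) => *; lra.
Qed.

End Moments.

(** * Gaussian fields on the sphere *)
Section Dist.
Context {R : realType} {K : finType}.
Implicit Types us vs : seq (K -> R).

Definition dist2 us i j : R := cov us i i + cov us j j - 2 * cov us i j.

Lemma dist2E us i j : dist2 us i j = \sum_(u <- us) (u i - u j) ^+ 2.
Proof.
rewrite /dist2 /cov mulr_sumr -big_split -sumrB/=; apply: eq_bigr => u _.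
by rewrite sqrrB !expr2; ring.
Qed.

Lemma dist2_cat us vs i j : dist2 (us ++ vs) i j = dist2 us i j + dist2 vs i j.
Proof. by rewrite !dist2E big_cat. Qed.

Lemma dist2_scl a us i j : dist2 (scl a us) i j = a ^+ 2 * dist2 us i j.
Proof. by rewrite /dist2 !cov_scale; ring. Qed.

Lemma dist2_ge0 us i j : 0 <= dist2 us i j.
Proof. by rewrite dist2E sumr_ge0// => u _; exact: sqr_ge0. Qed.

Lemma cov_map (T : Type) (r : seq T) (a : R) (w : K -> T -> R) i j :
  cov [seq (fun k => a * w k t) | t <- r] i j = a ^+ 2 * \sum_(t <- r) w i t * w j t.
Proof. by rewrite /cov big_map mulr_sumr; apply: eq_bigr => t _; ring. Qed.

(** An independent noise of size [b] attached to each class of the map [e]. *)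
Definition cells {D : finType} (b : R) (e : K -> D) : seq (K -> R) :=
  [seq (fun k => b * (e k == d)%:R) | d <- enum D].

Lemma cov_cells (D : finType) b (e : K -> D) i j : cov (cells b e) i j = b ^+ 2 * (e i == e j)%:R.
Proof.
rewrite cov_map big_enum/= (bigD1 (e i))//= eqxx mul1r big1 ?addr0 1?eq_sym//.
by move=> d di; rewrite [e i == d]eq_sym (negbTE di) mul0r.
Qed.

Lemma dist2_cells (D : finType) b (e : K -> D) i j :
  dist2 (cells b e) i j = 2 * b ^+ 2 * (e i != e j)%:R.
Proof. by rewrite /dist2 !cov_cells !eqxx; case: (e i == e j) => /=; ring. Qed.

Lemma l1_cells (D : finType) b (e : K -> D) i : l1 (cells b e) i = `|b|.
Proof.
rewrite /l1 big_map big_enum/= (bigD1 (e i))//= eqxx mulr1 big1 ?addr0//.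
by move=> d di; rewrite [e i == d]eq_sym (negbTE di) mulr0 normr0.
Qed.

Lemma scl_cells (D : finType) a b (e : K -> D) : scl a (cells b e) = cells (a * b) e.
Proof.
rewrite /scl /cells -map_comp; apply: eq_map => d /=; apply/funext => k.
by rewrite vscaleE mulrA.
Qed.

Lemma scl_scl a b us : scl a (scl b us) = scl (a * b) us.
Proof. by rewrite /scl -map_comp; apply: eq_map => u /=; rewrite scalerA. Qed.

Lemma Emax_small (s cc : R) us n x : 0 <= s ->
  (forall u, u \in us -> forall k, `|u k| <= cc) ->
  Emax s us n x <= (2 * expR (2 * (s * cc) ^+ 2)) ^+ size us * expmax s x.
Proof.
move=> s0; elim: us x => [|u us IH] x h; first by rewrite Emax_nil mul1r.
rewrite -cat1s Emax_catC Emax_cat /=.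
have c0 : 0 <= 2 * expR (2 * (s * cc) ^+ 2) by rewrite mulr_ge0// expR_ge0.
apply: (@le_trans _ _ (gE n us (fun y => 2 * expR (2 * (s * cc) ^+ 2) * expmax s (x + y)))).
  apply: gE_le => y; apply: Emax_single => // k; apply: h.
  exact: mem_head.
rewrite gE_mull; move: c0; set C := 2 * expR _ => c0; rewrite exprS -mulrA.
apply: ler_wpM2l => //.
by apply: IH => w wu; apply: h; rewrite inE wu orbT.
Qed.

Lemma l1_scl a us i : l1 (scl a us) i = `|a| * l1 us i.
Proof. exact: l1_scale. Qed.

(* Ranks every point below a center of larger value, with well-separated centers. *)
Lemma greedy_centers (x : K -> R) (near : rel K) : reflexive near -> symmetric near ->
  exists c : K -> K, [/\ forall i, x i <= x (c i), forall i, near i (c i) &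
    forall i j, c i != c j -> ~~ near (c i) (c j)].
Proof.
move=> nr ns.
suff [c [h1 h2 h3 h4]] : exists c : K -> K, [/\ forall i, i \in [set: K]%SET -> x i <= x (c i),
    forall i, i \in [set: K]%SET -> near i (c i),
    forall i, i \in [set: K]%SET -> c i \in [set: K]%SET &
    forall i j, i \in [set: K]%SET -> j \in [set: K]%SET -> c i != c j -> ~~ near (c i) (c j)].
  by exists c; split=> [i|i|i j]; [apply: h1|apply: h2|apply: h4].
move: [set: K]%SET => A; have [m] := ubnP #|A|; elim: m A => // m IH A cA.
have [->|/set0Pn[i0 i0A]] := eqVneq A finset.set0.
  by exists id; split=> [i|i|i|i j]; rewrite inE.
pose k := [arg max_(i > i0 in A) x i]%O.
have [kA kmax] : k \in A /\ forall i, i \in A -> x i <= x k.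
  by rewrite /k; case: arg_maxP.
pose B := [set i in A | ~~ near i k]%SET.
have BA : (#|B| < m)%N.
  rewrite ltnS in cA; apply: leq_trans cA; apply: proper_card; apply/properP; split.
    by apply/fintype.subsetP => i; rewrite inE => /andP[].
  by exists k => //; rewrite inE kA nr.
have [c [h1 h2 h3 h4]] := IH B BA.
exists (fun i => if near i k then k else c i); split=> [i iA|i iA|i iA|i j iA jA].
- by case: ifPn => n; [exact: kmax|apply: h1; rewrite inE iA].
- by case: ifPn => n //; apply: h2; rewrite inE iA.
- case: ifPn => n //; have := h3 i; rewrite !inE iA n => /(_ isT) /andP[]//.
- case: ifPn => ni; case: ifPn => nj.
  + by rewrite eqxx.
  + by have := h3 j; rewrite !inE jA nj ns => /(_ isT) /andP[].
  + by have := h3 i; rewrite !inE iA ni => /(_ isT) /andP[].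
  + by apply: h4; rewrite inE ?iA ?jA.
Qed.

End Dist.

Section Sphere.
Context {R : realType}.
Variables p N : nat.
Hypothesis N_gt0 : (0 < N)%N.
Notation T := {ffun 'I_p -> 'I_N}.
Notation vp := (p`!%:R^-1 : R).
Notation sd := (sdev R p N).
Notation NR := (N%:R : R).

Let NR0 : 0 < NR. Proof. by rewrite ltr0n. Qed.
Let NRn : NR != 0. Proof. by rewrite gt_eqF. Qed.

Definition ov (z z' : 'I_N -> R) : R := inner z z' / NR.

Lemma innerC (z z' : 'I_N -> R) : inner z z' = inner z' z.
Proof. by apply: eq_bigr => i _; rewrite mulrC. Qed.

Lemma ovC z z' : ov z z' = ov z' z. Proof. by rewrite /ov innerC. Qed.

Lemma innerBB (z z' : 'I_N -> R) :
  inner (z - z') (z - z') = inner z z + inner z' z' - 2 * inner z z'.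
Proof.
rewrite /inner mulr_sumr -big_split -sumrB/=; apply: eq_bigr => i _.
by rewrite !vaddE !voppE; ring.
Qed.

Lemma inner_ge0 (z : 'I_N -> R) : 0 <= inner z z.
Proof. by apply: sumr_ge0 => i _; rewrite -expr2 sqr_ge0. Qed.

Lemma innerNl (z z' : 'I_N -> R) : inner (- z) z' = - inner z z'.
Proof. by rewrite /inner -sumrN; apply: eq_bigr => i _; rewrite voppE mulNr. Qed.

Lemma innerN (z z' : 'I_N -> R) : inner (- z) (- z') = inner z z'.
Proof. by rewrite innerNl innerC innerNl opprK innerC. Qed.

Lemma ov_self z : inner z z = NR -> ov z z = 1.
Proof. by rewrite /ov => ->; rewrite divff. Qed.

Lemma ov_dist z z' : inner z z = NR -> inner z' z' = NR ->
  inner (z - z') (z - z') = NR * (2 - 2 * ov z z').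
Proof. by move=> h h'; rewrite innerBB h h' /ov; field. Qed.

Lemma ov_le1 z z' : inner z z = NR -> inner z' z' = NR -> ov z z' <= 1.
Proof.
by move=> h h'; have := inner_ge0 (z - z'); rewrite ov_dist// pmulr_rge0//; lra.
Qed.

Lemma ovN z z' : ov (- z) z' = - ov z z'.
Proof. by rewrite /ov innerNl mulNr. Qed.

Lemma ov_norm z z' : inner z z = NR -> inner z' z' = NR -> `|ov z z'| <= 1.
Proof.
move=> h h'; rewrite ler_norml ov_le1// andbT.
by have := @ov_le1 (- z) z'; rewrite innerN ovN => /(_ h h'); lra.
Qed.

Lemma inner_triangle (a b c : 'I_N -> R) :
  inner (a - b) (a - b) <= 2 * (inner (a - c) (a - c) + inner (b - c) (b - c)).
Proof.
rewrite -big_split mulr_sumr; apply: ler_sum => i _ /=; rewrite !vaddE !voppE.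
by have := sqr_ge0 (a i - c i + (b i - c i)); rewrite !expr2; lra.
Qed.

Lemma sdev_sqr : sd ^+ 2 = (NR ^+ p.+1)^-1.
Proof. by rewrite sqr_sqrtr// invr_ge0 exprn_ge0// ltW. Qed.

Section Fields.
Context {K : finType}.
Implicit Types c : K -> 'I_N -> R.

(** The full tensor puts independent noise on every tuple, repeated indices included, and 1/p!
    offsets the p! orderings. Its covariance is an exact power of the overlap ([cov_HF]), whereas
    [Hg] belongs to the actual disorder. *)
Definition HFg (w : K -> T -> R) : seq (K -> R) :=
  [seq (fun k => Num.sqrt vp * sd * w k f) | f <- enum T].

Definition Hg (w : K -> T -> R) : seq (K -> R) :=
  [seq (fun k => sd * w k f) | f <- enum T & incr f].

Definition HF c := HFg (fun k => mono (c k)).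

Definition H c := Hg (fun k => mono (c k)).

Definition lin c : seq (K -> R) := [seq (fun k => NR^-1 * c k j) | j <- enum 'I_N].

Definition sph c := forall k, inner (c k) (c k) = NR.

Lemma vp_gt0 : 0 < vp. Proof. by rewrite invr_gt0 ltr0n fact_gt0. Qed.

Lemma vp_le1 : vp <= 1. Proof. by rewrite invf_le1 ?ltr0n ?fact_gt0// ler1n fact_gt0. Qed.

Lemma coef_sqr : (Num.sqrt vp * sd) ^+ 2 = vp / NR ^+ p.+1.
Proof. by rewrite exprMn sdev_sqr sqr_sqrtr// ltW// vp_gt0. Qed.

Lemma cov_HF c i j : cov (HF c) i j = vp / NR * ov (c i) (c j) ^+ p.
Proof.
rewrite cov_map coef_sqr big_enum/= sum_mono /ov exprMn exprS exprVn invfM.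
by ring.
Qed.

Lemma cov_lin c i j : cov (lin c) i j = ov (c i) (c j) / NR.
Proof.
rewrite (cov_map _ NR^-1 (fun k j => c k j)) big_enum/= /ov /inner.
by set S := \sum_(_ < _) _; field.
Qed.

Lemma dist2_HF c i j : sph c -> dist2 (HF c) i j = vp / NR * (2 - 2 * ov (c i) (c j) ^+ p).
Proof. by move=> sc; rewrite /dist2 !cov_HF !ov_self// expr1n; ring. Qed.

Lemma dist2_lin c i j : sph c -> dist2 (lin c) i j = NR^-1 * (2 - 2 * ov (c i) (c j)).
Proof. by move=> sc; rewrite /dist2 !cov_lin !ov_self//; ring. Qed.

Lemma cov_Hg_le (w : K -> T -> R) k : (forall k, sym_fun (w k)) -> cov (Hg w) k k <= cov (HFg w) k k.
Proof.
move=> sw; rewrite !cov_map big_filter !big_enum_cond/= coef_sqr sdev_sqr.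
rewrite [vp / _]mulrC -mulrA; apply: ler_wpM2l; first by rewrite invr_ge0 exprn_ge0// ltW.
by apply: sum_incr_le => [f s|f]; [rewrite !sw|rewrite -expr2 sqr_ge0].
Qed.

(** By symmetry the increments of [Hg] are the part of those of [HFg] carried by injective tuples;
    repeated indices can only add. *)
Lemma incr_Hg_HFg (w : K -> T -> R) : (forall k, sym_fun (w k)) -> incr_le (Hg w) (HFg w).
Proof.
move=> sw i j; rewrite -/(dist2 (Hg w) i j) -/(dist2 (HFg w) i j) !dist2E !big_map.
rewrite big_filter !big_enum_cond/=.
rewrite (eq_bigr (fun f : T => sd ^+ 2 * (w i f - w j f) ^+ 2)); last first.
  by move=> f _; rewrite -mulrBr exprMn.
rewrite [leRHS](eq_bigr (fun f : T => (Num.sqrt vp * sd) ^+ 2 * (w i f - w j f) ^+ 2)); last first.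
  by move=> f _; rewrite -mulrBr [LHS]exprMn.
rewrite -!mulr_sumr coef_sqr sdev_sqr.
rewrite [vp / _]mulrC -mulrA; apply: ler_wpM2l; first by rewrite invr_ge0 exprn_ge0// ltW.
by apply: sum_incr_le => [f s|f]; [rewrite !sw|rewrite sqr_ge0].
Qed.

(** The tuples absent from [H] have a repeated index; on flat points [noninj_sum] bounds their
    increments by p^4 dl times those of [lin], so a weak linear field compensates for them. *)
Lemma incr_HF_H c (dl : R) : (2 <= p)%N -> sph c -> 0 <= dl ->
  (forall k i, c k i ^+ 2 <= dl * NR) ->
  incr_le (HF c) (H c ++ scl (p%:R ^+ 2 * Num.sqrt dl) (lin c)).
Proof.
move=> p2 sc dl0 cd i j.
rewrite -/(dist2 (HF c) i j) -/(dist2 (_ ++ _) i j) dist2_cat dist2_scl !dist2E !big_map.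
rewrite big_filter !big_enum_cond/=.
rewrite [leLHS](eq_bigr (fun f : T => (Num.sqrt vp * sd) ^+ 2 * (mono (c i) f - mono (c j) f) ^+ 2));
  last by move=> f _; rewrite -mulrBr [LHS]exprMn.
rewrite [X in _ <= X + _](eq_bigr (fun f : T => sd ^+ 2 * (mono (c i) f - mono (c j) f) ^+ 2)); last first.
  by move=> f _; rewrite -mulrBr exprMn.
rewrite [X in _ + _ * X](eq_bigr (fun k => NR^-1 ^+ 2 * ((c i - c j) k * (c i - c j) k))); last first.
  by move=> k _; rewrite -mulrBr exprMn.
rewrite -!mulr_sumr coef_sqr sdev_sqr -/(inner (c i - c j) (c i - c j)).
rewrite (bigID (fun f : T => injectiveb f))/= sum_incr; last first.
  by move=> f s; rewrite !mono_sym.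
set S1 := \sum_(f | incr f) _; set S2 := \sum_(f | ~~ _) _.
have h2 : S2 <= p%:R ^+ 4 * (dl * NR) * NR ^+ p.-2 * inner (c i - c j) (c i - c j).
  by apply: noninj_sum => //; rewrite mulr_ge0// ltW.
have -> : vp / NR ^+ p.+1 * (p`!%:R * S1 + S2) = (NR ^+ p.+1)^-1 * S1 + vp / NR ^+ p.+1 * S2.
  have P0 : NR ^+ p.+1 != 0 by rewrite expf_neq0.
  have F0 : p`!%:R != 0 :> R by rewrite pnatr_eq0 -lt0n fact_gt0.
  move: (NR ^+ p.+1) P0 (p`!%:R : R) F0 => q P0 q' F0.
  by field; rewrite P0 F0.
rewrite lerD2l.
have Np : 0 <= (NR ^+ p.+1)^-1 by rewrite invr_ge0 exprn_ge0// ltW.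
apply: (@le_trans _ _ ((NR ^+ p.+1)^-1 * S2)).
  rewrite -mulrA ler_piMl ?vp_le1// mulr_ge0//.
  by apply: sumr_ge0 => f _; exact: sqr_ge0.
apply: (le_trans (ler_wpM2l Np h2)).
have -> : p.+1 = (p.-2 + 3)%N by move: p2; case: (p) => [|[|q]] // _; rewrite addn3.
have q0 : NR ^+ p.-2 != 0 by rewrite expf_neq0.
rewrite exprD exprMn sqr_sqrtr//; move: (inner _ _) (NR ^+ p.-2) q0 => D q q0.
suff -> : (q * NR ^+ 3)^-1 * (p%:R ^+ 4 * (dl * NR) * q * D) =
  (p%:R ^+ 2) ^+ 2 * dl * (NR^-1 ^+ 2 * D) by [].
by field; rewrite NRn.
Qed.

(** By Cauchy-Schwarz the field is bounded by the norm of one Gaussian vector, so the cost is of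
    first order in [kap]. This is affordable for the weak field left by the diagonal entries, but
    not for the fields that come from decoupling. *)
Lemma Emax_lin c (s kap : R) n x : sph c -> 0 <= s -> 0 <= kap ->
  Emax s (scl kap (lin c)) n x <=
    expR (3 / 2 * (s * kap) + 2 * (s * kap) ^+ 2 / NR) * expmax s x.
Proof.
move=> sc s0 k0; rewrite /Emax.
pose es : seq ('I_N -> R) := [seq (fun i => (i == j)%:R) | j <- enum 'I_N].
pose L (g : 'I_N -> R) : K -> R := fun k => kap * (NR^-1 * dotp (c k) g).
have -> : scl kap (lin c) = map L es.
  rewrite /scl /lin /es -!map_comp; apply: eq_map => j /=; apply/funext => k.
  rewrite vscaleE /L /dotp (bigD1 j)//= eqxx mulr1 big1 ?addr0//.
  by move=> i ij; rewrite (negbTE ij) mulr0.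
rewrite -(@gE_map R ('I_N -> R) (K -> R) n L es (fun y => expmax s (x + y))); last 2 first.
- by move=> g h; apply/funext => k; rewrite vaddE /L dotpD; ring.
- by move=> a g; apply/funext => k; rewrite vscaleE /L dotpZ; ring.
pose rN := Num.sqrt NR; have rN0 : 0 < rN by rewrite sqrtr_gt0.
have rN2 : rN ^+ 2 = NR by rewrite sqr_sqrtr// ltW.
pose t := s * kap / rN; have t0 : 0 <= t by rewrite divr_ge0 ?mulr_ge0// ltW.
apply: (@le_trans _ _ (gE n es (fun g => expmax s x * expR (t * Num.sqrt (dotp g g + NR))))).
  apply: gE_le => g /=; apply: expmax_le => [|k]; first by rewrite mulr_ge0 ?expmax_ge0 ?expR_ge0.
  rewrite vaddE mulrDr expRD; apply: ler_pM; rewrite ?expR_ge0//; first exact: expmax_ge.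
  rewrite ler_expR /L /t; set S := Num.sqrt _.
  have S0 : 0 <= S by exact: sqrtr_ge0.
  have gg0 : 0 <= dotp g g by apply: sumr_ge0 => i _; rewrite -expr2 sqr_ge0.
  have S2 : S ^+ 2 = dotp g g + NR by rewrite sqr_sqrtr// addr_ge0// ltW.
  have -> : s * (kap * (NR^-1 * dotp (c k) g)) = s * kap / rN * (dotp (c k) g / rN).
    by rewrite -rN2; field; rewrite gt_eqF.
  apply: ler_wpM2l => //; rewrite ler_pdivrMr//.
  have h : 0 <= \sum_i (S * c k i - rN * g i) ^+ 2 by apply: sumr_ge0 => i _; exact: sqr_ge0.
  have e : \sum_i (S * c k i - rN * g i) ^+ 2 =
      S ^+ 2 * NR + rN ^+ 2 * dotp g g - 2 * (S * rN) * dotp (c k) g.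
    rewrite -(sc k) /inner /dotp !mulr_sumr -big_split -sumrB/=; apply: eq_bigr => i _.
    by rewrite sqrrB; ring.
  have [Sz|Sn] := eqVneq S 0.
    by move: S2; rewrite Sz expr0n/= => S2; have := NR0; lra.
  have Sp : 0 < S by rewrite lt_def Sn.
  rewrite -(ler_pM2l (_ : 0 < 2 * (S * rN))) ?mulr_gt0//.
  have -> : 2 * (S * rN) * (S * rN) = 2 * (S ^+ 2 * NR) by rewrite -rN2; ring.
  have h3 : NR * dotp g g <= S ^+ 2 * NR by rewrite mulrC S2 ler_wpM2r// ?lerDl ltW.
  by move: h; rewrite e rN2; lra.
rewrite gE_mull mulrC; apply: ler_wpM2r; first exact: expmax_ge0.
rewrite /gE -map_comp.
have z0 : dotp (0 : 'I_N -> R) 0 = 0 by rewrite /dotp big1// => i _; rewrite mul0r.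
have tr : t * rN = s * kap by rewrite /t divfK// gt_eqF.
have t2 : t ^+ 2 = (s * kap) ^+ 2 / NR by rewrite /t exprMn exprVn rN2.
apply: (le_trans (iter_step_bound n (expR_ge0 _) (fun g => step_exp_norm _ g N_gt0 t0) 0)).
rewrite z0 add0r -/rN -expRM_natl -expRD ler_expR tr.
have [->|n0] := posnP n.
  rewrite mul0r add0r; have : 0 <= 2 * (s * kap) ^+ 2 / NR.
    by rewrite divr_ge0 ?(ltW NR0)// mulr_ge0// sqr_ge0.
  by have := mulr_ge0 s0 k0; lra.
by rewrite mulrA invsqrt_sqr// mul1r t2; lra.
Qed.

End Fields.
End Sphere.

(** * Linear fields against even tensor fields *)
Section Sign.
Context {R : realType}.
Variables p N : nat.
Hypothesis N_gt0 : (0 < N)%N.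
Hypothesis p_ge4 : (4 <= p)%N.
Hypothesis p_even : ~~ odd p.
Notation vp := (p`!%:R^-1 : R).
Notation NR := (N%:R : R).

Let NR0 : 0 < NR. Proof. by rewrite ltr0n. Qed.
Let vp0 : 0 < vp. Proof. exact: vp_gt0. Qed.

Lemma even_pow_ge0 (x : R) : 0 <= x ^+ p.
Proof. by apply: exprn_even_ge0. Qed.

Lemma even_pow_norm (x : R) : `|x| ^+ p = x ^+ p.
Proof. by rewrite -normrX ger0_norm// even_pow_ge0. Qed.

Lemma even_pow_le1 (x : R) : `|x| <= 1 -> x ^+ p <= 1.
Proof. by move=> x1; rewrite -even_pow_norm exprn_ile1. Qed.

Context {K : finType}.
Variable c : K -> 'I_N -> R.
Hypothesis sc : sph c.

(** Overlap 7/8 with a common center means squared distance at most N/4 from it, hence at most N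
    between the two points. *)
Lemma same_cap i j k : 7 / 8 <= ov (c i) (c k) -> 7 / 8 <= ov (c j) (c k) -> 0 <= ov (c i) (c j).
Proof.
move=> hi hj; have := inner_triangle (c i) (c j) (c k).
rewrite !(ov_dist N_gt0 (sc _) (sc _)) -mulrDr (mulrCA 2 NR) ler_pM2l//; lra.
Qed.

Lemma opposite_cap i j k : ov (c i) (c k) <= - (7 / 8) -> ov (c j) (c k) <= - (7 / 8) ->
  0 <= ov (c i) (c j).
Proof.
move=> hi hj; have := inner_triangle (c i) (c j) (- c k).
have nk : inner (- c k) (- c k) = NR by rewrite innerN sc.
rewrite !(ov_dist N_gt0 (sc _) nk) !(ov_dist N_gt0 (sc _) (sc _)).
rewrite -mulrDr (mulrCA 2 NR) ler_pM2l// ![ov _ (- c k)]ovC !ovN ![ov (c k) _]ovC; lra.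
Qed.

(* The sign cannot be read off an even field: points are grouped around greedily chosen centers,
   and the sign relative to the center is paid for by an independent noise per cell. *)
Theorem linear_le_tensor (s th : R) : 0 < s -> 0 <= th ->
  asle (Emax s (scl th (lin c)))
    (fun n x => 4 * expR (64 * (s ^+ 2 * (th ^+ 2 / NR))) *
       Emax s (scl (Num.sqrt (20 / vp) * th) (HF p c)) n x).
Proof.
move=> s0 th0 eps e0.
pose tN := th ^+ 2 / NR; have tN0 : 0 <= tN by rewrite divr_ge0 ?sqr_ge0// ltW.
pose bN := Num.sqrt (2 / NR) * th.
have bN0 : 0 <= bN by rewrite mulr_ge0// sqrtr_ge0.
have bN2 : bN ^+ 2 = 2 * tN.
  by rewrite exprMn sqr_sqrtr ?divr_ge0 ?(ltW NR0)// /tN; field; rewrite gt_eqF.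
pose a1 := Num.sqrt (1 / vp) * th; pose a2 := Num.sqrt (20 / vp) * th.
have a12 : a1 ^+ 2 = th ^+ 2 / vp.
  by rewrite exprMn sqr_sqrtr ?divr_ge0 ?(ltW vp0)// mul1r mulrC.
have a22 : a2 ^+ 2 = 20 * (th ^+ 2 / vp).
  by rewrite exprMn sqr_sqrtr ?divr_ge0 ?(ltW vp0)// mulrAC -mulrA.
have vE (x : R) : th ^+ 2 / vp * (vp / NR * x) = tN * x.
  by rewrite /tN; move: vp vp0 => v v0; field; rewrite (gt_eqF NR0) (gt_eqF v0).
have [A1 [A10 hA1 hA1']] := l1_bound2 (scl th (lin c)) (scl a1 (HF p c)).
have [A2 [A20 hA2 hA2']] := l1_bound2 (scl a2 (HF p c)) (scl (2 * a1) (HF p c)).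
pose A := A1 + A2 + 2 * bN.
have A0 : 0 <= A by rewrite !addr_ge0// mulr_ge0.
have V1 : 0 <= 3 * tN by rewrite mulr_ge0.
have V2 : 0 <= 28 * tN by rewrite mulr_ge0.
have e3 : 0 < eps / 2 by rewrite divr_gt0.
have [n1 Hn1] := @compare_var R K s _ A _ s0 V1 e3 A0.
have [n2 Hn2] := @compare_var R K s _ A _ s0 V2 e3 A0.
have [n3 Hn3] := @compare_var R (K * bool)%type s _ A _ s0 V2 e3 A0.
exists (maxn n1 (maxn n2 n3)) => n; rewrite !geq_max => /andP[nn1 /andP[nn2 nn3]] x.
(* The threshold 7/8 is close enough to 1 for [same_cap], and low enough that 20 (2 - 2 (7/8)^4) >=
   16, by which the tensor field dominates the noise at distinct centers. *)
pose near : rel K := fun i j => 7 / 8 <= `|ov (c i) (c j)|.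
have nr : reflexive near by move=> i; rewrite /near (ov_self N_gt0 (sc i)) normr1; lra.
have nsy : symmetric near by move=> i j; rewrite /near ovC.
have [ce [xce nce sce]] := greedy_centers x nr nsy.
pose sg i := 0 <= ov (c i) (c (ce i)).
pose psi (q : K * bool) := (ce q.1, q.2).
pose phi (i : K) := (i, sg i).
pose x' (q : K * bool) := x (ce q.1).
have ovp0 i j : 0 <= ov (c i) (c j) ^+ p by exact: even_pow_ge0.
have ovp1 i j : ov (c i) (c j) ^+ p <= 1 by apply: even_pow_le1; exact: (ov_norm N_gt0 (sc i) (sc j)).
have ovl i j : -1 <= ov (c i) (c j) <= 1 by rewrite -ler_norml; exact: (ov_norm N_gt0 (sc i) (sc j)).
have covHF1 i : cov (HF p c) i i = vp / NR by rewrite cov_HF// (ov_self N_gt0 (sc i)) expr1n mulr1.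
(* Within a cell (same center, same sign) overlaps are nonnegative, so o^p <= o and tensor
   increments dominate linear ones. Across cells the noise alone supplies 4 tN, the largest possible
   increment of the linear field. *)
have S1 : Emax s (scl th (lin c)) n x <= expR (s ^+ 2 * (3 * tN) + eps / 2) *
    Emax s (scl a1 (HF p c) ++ cells bN (psi \o phi)) n x.
  apply: (Hn1 n nn1).
  - by move=> i; apply: (le_trans (hA1 i)); rewrite /A -addrA lerDl addr_ge0// mulr_ge0.
  - move=> i; rewrite l1_cat l1_cells (ger0_norm bN0).
    by have := hA1' i; rewrite /A; lra.
  - move=> i; rewrite cov_scale cov_lin// (ov_self N_gt0 (sc i)) mul1r -/tN; lra.
  - move=> i; rewrite cov_cat cov_scale covHF1 cov_cells eqxx mulr1 bN2 a12.
    by have := vE 1; rewrite !mulr1 => ->; lra.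
  move=> i j; rewrite -/(dist2 (scl th (lin c)) i j) -/(dist2 (_ ++ _) i j) dist2_cat.
  rewrite !dist2_scl dist2_lin// dist2_HF// dist2_cells a12 bN2 vE.
  have -> : th ^+ 2 * (NR^-1 * (2 - 2 * ov (c i) (c j))) = tN * (2 - 2 * ov (c i) (c j)).
    by rewrite mulrA.
  have [e|ne] := eqVneq ((psi \o phi) i) ((psi \o phi) j); last first.
    rewrite /= mulr1; have -> : 2 * (2 * tN) = tN * 4 by ring.
    by rewrite -mulrDr; apply: ler_wpM2l => //; have := ovl i j; have := ovp1 i j; lra.
  rewrite mulr0 addr0; apply: ler_wpM2l => //.
  have ov0 : 0 <= ov (c i) (c j).
    case: e => e1 e2; have := nce i; have := nce j; rewrite /near -e1.
    move: e2; rewrite /sg -e1; have [i0|i0] := ger0P (ov (c i) (c (ce i))).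
      move/esym => j0; rewrite (ger0_norm j0) => h1 h2; exact: same_cap h2 h1.
    move/esym/negbT; rewrite -ltNge => j0; rewrite (ltr0_norm j0) => h1 h2.
    by apply: (opposite_cap (k := ce i)); lra.
  have : ov (c i) (c j) ^+ p <= ov (c i) (c j).
    rewrite -[leRHS]expr1; apply: ler_wiXn2l => //; first by case/andP: (ovl i j).
    exact: leq_trans p_ge4.
  by lra.
have S2 : Emax s (scl (2 * a1) (HF p c)) n x <=
    expR (s ^+ 2 * (28 * tN) + eps / 2) * Emax s (scl a2 (HF p c)) n x.
  have c1 i : cov (scl (2 * a1) (HF p c)) i i = 4 * tN.
    by rewrite cov_scale covHF1 exprMn a12 -mulrA; have := vE 1; rewrite !mulr1 => ->; ring.
  have c2 i : cov (scl a2 (HF p c)) i i = 20 * tN.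
    by rewrite cov_scale covHF1 a22 -mulrA; have := vE 1; rewrite !mulr1 => ->.
  apply: (Hn2 n nn2).
  - by move=> i; apply: (le_trans (hA2' i)); rewrite /A; lra.
  - by move=> i; apply: (le_trans (hA2 i)); rewrite /A; lra.
  - by move=> i; rewrite c1; lra.
  - by move=> i; rewrite c2; lra.
  move=> i j; rewrite -/(dist2 (scl (2 * a1) (HF p c)) i j) -/(dist2 (scl a2 (HF p c)) i j).
  rewrite !dist2_scl; apply: ler_wpM2r; first exact: dist2_ge0.
  rewrite exprMn a12 a22; apply: ler_wpM2r; last by rewrite -natrX ler_nat.
  by rewrite divr_ge0 ?sqr_ge0// ltW.
(* Passing to the center of each cell only raises the mean, so the noise can live on pairs (center,
   sign). *)
have S3 : Emax s (cells (2 * bN) (psi \o phi)) n x <= Emax s (cells (2 * bN) psi) n x'.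
  apply: le_trans (Emax_sub phi s (cells (2 * bN) psi) n x').
  have -> : [seq (u \o phi : K -> R) | u <- cells (2 * bN) psi] = cells (2 * bN) (psi \o phi).
    by rewrite /cells -map_comp.
  apply: Emax_mono; first exact: ltW.
  by move=> k; rewrite /x' /=; exact: xce.
(* The number of centers is not controlled, so their noise cannot be estimated by counting. Being
   separated, they have tensor increments that dominate it; only the two signs keep a noise of their
   own, removed in [S5]. *)
have S4 : Emax s (cells (2 * bN) psi) n x' <= expR (s ^+ 2 * (28 * tN) + eps / 2) *
   Emax s (scl a2 (HF p (fun q : K * bool => c (ce q.1))) ++ cells (2 * bN) (@snd K bool)) n x'.
  have b2 : (2 * bN) ^+ 2 = 8 * tN by rewrite exprMn bN2; ring.
  have sc' : sph (fun q : K * bool => c (ce q.1)) by move=> q; exact: sc.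
  apply: (Hn3 n nn3).
  - by move=> q; rewrite l1_cells ger0_norm ?mulr_ge0// /A; lra.
  - move=> q; rewrite l1_cat l1_cells ger0_norm ?mulr_ge0//.
    have := hA2 (ce q.1); rewrite /A /l1 /scl /HF /HFg !big_map => h.
    by move: h; set X := \sum_(_ <- _) _ => h; lra.
  - by move=> q; rewrite cov_cells eqxx mulr1 b2; lra.
  - move=> q; rewrite cov_cat cov_scale cov_HF// (ov_self N_gt0 (sc _)) expr1n mulr1 cov_cells eqxx mulr1 b2 a22.
    by rewrite -mulrA; have := vE 1; rewrite !mulr1 => ->; lra.
  move=> q r; rewrite -/(dist2 (cells (2 * bN) psi) q r) -/(dist2 (_ ++ _) q r) dist2_cat.
  rewrite dist2_scl dist2_HF// !dist2_cells b2 a22 -(mulrA 20) vE.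
  set o := ov _ _.
  have o1 : o ^+ p <= 1 by exact: ovp1.
  have [e|ne] := eqVneq q.2 r.2; last first.
    have -> : psi q != psi r by apply/eqP => -[_ e2]; rewrite e2 eqxx in ne.
    by rewrite lerDr mulr_ge0// mulr_ge0//; lra.
  rewrite mulr0 addr0; have [e'|ne'] := eqVneq (psi q) (psi r).
    by rewrite mulr0 mulr_ge0// mulr_ge0//; lra.
  have nq : ce q.1 != ce r.1.
    by apply: contra ne' => /eqP e1; rewrite /psi e e1.
  have := sce q.1 r.1 nq; rewrite /near -ltNge -/o => oo.
  have o4 : o ^+ p <= (7 / 8) ^+ 4.
    rewrite -even_pow_norm; apply: (@le_trans _ _ (`|o| ^+ 4)).
      by apply: ler_wiXn2l => //; lra.
    by apply: lerXn2r; rewrite ?nnegrE//; lra.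
  rewrite mulr1; have h : 16 <= 20 * (2 - 2 * o ^+ p) by move: o4; rewrite !exprS expr0; lra.
  have := ler_wpM2l tN0 h; lra.
have S5 y : Emax s (cells (2 * bN) (@snd K bool)) n y <=
    (2 * expR (2 * (s * (2 * bN)) ^+ 2)) ^+ 2 * expmax s y.
  have := @Emax_small R (K * bool)%type s (2 * bN) (cells (2 * bN) (@snd K bool)) n y (ltW s0).
  rewrite /cells size_map -cardE card_bool; apply => u /mapP[d _ ->] k.
  by rewrite normrM ger0_norm ?mulr_ge0// ler_piMr ?mulr_ge0//; case: (_ == _); rewrite ?normr1 ?normr0.
set E := Emax s (scl a2 (HF p c)) n x.
have E0 : 0 <= E by exact: Emax_ge0.
have S6 : Emax s (scl a2 (HF p (fun q : K * bool => c (ce q.1))) ++ cells (2 * bN) (@snd K bool)) n x' <=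
    (2 * expR (2 * (s * (2 * bN)) ^+ 2)) ^+ 2 * E.
  rewrite Emax_cat; apply: (@le_trans _ _ (gE n (scl a2 (HF p (fun q : K * bool => c (ce q.1))))
     (fun y => (2 * expR (2 * (s * (2 * bN)) ^+ 2)) ^+ 2 * expmax s (x' + y)))).
    by apply: gE_le => y; exact: S5.
  rewrite gE_mull; apply: ler_wpM2l; first exact: sqr_ge0.
  have -> : scl a2 (HF p (fun q : K * bool => c (ce q.1))) =
      [seq (u \o (fun q : K * bool => ce q.1) : K * bool -> R) | u <- scl a2 (HF p c)].
    by rewrite /scl /HF /HFg -!map_comp.
  exact: (Emax_sub (fun q : K * bool => ce q.1) s (scl a2 (HF p c)) n x).
have S7 := @Emax_split R K s (scl a1 (HF p c)) (cells bN (psi \o phi)) n x (ltW s0).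
rewrite scl_scl scl_cells in S7.
have eN : (2 * expR (2 * (s * (2 * bN)) ^+ 2)) ^+ 2 = 4 * expR (s ^+ 2 * (32 * tN)).
  rewrite exprMn -expRM_natl; congr (_ * expR _); first by ring.
  have -> : (s * (2 * bN)) ^+ 2 = 4 * s ^+ 2 * bN ^+ 2 by ring.
  by rewrite bN2; ring.
rewrite eN in S6.
pose X := expR (s ^+ 2 * tN); have X1 : 1 <= X by rewrite -expR0 ler_expR mulr_ge0// sqr_ge0.
have X0 : 0 <= X by exact: le_trans X1.
have XE m : expR (s ^+ 2 * (m%:R * tN)) = X ^+ m by rewrite -expRM_natl mulrCA.
pose Y := expR (eps / 2); have Y0 : 0 <= Y by exact: expR_ge0.
have S8 : Emax s (scl a1 (HF p c) ++ cells bN (psi \o phi)) n x <= 5 / 2 * (X ^+ 60 * Y * E).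
  apply: (le_trans S7).
  have S34 := le_trans (le_trans S3 S4) (ler_wpM2l (expR_ge0 _) S6).
  rewrite expRD !XE -/Y in S34.
  have {}S34 : Emax s (cells (2 * bN) (psi \o phi)) n x <= 4 * (X ^+ 60 * Y * E).
    apply: (le_trans S34).
    have -> : X ^+ 28 * Y * (4 * X ^+ 32 * E) = 4 * (X ^+ (28 + 32) * Y * E) by rewrite exprD; ring.
    exact: lexx.
  rewrite expRD XE -/Y -/E in S2.
  have h : X ^+ 28 * Y * E <= X ^+ 60 * Y * E.
    rewrite -!(mulrA (X ^+ _)); apply: ler_wpM2r; first by rewrite mulr_ge0.
    exact: ler_weXn2l.
  by move: S2 S34 h; move: (Emax _ _ _ _) (Emax _ _ _ _) => u1 u2; lra.
apply: (le_trans S1); rewrite expRD XE -/Y.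
apply: (@le_trans _ _ (X ^+ 3 * Y * (5 / 2 * (X ^+ 60 * Y * E)))).
  by apply: ler_wpM2l S8; rewrite mulr_ge0// exprn_ge0.
have -> : expR eps = Y ^+ 2 by rewrite /Y -expRM_natl; congr expR; field.
have -> : expR (64 * (s ^+ 2 * (th ^+ 2 / NR))) = X ^+ 64.
  by rewrite /X -expRM_natl.
rewrite -/a2 -/E.
have -> : X ^+ 3 * Y * (5 / 2 * (X ^+ 60 * Y * E)) = Y ^+ 2 * (5 / 2 * X ^+ 63 * E).
  by rewrite (exprD X 3 60); ring.
apply: ler_wpM2l; first exact: sqr_ge0.
apply: ler_wpM2r => //.
have h : X ^+ 63 <= X ^+ 64 by apply: ler_weXn2l.
have : 0 <= X ^+ 63 by rewrite exprn_ge0.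
move: (X ^+ 63) (X ^+ 64) h => u1 u2; lra.
Qed.

End Sign.

(** * The maximum of the tensor field over flat points *)
Section Bound.
Context {R : realType}.

(** Only walks of 2^l steps are compared with Gaussian disorder, hence a bound along powers of
    two. *)
Definition evb (F : nat -> R) (B : R) : Prop :=
  forall eps : R, 0 < eps -> exists l0, forall l, (l0 <= l)%N -> F (2 ^ l)%N <= expR eps * B.

Lemma ltn_pow2 l : (l <= 2 ^ l)%N.
Proof. exact: ltnW (ltn_expl _ _). Qed.

Lemma asle_evb (T : Type) (F G : nat -> T -> R) (c B : R) (t : T) : 0 <= c ->
  asle F (fun n t => c * G n t) -> evb (fun n => G n t) B -> evb (fun n => F n t) (c * B).
Proof.
move=> c0 FG GB eps e0; have e2 : 0 < eps / 2 by rewrite divr_gt0.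
have [n0 h0] := FG _ e2; have [l1 h1] := GB _ e2.
exists (maxn n0 l1) => l; rewrite geq_max => /andP[k0 k1].
apply: (le_trans (h0 _ (leq_trans k0 (ltn_pow2 l)) t)).
have -> : expR eps * (c * B) = expR (eps / 2) * (c * (expR (eps / 2) * B)).
  by rewrite [expR eps](_ : _ = expR (eps / 2) * expR (eps / 2)); [ring|rewrite -expRD -splitr].
by rewrite ler_wpM2l ?expR_ge0// ler_wpM2l// h1.
Qed.

Lemma evb_le F G (c B : R) : 0 <= c -> (forall n, F n <= c * G n) -> evb G B -> evb F (c * B).
Proof.
move=> c0 FG GB eps e0; have [l1 h1] := GB _ e0; exists l1 => l /h1 h.
by apply: (le_trans (FG _)); rewrite mulrCA ler_wpM2l.
Qed.

Lemma Theta_inner (D : domain) N (z : 'I_N -> R) : Theta R D N z -> inner z z = N%:R.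
Proof.
case: D => //= h; rewrite /inner (eq_bigr (fun=> 1)) ?sumr_const ?card_ord// => i _.
by case: (h i) => ->; ring.
Qed.

Lemma sphere_coord N (z : 'I_N -> R) i : inner z z = N%:R -> `|z i| <= N%:R.
Proof.
move=> h; rewrite -(@ler_pXn2r _ 2) ?nnegrE// real_normK ?num_real//.
apply: (@le_trans _ _ (inner z z)).
  rewrite /inner (bigD1 i)//= -expr2 lerDl; apply: sumr_ge0 => j _.
  by rewrite -expr2 sqr_ge0.
by rewrite h -natrX ler_nat; case: (N) => // m; rewrite expnS expn1 leq_pmull.
Qed.

Lemma Hamil_le_max D p N (J : {ffun 'I_p -> 'I_N} -> R) z :
  Theta R D N z -> Hamil J z <= maxH D J.
Proof.
move=> zT; apply: ub_le_sup; last by exists z.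
exists (\sum_(f | incr f) `|J f| * N%:R ^+ p) => _ [y yT <-].
apply: ler_sum => f _; apply: (le_trans (ler_norm _)); rewrite normrM.
apply: ler_wpM2l => //; rewrite normr_prod -[in leRHS](card_ord p) -prodr_const.
by apply: ler_prod => i _; rewrite normr_ge0/=; apply: sphere_coord; exact: Theta_inner yT.
Qed.

Variables (p N : nat) (D : domain).
Hypothesis N_gt0 : (0 < N)%N.
Hypothesis p_ge4 : (4 <= p)%N.
Hypothesis p_even : ~~ odd p.
Notation vp := (p`!%:R^-1 : R).
Notation NR := (N%:R : R).
Notation T := {ffun 'I_p -> 'I_N}.
Let NR0 : 0 < NR. Proof. by rewrite ltr0n. Qed.
Let vp0 : 0 < vp. Proof. exact: vp_gt0. Qed.

(** Deterministic form of an upper bound on the ground state: finite families, exponential moments,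
    walks in place of disorder. The factor 4 and the variance term are the loss of passing from an
    event to a moment. *)
Definition max_bound (eta : R) : Prop :=
  forall (K : finType) (c : K -> 'I_N -> R), (forall k, Theta R D N (c k)) ->
  forall s : R, 0 < s ->
    evb (fun n => Emax s (H p c) n 0) (4 * expR (s * eta + 2 * s ^+ 2 / NR)).

(** On an event of probability at least 1/4 no point exceeds [eta], so the negative moment of the
    partition function is bounded below. [concentration_smooth] bounds its product with the
    exponential moment of the maximum, hence bounds the latter. *)
Lemma disorder_max_bound (d : measure_display) (Omega : measurableType d)
    (P : probability Omega R) (J : T -> Omega -> R) (eta : R) (A : set Omega) :
  gaussian_disorder P J -> measurable A -> ((1 / 2)%:E <= P A)%E ->
  (forall om, A om -> maxH D (J^~ om) <= eta) -> max_bound eta.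
Proof.
move=> HJ mA PA Aeta K c cT s s0 eps e0.
have [K0|[k0 _]] : #|K| = 0%N \/ exists k : K, k \in K.
- by case: (posnP #|K|) => [->|/card_gt0P[i Ii]]; [left|right; exists i].
  exists 0%N => l _; rewrite /Emax.
  have -> : (fun y => expmax s (0 + y)) = (fun _ : K -> R => 0).
    by apply/funext => y; exact: expmax_empty.
  by rewrite gE_cst mulr_ge0 ?expR_ge0// mulr_ge0// expR_ge0.
have sc : sph c by move=> k; exact: Theta_inner (cT k).
have e4 : 0 < eps / 4 by rewrite divr_gt0.
have [A1 hA1] := l1_bound (H p c).
have A10 : 0 <= A1 by exact: le_trans (l1_ge0 (H p c) k0) (hA1 k0).
have v0 : 0 <= NR^-1 by rewrite invr_ge0 ltW.
have [m [beta [m0 b0 mb ml [n0 Hn0]]]] := concentration_smooth k0 s0 v0 e4 A10.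
have covH i j : cov (H p c) i j <= NR^-1.
  apply: le_trans (ler_norm _) _; apply: cov_var => k.
  have h : cov (H p c) k k <= cov (HF p c) k k.
    by apply: (@cov_Hg_le R p N K (fun k => @mono R p N (c k)) k) => ?; exact: mono_sym.
  apply: (le_trans h); rewrite cov_HF// (ov_self N_gt0 (sc k)) expr1n mulr1.
  by rewrite ler_piMl ?vp_le1.
(* Discarding disorder too large for the grid costs probability 1/4 out of the assumed 1/2. *)
have q4 : 0 < 1 / 4 :> R by lra.
have [Rm [Rm0 [B [mB PB hB]]]] := disorder_tail HJ N_gt0 q4.
pose w (f : T) (k : K) : R := beta * mono (c k) f.
pose mm : 'I_1 -> R := fun _ => - m.
pose W : 'I_1 -> K -> R := fun _ _ => 1.
pose b := expR (- (eps / 4) - s * eta).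
have bgt0 : 0 < b by exact: expR_gt0.
pose E := A `\` B.
have mE : measurable E by exact: measurableD.
have powE x : power_fun mm W x = expR (- m * ln (\sum_i expR (x i))).
  rewrite /power_fun big_ord1 /mm /partition_fun; congr (expR (_ * ln _)).
  by apply: eq_bigr => i _; rewrite mul1r.
have hb om : E om -> b <= power_fun mm W (\sum_(f | incr f) J f om *: w f).
  move=> [Aom _]; rewrite powE /b ler_expR.
  have hs k : (\sum_(f | incr f) J f om *: w f) k <= beta * eta.
    have -> : (\sum_(f | incr f) J f om *: w f) k = beta * Hamil (J^~ om) (c k).
      rewrite fct_sumE /Hamil mulr_sumr; apply: eq_bigr => f _.
      by rewrite vscaleE /w mulrCA.
    rewrite ler_pM2l//; exact: le_trans (Hamil_le_max _ (cT k)) (Aeta _ Aom).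
  set x := \sum_(f | _) _ in hs *.
  have h1 : \sum_i expR (x i) <= #|K|%:R * expR (beta * eta).
    rewrite (le_trans (_ : _ <= \sum_(i : K) expR (beta * eta)))//.
      by apply: ler_sum => i _; rewrite ler_expR.
    by rewrite sumr_const -[leLHS]mulr_natl.
  have K0 : 0 < #|K|%:R :> R by rewrite ltr0n; apply/card_gt0P; exists k0.
  have h2 : ln (\sum_i expR (x i)) <= ln #|K|%:R + beta * eta.
    rewrite -[X in _ + X]expRK -lnM ?posrE ?expR_gt0//.
    rewrite ler_ln ?posrE//; first exact: (sum_expR_gt0 k0 x).
    by rewrite mulr_gt0// expR_gt0.
  have := ler_wpM2l (ltW m0) h2; rewrite mulrDr (mulrA m beta) mb; lra.
have W0 j i : 0 <= W j i by exact: ler01.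
have W1 j : exists i, 0 < W j i by exists k0; exact: ltr01.
have [l0 Hl0] := disorder_le_walk HJ N_gt0 W0 W1 Rm0 bgt0 e4
   (fun om (h : E om) => hB om h.2) hb.
exists (maxn n0 l0) => l; rewrite geq_max => /andP[k1 k2].
have [B' [mB' EB' hB']] := Hl0 l k2.
have PB' : 1 / 4 <= fine (P B').
  have h1 : (P A <= P B + P E)%E.
    have -> : A = (A `&` B) `|` E by rewrite /E setDE -setIUr setUv setIT.
    rewrite measureU; [|exact: measurableI|exact: mE|].
      apply: leeD; last exact: lexx.
      by apply: le_measure; rewrite ?inE//; first [exact: measurableI|move=> ? []].
    by rewrite /E; apply/seteqP; split=> // ? [[_ ?] [_ []]].
  have h2 : (P E <= P B')%E by apply: le_measure; rewrite ?inE.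
  have := le_trans PA (le_trans h1 (leeD PB h2)).
  have fB : P B' \is a fin_num by exact: fin_num_measure.
  by rewrite -(fineK fB) -EFinD lee_fin; lra.
move: hB'; have fB : P B' \is a fin_num by exact: fin_num_measure.
rewrite -(fineK fB) -EFinM lee_fin.
have -> : [seq sdev R p N *: w f | f <- enum T & incr f] = [seq beta *: u | u <- H p c].
  rewrite /H /Hg -map_comp; apply: eq_map => f; apply/funext => k.
  by rewrite /= !vscaleE /w mulrCA.
rewrite -gE_scale.
have -> : (fun y : K -> R => power_fun mm W (beta *: y)) =
    (fun y => expR (- m * ln (\sum_i expR (beta * y i)))).
  by apply/funext => y; rewrite powE.
move=> hneg; have hn := Hn0 (2 ^ l)%N (leq_trans k1 (ltn_pow2 l)) (H p c) hA1 covH.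
have -> : Emax s (H p c) (2 ^ l) 0 = gE (2 ^ l) (H p c) (expmax s).
  by rewrite /Emax; congr gE; apply/funext => y; rewrite add0r.
move: hn hneg; set X := gE _ _ (expmax s); set Y := gE _ _ _ => hn hneg.
have X0 : 0 <= X by apply: gE_ge0 => y; exact: expmax_ge0.
have h5 : X * (b * (1 / 4)) <= expR (eps / 4) * expR (2 * s ^+ 2 / NR + eps / 4).
  apply: (@le_trans _ _ (expR (eps / 4) * (X * Y))); last by rewrite ler_wpM2l ?expR_ge0.
  rewrite (mulrCA (expR (eps / 4))); apply: ler_wpM2l => //; apply: le_trans hneg.
  by apply: ler_wpM2l => //; exact: ltW.
have -> : X = X * (b * (1 / 4)) * (4 / b) by field; rewrite gt_eqF.
have bi : 0 <= 4 / b by rewrite divr_ge0// ltW.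
apply: (le_trans (ler_wpM2r bi h5)); rewrite /b -expRN -expRD.
have -> : expR (eps / 4 + (2 * s ^+ 2 / NR + eps / 4)) * (4 * expR (- (- (eps / 4) - s * eta))) =
  4 * (expR (eps / 4 + (2 * s ^+ 2 / NR + eps / 4)) * expR (- (- (eps / 4) - s * eta))) by ring.
rewrite [leRHS]mulrCA -!expRD ler_pM2l// ler_expR; lra.
Qed.

(* The exponent for one replica with an external linear field of strength [th]. *)
Lemma replica_bound (eta dl th s : R) (K : finType) (c : K -> 'I_N -> R) :
  max_bound eta -> (forall k, Theta R D N (c k)) -> 0 <= dl <= 1 -> 0 <= th -> 0 < s ->
  (forall k i, c k i ^+ 2 <= dl * NR) ->
  let kap := p%:R ^+ 2 * Num.sqrt dl in
  let s' := s * Num.sqrt (1 + 20 / vp * th ^+ 2) in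
  evb (fun n => Emax s (HF p c ++ scl th (lin c)) n 0)
    (16 * expR (64 * (s ^+ 2 * (th ^+ 2 / NR)) + 3 * s' ^+ 2 * (1 + kap ^+ 2) / NR +
       3 / 2 * (s' * kap) + s' * eta)).
Proof.
move=> Heta cT /andP[dl0 dl1] th0 s0 cd kap s'.
have sc : sph c by move=> k; exact: Theta_inner (cT k).
have kap0 : 0 <= kap by rewrite mulr_ge0 ?exprn_ge0 ?sqrtr_ge0.
pose r := Num.sqrt (1 + 20 / vp * th ^+ 2).
have r1 : 0 < 1 + 20 / vp * th ^+ 2.
  by rewrite ltr_pwDl// mulr_ge0 ?sqr_ge0// divr_ge0// ltW.
have r0 : 0 < r by rewrite sqrtr_gt0.
have r2 : r ^+ 2 = 1 + 20 / vp * th ^+ 2 by rewrite sqr_sqrtr// ltW.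
have s'0 : 0 < s' by rewrite mulr_gt0.
have i0 : 0 <= NR^-1 by rewrite invr_ge0 ltW.
have covHF1 i : cov (HF p c) i i = vp / NR.
  by rewrite cov_HF// (ov_self N_gt0 (sc i)) expr1n mulr1.
have vN : vp / NR <= NR^-1 by rewrite ler_piMl ?vp_le1.
pose V := (1 + kap ^+ 2) / NR.
have k2 : 0 <= kap ^+ 2 / NR by rewrite divr_ge0 ?sqr_ge0// ltW.
have VE : V = NR^-1 + kap ^+ 2 / NR by rewrite /V mulrDl mul1r.
have V0 : 0 <= V by rewrite VE addr_ge0.
have b1 : evb (fun n => Emax s' (HF p c) n 0) (expR (s' ^+ 2 * V) *
   (expR (3 / 2 * (s' * kap) + 2 * (s' * kap) ^+ 2 / NR) *
    (4 * expR (s' * eta + 2 * s' ^+ 2 / NR)))).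
  apply: (asle_evb (expR_ge0 _) (G := Emax s' (H p c ++ scl kap (lin c)))).
    apply: Emax_compare => // [i|i|].
    - by rewrite covHF1 VE (le_trans vN)// lerDl.
    - rewrite cov_cat cov_scale cov_lin// (ov_self N_gt0 (sc i)) mul1r VE lerD2r.
      apply: le_trans vN; rewrite -(covHF1 i).
      by apply: (@cov_Hg_le R p N K (fun k => @mono R p N (c k)) i) => ?; exact: mono_sym.
    - by apply: incr_HF_H => //; exact: leq_trans p_ge4.
  apply: (evb_le (expR_ge0 _) (G := fun n => Emax s' (H p c) n 0)); last exact: Heta.
  move=> n; rewrite Emax_cat -gE_mull; apply: gE_le => y.
  exact: (Emax_lin N_gt0 n _ sc (ltW s'0) kap0).
have b2 : evb (fun n => Emax s (HF p c ++ scl th (lin c)) n 0)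
   (4 * expR (64 * (s ^+ 2 * (th ^+ 2 / NR))) * (expR (s' ^+ 2 * V) *
   (expR (3 / 2 * (s' * kap) + 2 * (s' * kap) ^+ 2 / NR) *
    (4 * expR (s' * eta + 2 * s' ^+ 2 / NR))))).
  have c0 : 0 <= 4 * expR (64 * (s ^+ 2 * (th ^+ 2 / NR))) by rewrite mulr_ge0// expR_ge0.
  apply: (asle_evb c0 (asle_cat (HF p c) (linear_le_tensor N_gt0 p_ge4 p_even sc s0 th0))).
  set a2 := Num.sqrt (20 / vp) * th.
  have a22 : a2 ^+ 2 = 20 / vp * th ^+ 2.
    by rewrite exprMn sqr_sqrtr// divr_ge0// ltW.
  (* Independent copies of one field add in variance: the linear field has become a rescaling of the
     tensor field by r = sqrt(1 + 20 th^2 / vp). This is why its cost is quadratic in [th]. *)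
  have same : asle (Emax s (HF p c ++ scl a2 (HF p c))) (fun n x => 1 * Emax s (scl r (HF p c)) n x).
    have := @Emax_same R K s (HF p c ++ scl a2 (HF p c)) (scl r (HF p c)) s0.
    rewrite /asle => h eps e0; have [|n0 hn] := h _ _ e0.
      by move=> i j; rewrite cov_cat !cov_scale a22 r2; ring.
    by exists n0 => n nn x; rewrite mul1r; exact: hn.
  have b1' : evb (fun n => Emax s (scl r (HF p c)) n 0) (expR (s' ^+ 2 * V) *
   (expR (3 / 2 * (s' * kap) + 2 * (s' * kap) ^+ 2 / NR) *
    (4 * expR (s' * eta + 2 * s' ^+ 2 / NR)))).
    move=> eps e0; have [l0 hl] := b1 _ e0; exists l0 => l ll.
    by have := hl l ll; rewrite /s' (Emax_scale s r) scaler0.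
  by have := asle_evb ler01 same b1'; rewrite mul1r.
suff <- : 4 * expR (64 * (s ^+ 2 * (th ^+ 2 / NR))) * (expR (s' ^+ 2 * V) *
   (expR (3 / 2 * (s' * kap) + 2 * (s' * kap) ^+ 2 / NR) *
    (4 * expR (s' * eta + 2 * s' ^+ 2 / NR)))) = 16 * expR (64 * (s ^+ 2 * (th ^+ 2 / NR)) +
     3 * s' ^+ 2 * (1 + kap ^+ 2) / NR + 3 / 2 * (s' * kap) + s' * eta) by exact: b2.
have -> : 64 * (s ^+ 2 * (th ^+ 2 / NR)) + 3 * s' ^+ 2 * (1 + kap ^+ 2) / NR +
    3 / 2 * (s' * kap) + s' * eta = 64 * (s ^+ 2 * (th ^+ 2 / NR)) + (s' ^+ 2 * V +
    (3 / 2 * (s' * kap) + 2 * (s' * kap) ^+ 2 / NR + (s' * eta + 2 * s' ^+ 2 / NR))).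
  by rewrite /V; field; rewrite gt_eqF.
by rewrite !expRD; ring.
Qed.

End Bound.

(** * Rademacher steps and convexity *)
Section Convexity.
Context {R : realType}.

Section Space.
Context {V : lmodType R}.
Implicit Types (F : V -> R) (us : seq V).

Definition cvx F := forall (t : R) x y, 0 <= t <= 1 ->
  F (t *: x + (1 - t) *: y) <= t * F x + (1 - t) * F y.

Lemma cvx_gE n us F : cvx F -> cvx (fun x => gE n us (fun y => F (x + y))).
Proof.
move=> cF t x y t01; rewrite -gE_lin; apply: gE_le => z.
have -> : t *: x + (1 - t) *: y + z = t *: (x + z) + (1 - t) *: (y + z).
  by rewrite !scalerDr addrACA -scalerDl addrC [t + _]addrC subrK scale1r addrC.
exact: cF.
Qed.

(* [h t >= h 0 + (h 1 - h 0) (t - 1)] for the even convex function [h t = halfstep (t u) F x]. *)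
Lemma halfstep_line F u x (t : R) : cvx F ->
  F x + (halfstep u F x - F x) * (`|t| - 1) <= halfstep (t *: u) F x.
Proof.
move=> cF; have low v : F x <= halfstep v F x.
  have h2 : is_true ((0 <= 2^-1 :> R) && (2^-1 <= 1 :> R)) by rewrite invr_ge0 ler0n invf_le1 ?ler1n.
  have := cF 2^-1 (x + v) (x - v) h2.
  have -> : 1 - 2^-1 = 2^-1 :> R by field.
  have -> : 2^-1 *: (x + v) + 2^-1 *: (x - v) = x.
    rewrite -scalerDr addrACA subrr addr0 -[x in x + _]scale1r -[x in _ + x]scale1r.
    by rewrite -scalerDl scalerA mulVf ?scale1r// pnatr_eq0.
  by rewrite /halfstep; lra.
wlog t0 : t u / 0 <= t.
  move=> W; have [t0|t0] := leP 0 t; first exact: W.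
  have := W (- t) u; rewrite oppr_ge0 normrN scaleNr => /(_ (ltW t0)).
  by rewrite /halfstep opprK [F (x - _) + _]addrC.
rewrite ger0_norm//; have h1 := low u; have ht := low (t *: u).
have [t1|t1] := leP t 1.
  have : (halfstep u F x - F x) * (t - 1) <= 0 by rewrite mulr_ge0_le0//; lra.
  by lra.
have ti : 0 <= t^-1 <= 1 by rewrite invr_ge0 t0 invf_le1 ?(lt_trans ltr01)// ltW.
have e1 v : t^-1 *: (x + t *: v) + (1 - t^-1) *: x = x + v.
  rewrite scalerDr scalerA mulVf ?gt_eqF ?(lt_trans ltr01)// scale1r.
  by rewrite addrAC -scalerDl addrC [t^-1 + _]addrC subrK scale1r addrC.
have := cF t^-1 (x + t *: u) x ti; have := cF t^-1 (x + t *: (- u)) x ti.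
rewrite !e1 scalerN => k1 k2.
have tp : 0 < t by exact: lt_trans ltr01 t1.
have : t * halfstep u F x <= halfstep (t *: u) F x + (t - 1) * F x.
  have e2 : t * (t^-1 * halfstep (t *: u) F x + (1 - t^-1) * F x) =
      halfstep (t *: u) F x + (t - 1) * F x by field; rewrite gt_eqF.
  by rewrite -e2 ler_pM2l// /halfstep; lra.
lra.
Qed.

End Space.

Lemma iter_half_sqr k (dl x : R) :
  iter k (step [:: dl : R^o]) (fun w => w ^+ 2) x = x ^+ 2 + k%:R * dl ^+ 2.
Proof.
elim: k x => [|k IH] x; first by rewrite mul0r addr0.
by rewrite iterS /= /halfstep !IH -natr1; field.
Qed.

Lemma iter_half_quart k (dl x : R) :
  iter k (step [:: dl : R^o]) (fun w => w ^+ 4) x =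
    x ^+ 4 + 6 * k%:R * dl ^+ 2 * x ^+ 2 + (3 * k%:R ^+ 2 - 2 * k%:R) * dl ^+ 4.
Proof.
elim: k x => [|k IH] x; first by rewrite /=; ring.
by rewrite iterS /= /halfstep !IH -natr1; field.
Qed.

Lemma abs_quartic (w : R) : w ^+ 2 - w ^+ 4 / 4 <= `|w|.
Proof.
rewrite -(real_normK (num_real w)) -[w ^+ 4]ger0_norm ?exprn_even_ge0// normrX.
set y := `|w|; have y0 : 0 <= y by exact: normr_ge0.
have h2 : 0 <= y * (y ^+ 3 - 4 * y + 4).
  rewrite mulr_ge0//; have := sqr_ge0 (y - 5 / 4); have := mulr_ge0 y0 (sqr_ge0 (y - 1)).
  by rewrite !exprS !expr0; lra.
by move: h2; rewrite !exprS !expr0; lra.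
Qed.

(** Random gauge signs are Rademacher variables and must become a walk direction. For a normalized
    walk w one has E w^2 = 1 and E w^4 = 3 - 2/n, so [abs_quartic] gives E|8 w| >= 2, which is what
    [halfstep_line] needs; hence the factor 8. *)
Lemma rad_le_walk1 {V : lmodType R} n (u : V) F x : (0 < n)%N -> cvx F ->
  halfstep u F x <= gE n [:: 8 *: u] (fun y => F (x + y)).
Proof.
move=> n0 cF; pose L (w : R^o) : V := w *: (8 *: u).
have LD w w' : L (w + w') = L w + L w' by rewrite /L scalerDl.
have LZ (a : R) w : L (a *: w) = a *: L w by exact: (esym (scalerA a w (8 *: u))).
have -> : [:: 8 *: u] = [seq L w | w <- [:: 1 : R^o]].
  by congr (_ :: _); apply/esym; exact: (scale1r (8 *: u)).
rewrite -(gE_map n _ (fun y => F (x + y)) LD LZ).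
have sym : gE n [:: 1 : R^o] ((fun y => F (x + y)) \o L) =
    gE n [:: 1 : R^o] (fun w => halfstep (L w) F x).
  have neg : gE n [:: 1 : R^o] (fun w => F (x - L w)) = gE n [:: 1 : R^o] (fun w => F (x + L w)).
    have := gE_map n [:: 1 : R^o] (fun w : R^o => F (x + L w)) (L := fun w : R^o => - w : R^o)
       (fun a b => opprD a b) (fun a b => esym (scalerN a b)).
    have -> : (fun w : R^o => F (x + L w)) \o (fun w : R^o => - w : R^o) = (fun w => F (x - L w)).
      by apply/funext => w /=; rewrite /L scaleNr.
    move=> ->; rewrite /gE /=; set e := _ *: (- 1); set e' := _ *: 1.
    have -> : step [:: e] = step [:: e'] => //.
    apply/funext => G; apply/funext => w; rewrite /step /= /halfstep /e /e' scalerN opprK.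
    by rewrite [G (w - _) + _]addrC.
  have -> : (fun w => halfstep (L w) F x) = (fun w => 2^-1 * F (x + L w) + 2^-1 * F (x - L w)).
    by apply/funext => w; rewrite /halfstep; field.
  by rewrite gE_lin neg /comp; field.
rewrite sym; set d := halfstep u F x - F x.
have d0 : 0 <= d.
  by have := halfstep_line u x 0 cF; rewrite scale0r normr0 /halfstep subr0 addr0 -/d; lra.
apply: (@le_trans _ _ (gE n [:: 1 : R^o] (fun w => (F x - d) + (8 * d) * (w ^+ 2 - w ^+ 4 / 4)))).
  rewrite gE_add gE_cst gE_mull.
  have -> : gE n [:: 1 : R^o] (fun w : R^o => w ^+ 2 - w ^+ 4 / 4 : R) =
      gE n [:: 1 : R^o] (fun w => 1 * (w : R) ^+ 2 + (- 4^-1) * (w : R) ^+ 4).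
    by congr gE; apply/funext => w; field.
  rewrite gE_lin /gE /= iter_half_sqr iter_half_quart.
  set dl := _ *: (1 : R^o); have dlE : dl ^+ 2 = n%:R^-1.
    rewrite /dl /GRing.scale /= mulr1 exprVn sqr_sqrtr ?ler0n//.
  have nR : 0 < n%:R :> R by rewrite ltr0n.
  have -> : dl ^+ 4 = n%:R^-1 ^+ 2 by rewrite -dlE -exprM.
  rewrite dlE expr0n/= expr0n/= mulr0 !add0r divff ?gt_eqF//.
  have -> : (3 * n%:R ^+ 2 - 2 * n%:R) * n%:R^-1 ^+ 2 = 3 - 2 / n%:R :> R.
    by field; rewrite gt_eqF.
  have ni : 0 <= n%:R^-1 :> R by rewrite invr_ge0 ltW.
  have := mulr_ge0 d0 ni; rewrite /d; set i := n%:R^-1; move: (halfstep u F x) (F x) => a b; lra.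
apply: gE_le => w; have h := halfstep_line u x (8 * w) cF.
rewrite /L scalerA (mulrC w).
apply: le_trans h; rewrite -/d normrM ger0_norm//.
have := ler_wpM2l d0 (abs_quartic w); lra.
Qed.

Lemma rad_le_walk {V : lmodType R} n (us : seq V) F x : (0 < n)%N -> cvx F ->
  step us F x <= gE n [seq 8 *: u | u <- us] (fun y => F (x + y)).
Proof.
move=> n0 cF; elim: us x => [|u us IH] x; first by rewrite gE_nil addr0.
rewrite /= -cat1s gE_cat.
apply: (le_trans (halfstep_le u IH x)).
apply: (le_trans (rad_le_walk1 u x n0 (cvx_gE n _ cF))).
by apply: gE_le => y; apply: gE_le => z; rewrite addrA.
Qed.

Lemma step_lower (V : lmodType R) (T : eqType) (r : seq T) (u : T -> V) F x (Z : R) : uniq r ->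
  (forall xi : T -> bool, Z <= F (x + \sum_(k <- r) (-1) ^+ xi k *: u k)) ->
  Z <= step [seq u k | k <- r] F x.
Proof.
elim: r x => [|k r IH] x /=; first by move=> _ /(_ xpredT); rewrite big_nil addr0.
move=> /andP[kr ur] h; rewrite /halfstep.
have g (b : bool) : Z <= step [seq u k | k <- r] F (x + (-1) ^+ b *: u k).
  apply: IH => // xi; have := h (fun j => if j == k then b else xi j).
  rewrite big_cons eqxx addrA (eq_big_seq (fun j => (-1) ^+ xi j *: u j))//.
  by move=> j jr; case: eqP => // e; move: kr; rewrite -e jr.
have := g false; have := g true; rewrite expr0 expr1 scale1r scaleN1r.
move: (step _ _ _) (step _ _ _) => a b; lra.
Qed.

Lemma cvx_expmax (I : finType) (s : R) : cvx (expmax s : (I -> R) -> R).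
Proof.
move=> t x y /andP[t0 t1]; apply: expmax_le => [|i].
  by rewrite addr_ge0// mulr_ge0 ?expmax_ge0// subr_ge0.
apply: (@le_trans _ _ (t * expR (s * x i) + (1 - t) * expR (s * y i))); last first.
  by apply: lerD; apply: ler_wpM2l; rewrite ?subr_ge0// expmax_ge.
rewrite vaddE !vscaleE; set c := s * _.
have tg a : expR c * (1 + (a - c)) <= expR a.
  have -> : expR a = expR c * expR (a - c) by rewrite -expRD addrC subrK.
  by rewrite ler_wpM2l ?expR_ge0// expR_ge1Dx.
have := ler_wpM2l t0 (tg (s * x i)); have := ler_wpM2l (_ : 0 <= 1 - t) (tg (s * y i)).
rewrite subr_ge0 => /(_ t1).
have e : t * (expR c * (1 + (s * x i - c))) + (1 - t) * (expR c * (1 + (s * y i - c))) = expR c.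
  by rewrite {2 4}/c; ring.
by move: e; move: (_ * (expR c * _)) (_ * (expR c * _)) => e1 e2; lra.
Qed.

Lemma pow_tangent (k : nat) (x y : R) : 0 <= x -> 0 <= y ->
  y ^+ k + k%:R * y ^+ k.-1 * (x - y) <= x ^+ k.
Proof.
move=> x0 y0; elim: k => [|k IH]; first by rewrite !expr0 !mul0r addr0.
have := ler_wpM2l x0 IH; rewrite -exprS => h; apply: le_trans h.
case: k {IH} => [|k]; first by rewrite /= !expr0 !expr1; lra.
rewrite /= -!natr1 !exprS; set Y := y ^+ k; have Y0 : 0 <= Y by rewrite exprn_ge0.
have k0 : 0 <= k%:R :> R by [].
have h1 : 0 <= (k%:R + 1) * (Y * (x - y) ^+ 2).
  by rewrite mulr_ge0// ?addr_ge0// mulr_ge0// sqr_ge0.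
rewrite -subr_ge0.
have -> : x * (y * Y + (k%:R + 1) * Y * (x - y)) - (y * (y * Y) + (k%:R + 1 + 1) * (y * Y) * (x - y))
  = (k%:R + 1) * (Y * (x - y) ^+ 2) by ring.
exact: h1.
Qed.

Definition clip (k x : R) : R := if x < - k then - k else if k < x then k else x.

Lemma clipN k x : 0 <= k -> clip k (- x) = - clip k x.
Proof. by move=> k0; rewrite /clip; do 4?case: ltP => ?; lra. Qed.

Lemma clip_norm k x : 0 <= k -> `|clip k x| <= k.
Proof. by move=> k0; rewrite /clip ler_norml; do 2?case: ltP => ?; lra. Qed.

Lemma clip_sqr k x : 0 <= k -> clip k x ^+ 2 <= x ^+ 2.
Proof. by move=> k0; rewrite /clip; do 2?case: ltP => ?; nra. Qed.

Lemma clip_lip k x y : 0 <= k -> (clip k x - clip k y) ^+ 2 <= (x - y) ^+ 2.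
Proof.
move=> k0; have main a b : a <= b -> 0 <= clip k b - clip k a <= b - a.
  by move=> ab; rewrite /clip; do 4?case: ltP => ?; lra.
wlog xy : x y / x <= y.
  move=> W; have [xy|/ltW yx] := leP x y; first exact: W.
  by rewrite -(sqrrN (clip k x - _)) -(sqrrN (x - _)) !opprB; exact: W.
rewrite -(sqrrN (clip k x - _)) -(sqrrN (x - _)) !opprB; have /andP[h1 h2] := main _ _ xy.
by rewrite lerXn2r// nnegrE (le_trans h1).
Qed.

Lemma clip_rem k x : 0 < k -> `|x - clip k x| * k ^+ 3 <= x ^+ 4.
Proof.
move=> k0; rewrite /clip; have x4 : 0 <= x ^+ 4 by exact: exprn_even_ge0.
have main y : k < y -> (y - k) * k ^+ 3 <= y ^+ 4.
  move=> ky; have y0 : 0 < y by exact: lt_trans ky.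
  rewrite (exprS y); apply: ler_pM.
  - by rewrite subr_ge0 ltW.
  - by rewrite exprn_ge0// ltW.
  - by rewrite gerBl ltW.
  - by apply: lerXn2r; rewrite ?nnegrE ltW.
case: ltP => h.
  rewrite opprK ltr0_norm; last by lra.
  have -> : x ^+ 4 = (- x) ^+ 4 by ring.
  by rewrite opprD; apply: main; lra.
by case: ltP => h'; [rewrite gtr0_norm ?subr_gt0//; exact: main|rewrite subrr normr0 mul0r].
Qed.

(** The part of x cut off is at most x^4 / k^3, and Young's inequality with the other factor leaves
    x^8 and y^2. On points with bounded eighth moments the loss is thus O(k^-3) per coordinate on
    average. *)
Lemma clip_prod k x y : 0 < k ->
  x * y - clip k x * clip k y <= (x ^+ 8 + y ^+ 8 + x ^+ 2 + y ^+ 2) / (2 * k ^+ 3).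
Proof.
move=> k0; have k3 : 0 < k ^+ 3 by rewrite exprn_gt0.
have am a b c : `|a| * k ^+ 3 <= c ^+ 4 -> a * b * (2 * k ^+ 3) <= c ^+ 8 + b ^+ 2.
  move=> h; have h2 : (a * k ^+ 3) ^+ 2 <= c ^+ 8.
    rewrite -[c ^+ 8]/(c ^+ (4 * 2)) exprM -(real_normK (num_real (a * _))).
    by rewrite lerXn2r ?nnegrE ?exprn_even_ge0// normrM (gtr0_norm k3).
  by have := sqr_ge0 (a * k ^+ 3 - b); rewrite sqrrB; lra.
rewrite ler_pdivlMr ?mulr_gt0//.
have h1 := am _ y _ (clip_rem x k0); have h2 := am _ (clip k x) _ (clip_rem y k0).
have h3 := clip_sqr x (ltW k0).
have -> : (x * y - clip k x * clip k y) * (2 * k ^+ 3) =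
  (x - clip k x) * y * (2 * k ^+ 3) + (y - clip k y) * clip k x * (2 * k ^+ 3) by ring.
lra.
Qed.

End Convexity.

(** * Two replicas *)
Section Pair.
Context {R : realType}.
Variables (p N : nat) (D : domain).
Hypothesis N_gt0 : (0 < N)%N.
Hypothesis p_ge4 : (4 <= p)%N.
Hypothesis p_even : ~~ odd p.
Notation vp := (p`!%:R^-1 : R).
Notation NR := (N%:R : R).
Notation T := {ffun 'I_p -> 'I_N}.
Let NR0 : 0 < NR. Proof. by rewrite ltr0n. Qed.
Let vp0 : 0 < vp. Proof. exact: vp_gt0. Qed.

Let pN2 : (p%:R / Num.sqrt NR) ^+ 2 = p%:R ^+ 2 / NR.
Proof. by rewrite expr_div_n sqr_sqrtr// ltW. Qed.

Lemma fin_eventually (X : finType) (Q : X -> nat -> Prop) :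
  (forall t, exists n0, forall n, (n0 <= n)%N -> Q t n) ->
  exists n0, forall n, (n0 <= n)%N -> forall t, Q t n.
Proof.
move=> /boolp.choice[f hf]; exists (\max_t f t) => n nn t; apply: hf.
exact: leq_trans (leq_bigmax t) nn.
Qed.

Lemma even_tangent (x y : R) : 0 <= y -> y ^+ p + p%:R * y ^+ p.-1 * (x - y) <= x ^+ p.
Proof.
move=> y0; rewrite -(even_pow_norm p_even x).
apply: le_trans (pow_tangent p (normr_ge0 x) y0); rewrite lerD2l ler_wpM2l//.
  by rewrite mulr_ge0// exprn_ge0.
by rewrite lerD2r ler_norm.
Qed.

(** Tangents at [r] and at [r'], evaluated at the midpoint, leave the difference of the two slopes,
    which is of order r - r': the convexity defect is of second order. *)
Lemma power_mid (r r' : R) : 0 <= r <= 1 -> 0 <= r' <= 1 ->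
  r ^+ p + r' ^+ p - 2 * ((r + r') / 2) ^+ p <= p%:R ^+ 2 / 2 * (r - r') ^+ 2.
Proof.
wlog rr : r r' / r' <= r.
  move=> W h h'; have [k|/ltW k] := leP r' r; first exact: W.
  by rewrite (addrC (r ^+ p)) (addrC r) -(sqrrN (r - r')) opprB; exact: W.
move=> /andP[r0 r1] /andP[r0' r1']; set m := (r + r') / 2.
have m0 : 0 <= m by rewrite divr_ge0// addr_ge0.
have h1 := pow_tangent p m0 r0; have h2 := pow_tangent p m0 r0'.
have h3 := pow_tangent p.-1 r0' r0.
have p1 : p.-1%:R <= p%:R :> R by rewrite ler_nat leq_pred.
have k0 : 0 <= p.-1%:R :> R by [].
have pp : 0 <= p%:R :> R by [].
have x1 : r ^+ p.-1.-1 <= 1 by rewrite exprn_ile1.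
have x0 : 0 <= r ^+ p.-1.-1 by rewrite exprn_ge0.
have d0 : 0 <= r - r' by lra.
have h4 : r ^+ p.-1 - r' ^+ p.-1 <= p%:R * (r - r').
  apply: (@le_trans _ _ (p.-1%:R * r ^+ p.-1.-1 * (r - r'))); first by lra.
  by rewrite ler_wpM2r// (le_trans _ p1)// ler_piMr.
have h5 : p%:R * ((r - r') / 2) * (r ^+ p.-1 - r' ^+ p.-1) <=
    p%:R * ((r - r') / 2) * (p%:R * (r - r')).
  by rewrite ler_wpM2l// mulr_ge0// divr_ge0.
have e1 : m - r = - ((r - r') / 2) by rewrite /m; field.
have e2 : m - r' = (r - r') / 2 by rewrite /m; field.
rewrite e1 in h1; rewrite e2 in h2.
have -> : p%:R ^+ 2 / 2 * (r - r') ^+ 2 = p%:R * ((r - r') / 2) * (p%:R * (r - r')) by field.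
move: h1 h2 h5; move: (r ^+ p) (r' ^+ p) (m ^+ p) (r ^+ p.-1) (r' ^+ p.-1) => *; lra.
Qed.

Section Family.
Context {I : finType}.
Variables a b : I -> 'I_N -> R.
Hypotheses (sa : sph a) (sb : sph b).

Definition pairF : seq (I -> R) := HFg (fun i (f : T) => mono (a i) f + mono (b i) f).

Lemma cov_pairF i j : cov pairF i j = vp / NR * (ov (a i) (a j) ^+ p + ov (b i) (b j) ^+ p +
   ov (a i) (b j) ^+ p + ov (b i) (a j) ^+ p).
Proof.
rewrite cov_map coef_sqr big_enum/=.
rewrite (eq_bigr (fun f : T => mono (a i) f * mono (a j) f + mono (b i) f * mono (b j) f +
   mono (a i) f * mono (b j) f + mono (b i) f * mono (a j) f)); last by move=> f _; ring.
rewrite !big_split/= !sum_mono /ov !exprMn exprS exprVn invfM.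
by ring.
Qed.

(** Concatenation means independence: a tensor field of its own for each replica, and a linear field
    of strength [e1] on each. *)
Definition decF (e1 : R) : seq (I -> R) :=
  (HF p a ++ HF p b) ++ (scl e1 (lin a) ++ scl e1 (lin b)).

Variable q : R.
Hypotheses (q0 : 0 < q) (q1 : 2 * q <= 1).
Hypothesis ovq : forall i, q <= ov (a i) (b i) <= 2 * q.

Let e1 := Num.sqrt (vp * p%:R * (2 * q) ^+ p.-1).

Lemma e1_sqr : e1 ^+ 2 = vp * p%:R * (2 * q) ^+ p.-1.
Proof. by rewrite sqr_sqrtr// mulr_ge0 ?exprn_ge0// mulr_ge0// ltW. Qed.

Lemma e1_le : e1 ^+ 2 <= p%:R.
Proof.
have q20 : 0 <= 2 * q by rewrite mulr_ge0// ltW.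
rewrite e1_sqr -mulrA mulrCA; apply: ler_piMr => //; apply: mulr_ile1.
- exact: ltW vp0.
- by rewrite exprn_ge0.
- exact: vp_le1.
- by rewrite exprn_ile1.
Qed.

(** The cross terms r^p + r'^p - R12^p - R21^p are linearized at the midpoint of r and r'. The slope
    meets r + r' - R12 - R21, which is at most 2 - R11 - R22 since a difference of displacements has
    nonnegative norm; that is a linear-field increment. The error of order (r - r')^2 is paid by the
    single direction with entries proportional to the overlap. *)
Lemma pair_incr :
  incr_le pairF (decF e1 ++ [:: fun i => p%:R / Num.sqrt NR * ov (a i) (b i)]).
Proof.
move=> i j; rewrite -/(dist2 pairF i j) -/(dist2 (_ ++ _) i j) !dist2_cat !dist2_scl.
rewrite (@dist2_HF R p N N_gt0 I a i j sa) (@dist2_HF R p N N_gt0 I b i j sb).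
rewrite (dist2_lin N_gt0 i j sa) (dist2_lin N_gt0 i j sb) [X in _ <= _ + X]dist2E big_seq1.
rewrite /dist2 !cov_pairF !(ov_self N_gt0 (sa _)) !(ov_self N_gt0 (sb _)) !expr1n.
rewrite -mulrBr (exprMn _ (p%:R / Num.sqrt NR)) pN2.
rewrite (ovC (b i) (a i)) (ovC (b j) (a j)) (ovC (b i) (a j)).
have /andP[ri1 ri2] := ovq i; have /andP[rj1 rj2] := ovq j.
move: ri1 ri2 rj1 rj2; set r := ov (a i) (b i); set r' := ov (a j) (b j) => ri1 ri2 rj1 rj2.
set R11 := ov (a i) (a j); set R22 := ov (b i) (b j).
set R12 := ov (a i) (b j); set R21 := ov (a j) (b i).
have hX : r + r' - R12 - R21 <= 2 - R11 - R22.
  have h : 0 <= \sum_k ((a i k - a j k) - (b i k - b j k)) ^+ 2.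
    by apply: sumr_ge0 => k _; exact: sqr_ge0.
  have e : \sum_k ((a i k - a j k) - (b i k - b j k)) ^+ 2 =
    inner (a i - a j) (a i - a j) + inner (b i - b j) (b i - b j) -
    2 * (inner (a i) (b i) + inner (a j) (b j) - inner (a i) (b j) - inner (a j) (b i)).
    rewrite /inner -!big_split -!sumrB mulr_sumr -sumrB/=.
    by apply: eq_bigr => k _; rewrite !vaddE !voppE; ring.
  have ie (z z' : 'I_N -> R) : inner z z' = NR * ov z z'.
    by rewrite /ov mulrC divfK// gt_eqF.
  move: h; rewrite e !(ov_dist N_gt0 (sa _) (sa _)) !(ov_dist N_gt0 (sb _) (sb _)).
  rewrite !(ie (a _) (b _)) -/r -/r' -/R11 -/R22 -/R12 -/R21.
  have -> : NR * (2 - 2 * R11) + NR * (2 - 2 * R22) - 2 * (NR * r + NR * r' - NR * R12 - NR * R21) =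
    NR * (2 * (2 - R11 - R22 - (r + r' - R12 - R21))) by ring.
  by rewrite pmulr_rge0//; lra.
pose m := (r + r') / 2.
have m0 : 0 <= m by rewrite divr_ge0// addr_ge0//; lra.
have mq : m <= 2 * q by rewrite /m; lra.
have t1 := even_tangent R12 m0; have t2 := even_tangent R21 m0.
have hm : r ^+ p + r' ^+ p - 2 * m ^+ p <= p%:R ^+ 2 / 2 * (r - r') ^+ 2.
  apply: power_mid; apply/andP; split.
  - exact: le_trans (ltW q0) ri1.
  - exact: le_trans ri2 q1.
  - exact: le_trans (ltW q0) rj1.
  - exact: le_trans rj2 q1.
have Y0 : 0 <= 2 - R11 - R22.
  have := ov_le1 N_gt0 (sa i) (sa j); have := ov_le1 N_gt0 (sb i) (sb j).
  by rewrite -/R11 -/R22; lra.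
have pm0 : 0 <= p%:R * m ^+ p.-1 by rewrite mulr_ge0// exprn_ge0.
have hpm : p%:R * m ^+ p.-1 <= p%:R * (2 * q) ^+ p.-1.
  by rewrite ler_wpM2l// lerXn2r ?nnegrE//; lra.
have k1 := ler_wpM2l pm0 hX; have k2 := ler_wpM2r Y0 hpm.
pose B := p%:R ^+ 2 * (r - r') ^+ 2.
have B0 : 0 <= B by rewrite mulr_ge0 ?sqr_ge0// exprn_ge0.
pose G := r ^+ p + r' ^+ p - R12 ^+ p - R21 ^+ p.
have hG : G <= B / 2 + p%:R * (2 * q) ^+ p.-1 * (2 - R11 - R22).
  rewrite /G /B; have -> : p%:R ^+ 2 * (r - r') ^+ 2 / 2 = p%:R ^+ 2 / 2 * (r - r') ^+ 2 by field.
  have e : p%:R * m ^+ p.-1 * (R12 - m) + p%:R * m ^+ p.-1 * (R21 - m) =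
    - (p%:R * m ^+ p.-1 * (r + r' - R12 - R21)) by rewrite /m; field.
  move: t1 t2 hm e k1 k2; clear.
  move: (p%:R * m ^+ p.-1 * _) (p%:R * m ^+ p.-1 * (R21 - m)) (p%:R * m ^+ p.-1 * _) => u1 u2 u3.
  move: (p%:R * m ^+ p.-1 * _) (p%:R * (2 * q) ^+ p.-1 * _) (p%:R ^+ 2 / 2 * _) => u4 u5 u6.
  move: (R12 ^+ p) (R21 ^+ p) (r ^+ p) (r' ^+ p) (m ^+ p) => *; lra.
have hv : vp * G <= B / 2 + vp * p%:R * (2 * q) ^+ p.-1 * (2 - R11 - R22).
  apply: (le_trans (ler_wpM2l (ltW vp0) hG)); rewrite mulrDr -!(mulrA vp) lerD2r.
  by rewrite ler_piMl ?vp_le1// divr_ge0.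
rewrite e1_sqr; set E := vp * p%:R * _ in hv *.
have Ni : 0 <= NR^-1 by rewrite invr_ge0 ltW.
have := ler_wpM2l Ni hv; rewrite /G /B; clear -Ni.
move: (R11 ^+ p) (R22 ^+ p) (R12 ^+ p) (R21 ^+ p) (r ^+ p) (r' ^+ p) vp => *; lra.
Qed.

Lemma pair_decouple (s : R) : 0 < s ->
  asle (Emax s pairF) (fun n x => expR (s ^+ 2 * ((4 + 2 * p%:R + p%:R ^+ 2) / NR)) *
     (2 * expR (2 * (s * (p%:R / Num.sqrt NR)) ^+ 2)) * Emax s (decF e1) n x).
Proof.
move=> s0; have pp : 0 <= p%:R :> R by [].
have p2 : 0 <= p%:R ^+ 2 :> R by exact: sqr_ge0.
have Ni : 0 <= NR^-1 by rewrite invr_ge0 ltW.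
have rle i : 0 <= ov (a i) (b i) <= 1.
  have /andP[h1 h2] := ovq i; apply/andP; split.
    exact: le_trans (ltW q0) h1.
  exact: le_trans h2 q1.
apply: (asle_trans_cst (expR_ge0 _) (G := Emax s (decF e1 ++
   [:: fun i => p%:R / Num.sqrt NR * ov (a i) (b i)]))).
  have V0 : 0 <= (4 + 2 * p%:R + p%:R ^+ 2) / NR.
    by rewrite divr_ge0 ?(ltW NR0)// !addr_ge0// mulr_ge0.
  apply: (Emax_compare s0 V0).
  - move=> i; rewrite cov_pairF (ovC (b i) (a i)) !(ov_self N_gt0 (sa _)) !(ov_self N_gt0 (sb _)) !expr1n.
    rewrite mulrAC; apply: ler_wpM2r => //.
    have /andP[r0 r1] := rle i.
    have o1 : ov (a i) (b i) ^+ p <= 1 by rewrite exprn_ile1.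
    have o0 : 0 <= ov (a i) (b i) ^+ p by rewrite exprn_ge0.
    apply: (@le_trans _ _ (1 * 4)); last by lra.
    by apply: ler_pM; rewrite ?vp_le1 ?(ltW vp0)//; lra.
  - move=> i; rewrite !cov_cat !cov_scale !cov_HF// !cov_lin//.
    rewrite !(ov_self N_gt0 (sa _)) !(ov_self N_gt0 (sb _)) expr1n [cov [:: _] i i]big_seq1.
    rewrite -expr2 (exprMn _ (p%:R / Num.sqrt NR)) pN2.
    have /andP[r0 r1] := rle i.
    have o1 : ov (a i) (b i) ^+ 2 <= 1 by rewrite exprn_ile1.
    have h1 := ler_wpM2r Ni (vp_le1 (R := R) p); have h2 := ler_wpM2r Ni e1_le.
    have p2N : 0 <= p%:R ^+ 2 / NR by rewrite mulr_ge0.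
    have h3 := ler_wpM2l p2N o1.
    move: h1 h2 h3 Ni; move: (ov _ _ ^+ 2) (vp) (e1 ^+ 2) (p%:R ^+ 2 : R) (p%:R : R) NR^-1 => *; lra.
  exact: pair_incr.
apply: asle_le => [n x|n x]; first exact: Emax_ge0.
rewrite Emax_cat -gE_mull; apply: gE_le => y; apply: Emax_single; first exact: ltW.
move=> i; have /andP[r0 r1] := rle i.
have c0 : 0 <= p%:R / Num.sqrt NR by rewrite divr_ge0// sqrtr_ge0.
by rewrite normrM (ger0_norm c0) (ger0_norm r0) ler_piMr.
Qed.

End Family.

Lemma Emax_shift (K : finType) (s c : R) (us : seq (K -> R)) n x : 0 <= s ->
  (forall k, c <= x k) -> Emax s us n 0 <= expR (- (s * c)) * Emax s us n x.
Proof.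
move=> s0 h; rewrite /Emax -gE_mull; apply: gE_le => y; apply: expmax_le => [|k].
  by rewrite mulr_ge0 ?expR_ge0 ?expmax_ge0.
apply: (le_trans _ (ler_wpM2l (expR_ge0 _) (expmax_ge s (x + y) k))).
rewrite -expRD ler_expR !vaddE add0r mulrDr.
by have := ler_wpM2l s0 (h k); lra.
Qed.

(** A gauge transformation: flipping coordinates preserves inner products within one replica, but
    not its overlap with an ungauged one. *)
Definition gz (xi : {ffun 'I_N -> bool}) (z : 'I_N -> R) : 'I_N -> R := fun k => (-1) ^+ xi k * z k.

Lemma inner_gz xi z z' : inner (gz xi z) (gz xi z') = inner z z'.
Proof.
apply: eq_bigr => k _; rewrite /gz mulrACA -expr2 sqrr_sign.
by rewrite mul1r.
Qed.

Lemma Theta_gz xi z : Theta R D N z -> Theta R D N (gz xi z).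
Proof.
case: D => /= h; last by rewrite inner_gz.
move=> i; rewrite /gz; case: (xi i); rewrite ?expr0 ?expr1 ?mul1r//.
by case: (h i) => ->; rewrite mulN1r ?opprK; [right|left].
Qed.

Definition replica_cst (s eta dl th : R) : R :=
  let kap := p%:R ^+ 2 * Num.sqrt dl in
  let s' := s * Num.sqrt (1 + 20 / vp * th ^+ 2) in
  16 * expR (64 * (s ^+ 2 * (th ^+ 2 / NR)) + 3 * s' ^+ 2 * (1 + kap ^+ 2) / NR +
       3 / 2 * (s' * kap) + s' * eta).

(** After decoupling, gauging the second replica alone changes no covariance. Signing the penalty by
    the same [xi] leaves its value on the original pairs unchanged, while over the enlarged index
    set and random [xi] it is a centered field that can be compared with linear fields. *)
Theorem pair_bound (I : finType) (a b : I -> 'I_N -> R) (eta dl q K0 lam s : R) :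
  max_bound p N D eta -> (forall i, Theta R D N (a i)) -> (forall i, Theta R D N (b i)) ->
  0 <= dl <= 1 -> (forall i k, a i k ^+ 2 <= dl * NR) -> (forall i k, b i k ^+ 2 <= dl * NR) ->
  0 < q -> 2 * q <= 1 -> (forall i, q <= ov (a i) (b i) <= 2 * q) ->
  0 < K0 -> 0 <= lam -> 0 < s ->
  (forall i, q / 2 <= NR^-1 * \sum_k clip K0 (a i k) * clip K0 (b i k)) ->
  let th := Num.sqrt (vp * p%:R * (2 * q) ^+ p.-1 + 128 * lam ^+ 2 * K0 ^+ 2) in
  evb (fun n => Emax s (pairF a b) n 0)
    (2 * expR (s ^+ 2 / NR * (4 + 2 * p%:R + 3 * p%:R ^+ 2 + 256 * lam ^+ 2 * K0 ^+ 2)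
       - s * (lam * (q / 2))) * (replica_cst s eta dl th * replica_cst s eta dl th)).
Proof.
move=> Heta aT bT dl01 ad bd q0 q1 ovq K00 lam0 s0 hm th.
have sa : sph a by move=> i; exact: Theta_inner (aT i).
have sb : sph b by move=> i; exact: Theta_inner (bT i).
pose e1 := Num.sqrt (vp * p%:R * (2 * q) ^+ p.-1).
(* The gauged second replicas form an index type independent of the first, so that [Emax_prod] can
   factorize the bound; the original pairs sit on a diagonal of [Q]. *)
pose Xi := {ffun 'I_N -> bool}; pose Q := (I * (I * Xi))%type.
pose bt (jx : I * Xi) := gz jx.2 (b jx.1).
pose aQ (t : Q) := a t.1; pose bQ (t : Q) := bt t.2.
have saQ : sph aQ by move=> t; exact: sa.
have sbt : sph bt by move=> t; rewrite /bt inner_gz; exact: sb.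
have sbQ : sph bQ by move=> t; exact: sbt.
(* 128 = 64 * 2: the factor 8 of [rad_le_walk] enters the variance as 64, and 2 K0^2 bounds the
   squared change of the clipped products in terms of that of the two replicas. *)
pose mu := Num.sqrt (128 * lam ^+ 2 * K0 ^+ 2).
have M0 : 0 <= 128 * lam ^+ 2 * K0 ^+ 2.
  by apply: mulr_ge0; [apply: mulr_ge0 => //; exact: sqr_ge0|exact: sqr_ge0].
have mu2 : mu ^+ 2 = 128 * lam ^+ 2 * K0 ^+ 2 by rewrite sqr_sqrtr.
have th0 : 0 <= th by exact: sqrtr_ge0.
have th2 : th ^+ 2 = e1 ^+ 2 + mu ^+ 2.
  rewrite mu2 (e1_sqr q0) sqr_sqrtr//; apply: addr_ge0 => //; apply: mulr_ge0.
    by apply: mulr_ge0 => //; exact: ltW vp0.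
  by apply: exprn_ge0; apply: mulr_ge0 => //; exact: ltW.
pose uk (k : 'I_N) : Q -> R := fun t => lam / NR * (clip K0 (aQ t k) * clip K0 (bQ t k)).
pose us := [seq uk k | k <- enum 'I_N].
have S4 eps : 0 < eps -> exists n0, forall n, (n0 <= n)%N ->
    Emax s (decF a b e1) n 0 <= expR eps * (expR (- (s * (lam * (q / 2)))) *
       Emax s (decF aQ bQ e1 ++ scl 8 us) n 0).
  move=> e0; have [n0 hn0] : exists n0, forall n, (n0 <= n)%N -> forall xi : Xi, forall x,
     Emax s (decF a b e1) n x <= expR eps * Emax s (decF a (fun i => gz xi (b i)) e1) n x.
    apply: (@fin_eventually Xi (fun xi n => forall x, Emax s (decF a b e1) n x <=
      expR eps * Emax s (decF a (fun i => gz xi (b i)) e1) n x)) => xi.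
    apply: (@Emax_same R I s (decF a b e1) (decF a (fun i => gz xi (b i)) e1) s0 _ eps e0).
    by move=> i j; rewrite !cov_cat !cov_scale !cov_HF// !cov_lin// /ov !inner_gz.
  exists n0.+1 => n nn; have n_gt0 : (0 < n)%N by exact: leq_trans nn.
  rewrite Emax_catC Emax_cat mulrA -ler_pdivrMl; last by rewrite mulr_gt0// expR_gt0.
  have cE : cvx (Emax s (decF aQ bQ e1) n) by apply: cvx_gE; exact: cvx_expmax.
  apply: le_trans (rad_le_walk us 0 n_gt0 cE).
  apply: step_lower => [|xi]; first exact: enum_uniq.
  rewrite ler_pdivrMl; last by rewrite mulr_gt0// expR_gt0.
  pose xf : Xi := [ffun k => xi k].
  rewrite add0r; set x2 := \sum_(k <- _) _.
  (* Gauged by the very signs of the field, a pair sees the signs cancel: the field becomes [lam]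
     times the clipped overlap, hence at least lam q / 2. This holds for every sign pattern, as
     [step_lower] requires. *)
  pose phi (i : I) : Q := (i, (i, xf)).
  have x2E i : lam * (q / 2) <= x2 (phi i).
    rewrite /x2 fct_sumE big_enum/=.
    rewrite (eq_bigr (fun k => lam * (NR^-1 * (clip K0 (a i k) * clip K0 (b i k))))).
      by rewrite -!mulr_sumr; apply: ler_wpM2l => //; exact: hm.
    move=> k _; rewrite vscaleE /uk /aQ /bQ /bt /gz /= ffunE.
    case: (xi k); rewrite ?expr0 ?expr1 ?mul1r; last by ring.
    by rewrite mulN1r (clipN _ (ltW K00)); ring.
  apply: (le_trans (Emax_shift _ n (ltW s0) x2E)).
  rewrite (mulrC (expR eps)) -(mulrA (expR (- _))); apply: ler_wpM2l; first exact: expR_ge0.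
  apply: (le_trans (hn0 n (ltnW nn) xf _)); apply: ler_wpM2l; first exact: expR_ge0.
  apply: le_trans (Emax_sub phi s (decF aQ bQ e1) n x2).
  have -> : [seq (u \o phi : I -> R) | u <- decF aQ bQ e1] = decF a (fun i => gz xf (b i)) e1.
    by rewrite /decF !map_cat /scl /HF /HFg /lin -!map_comp.
  exact: lexx.
have S5 : asle (Emax s (scl 8 us)) (fun n x => expR (s ^+ 2 * (256 * lam ^+ 2 * K0 ^+ 2 / NR)) *
    Emax s (scl mu (lin aQ) ++ scl mu (lin bQ)) n x).
  have Ni : 0 <= NR^-1 by rewrite invr_ge0 ltW.
  have L0 : 0 <= lam ^+ 2 by exact: sqr_ge0.
  have K2 : 0 <= K0 ^+ 2 by exact: sqr_ge0.
  have ck z : clip K0 z ^+ 2 <= K0 ^+ 2.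
    have := clip_norm z (ltW K00) => h; rewrite -(real_normK (num_real (clip K0 z))).
    by rewrite lerXn2r ?nnegrE// ltW.
  have covE t t' : cov (scl 8 us) t t' = 64 * (lam / NR) ^+ 2 *
      \sum_k (clip K0 (aQ t k) * clip K0 (bQ t k)) * (clip K0 (aQ t' k) * clip K0 (bQ t' k)).
    by rewrite cov_scale /us cov_map big_enum/=; ring.
  have dE t t' : dist2 (scl 8 us) t t' = 64 * (lam / NR) ^+ 2 *
      \sum_k (clip K0 (aQ t k) * clip K0 (bQ t k) - clip K0 (aQ t' k) * clip K0 (bQ t' k)) ^+ 2.
    rewrite dist2_scl dist2E /us big_map big_enum/= !mulr_sumr; apply: eq_bigr => k _.
    by rewrite /uk; ring.
  have Lc : 0 <= 64 * (lam / NR) ^+ 2 by rewrite mulr_ge0// sqr_ge0.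
  have V0 : 0 <= 256 * lam ^+ 2 * K0 ^+ 2 / NR.
    apply: (mulr_ge0 _ Ni); apply: (mulr_ge0 _ K2); apply: (mulr_ge0 _ L0).
    exact: ler0n.
  apply: (Emax_compare s0 V0).
  - move=> t; rewrite covE.
    have h : \sum_k (clip K0 (aQ t k) * clip K0 (bQ t k)) * (clip K0 (aQ t k) * clip K0 (bQ t k))
        <= K0 ^+ 2 * NR.
      rewrite -(sbQ t) /inner mulr_sumr; apply: ler_sum => k _.
      rewrite -!expr2 exprMn; apply: ler_pM; rewrite ?sqr_ge0//; exact: clip_sqr (ltW K00).
    apply: (le_trans (ler_wpM2l Lc h)).
    have -> : 64 * (lam / NR) ^+ 2 * (K0 ^+ 2 * NR) = 64 * lam ^+ 2 * K0 ^+ 2 / NR.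
      by field; rewrite gt_eqF.
    by rewrite ler_wpM2r// ler_wpM2r// ler_wpM2r// ler_nat.
  - move=> t; rewrite cov_cat !cov_scale !cov_lin// (ov_self N_gt0 (saQ t)) (ov_self N_gt0 (sbQ t)).
    by rewrite mu2 le_eqVlt; apply/orP; left; apply/eqP; ring.
  move=> t t'; rewrite -/(dist2 (scl 8 us) t t') -/(dist2 (_ ++ _) t t') dist2_cat dE !dist2_scl.
  rewrite (dist2_lin N_gt0 t t' saQ) (dist2_lin N_gt0 t t' sbQ) mu2.
  have h : \sum_k (clip K0 (aQ t k) * clip K0 (bQ t k) - clip K0 (aQ t' k) * clip K0 (bQ t' k)) ^+ 2
     <= 2 * K0 ^+ 2 * (inner (aQ t - aQ t') (aQ t - aQ t') + inner (bQ t - bQ t') (bQ t - bQ t')).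
    rewrite /inner -big_split mulr_sumr; apply: ler_sum => k _ /=; rewrite !vaddE !voppE.
    have := clip_lip (aQ t k) (aQ t' k) (ltW K00); have := clip_lip (bQ t k) (bQ t' k) (ltW K00).
    have := ck (bQ t k); have := ck (aQ t' k); rewrite -!expr2.
    move: (clip _ (aQ t k)) (clip _ (aQ t' k)) (clip _ (bQ t k)) (clip _ (bQ t' k)) => u u' v v'.
    move: ((aQ t k - aQ t' k) ^+ 2) ((bQ t k - bQ t' k) ^+ 2) => x y hu hv hy hx.
    have g1 := ler_pM (sqr_ge0 _) (sqr_ge0 _) hx hv.
    have g2 := ler_pM (sqr_ge0 _) (sqr_ge0 _) hy hu.
    have g3 := sqr_ge0 ((u - u') * v - u' * (v - v')).
    have -> : u * v - u' * v' = (u - u') * v + u' * (v - v') by ring.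
    by move: g1 g2 g3; rewrite -!exprMn; set A := (u - u') * v; set B := u' * (v - v');
       rewrite (mulrC (v - v') u') -/B; nra.
  apply: (le_trans (ler_wpM2l Lc h)).
  rewrite (ov_dist N_gt0 (saQ t) (saQ t')) (ov_dist N_gt0 (sbQ t) (sbQ t')).
  rewrite le_eqVlt; apply/orP; left; apply/eqP.
  by move: (ov _ _) (ov _ _) => o o'; field; rewrite gt_eqF.
pose fA (K : finType) (c : K -> 'I_N -> R) := HF p c ++ scl th (lin c).
have S6 : asle (Emax s (decF aQ bQ e1 ++ (scl mu (lin aQ) ++ scl mu (lin bQ))))
    (fun n x => 1 * Emax s (fA Q aQ ++ fA Q bQ) n x).
  move=> eps e0; have [|n0 hn] := @Emax_same R Q s (decF aQ bQ e1 ++ (scl mu (lin aQ) ++ scl mu (lin bQ)))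
    (fA Q aQ ++ fA Q bQ) s0 _ eps e0; last first.
    by exists n0 => n nn x; rewrite mul1r; exact: hn.
  by move=> t t'; rewrite !cov_cat !cov_scale th2; ring.
have S7 n : Emax s (fA Q aQ ++ fA Q bQ) n 0 <= 1 * (Emax s (fA I a) n 0 * Emax s (fA (I * Xi)%type bt) n 0).
  have := Emax_prod s (fA I a) (fA (I * Xi)%type bt) n 0 0.
  have -> : ((0 : I -> R) \o (@fst I (I * Xi))) + ((0 : I * Xi -> R) \o (@snd I (I * Xi))) = 0.
    by apply/funext => t; rewrite vaddE /= addr0.
  by rewrite mul1r /fA !map_cat /scl /HF /HFg /lin -!map_comp.
have S8 : evb (fun n => Emax s (fA I a) n 0 * Emax s (fA (I * Xi)%type bt) n 0)
    (replica_cst s eta dl th * replica_cst s eta dl th).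
  have btT t : Theta R D N (bt t) by apply: Theta_gz; exact: bT.
  have btd t k : bt t k ^+ 2 <= dl * NR by rewrite /bt /gz exprMn sqrr_sign mul1r.
  move=> eps e0; have e2 : 0 < eps / 2 by rewrite divr_gt0.
  have [l1 h1] := replica_bound N_gt0 p_ge4 p_even Heta aT dl01 th0 s0 ad e2.
  have [l2 h2] := replica_bound N_gt0 p_ge4 p_even Heta btT dl01 th0 s0 btd e2.
  exists (maxn l1 l2) => l; rewrite geq_max => /andP[k1 k2].
  have := ler_pM (Emax_ge0 _ _ _ _) (Emax_ge0 _ _ _ _) (h1 l k1) (h2 l k2).
  move/le_trans; apply; rewrite mulrACA -expRD -splitr; exact: lexx.
have S9 := evb_le ler01 S7 S8; rewrite mul1r in S9.
have S10 := asle_evb ler01 S6 S9; rewrite mul1r in S10.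
have S11 := asle_evb (expR_ge0 _) (asle_cat (decF aQ bQ e1) S5) S10.
have S12 : evb (fun n => Emax s (decF a b e1) n 0) (expR (- (s * (lam * (q / 2)))) *
   (expR (s ^+ 2 * (256 * lam ^+ 2 * K0 ^+ 2 / NR)) *
    (replica_cst s eta dl th * replica_cst s eta dl th))).
  move=> eps e0; have e2 : 0 < eps / 2 by rewrite divr_gt0.
  have [n0 h0] := S4 _ e2; have [l1 h1] := S11 _ e2.
  exists (maxn n0 l1) => l; rewrite geq_max => /andP[k0 k1].
  apply: (le_trans (h0 _ (leq_trans k0 (ltn_pow2 l)))).
  have -> : expR eps = expR (eps / 2) * expR (eps / 2) by rewrite -expRD -splitr.
  rewrite -mulrA; apply: ler_wpM2l; first exact: expR_ge0.
  rewrite [leRHS]mulrCA; apply: ler_wpM2l; first exact: expR_ge0.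
  exact: h1.
have cc0 : 0 <= expR (s ^+ 2 * ((4 + 2 * p%:R + p%:R ^+ 2) / NR)) *
     (2 * expR (2 * (s * (p%:R / Num.sqrt NR)) ^+ 2)).
  by rewrite mulr_ge0 ?expR_ge0// mulr_ge0// expR_ge0.
have := asle_evb cc0 (pair_decouple sa sb q0 q1 ovq s0) S12.
have -> : expR (s ^+ 2 * ((4 + 2 * p%:R + p%:R ^+ 2) / NR)) *
     (2 * expR (2 * (s * (p%:R / Num.sqrt NR)) ^+ 2)) * (expR (- (s * (lam * (q / 2)))) *
   (expR (s ^+ 2 * (256 * lam ^+ 2 * K0 ^+ 2 / NR)) *
    (replica_cst s eta dl th * replica_cst s eta dl th))) =
  2 * expR (s ^+ 2 / NR * (4 + 2 * p%:R + 3 * p%:R ^+ 2 + 256 * lam ^+ 2 * K0 ^+ 2)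
       - s * (lam * (q / 2))) * (replica_cst s eta dl th * replica_cst s eta dl th).
  have -> : (s * (p%:R / Num.sqrt NR)) ^+ 2 = s ^+ 2 * (p%:R ^+ 2 / NR).
    by rewrite !exprMn exprVn sqr_sqrtr// ltW.
  have -> : s ^+ 2 / NR * (4 + 2 * p%:R + 3 * p%:R ^+ 2 + 256 * lam ^+ 2 * K0 ^+ 2)
       - s * (lam * (q / 2)) = s ^+ 2 * ((4 + 2 * p%:R + p%:R ^+ 2) / NR) +
       (2 * (s ^+ 2 * (p%:R ^+ 2 / NR)) + (- (s * (lam * (q / 2))) +
       s ^+ 2 * (256 * lam ^+ 2 * K0 ^+ 2 / NR))) by ring.
  by move: (replica_cst _ _ _ _ * _) => rc; rewrite !expRD; ring.
exact.
Qed.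

End Pair.

(** * Flattening by random rotations *)
Section Hartley.
Context {R : realType}.
Variable N : nat.
Hypothesis N_gt0 : (0 < N)%N.
Notation NR := (N%:R : R).
Let NR0 : 0 < NR. Proof. by rewrite ltr0n. Qed.
Let NRn : NR != 0. Proof. by rewrite gt_eqF. Qed.

Let theta : R := pi *+ 2 / NR.

Let thN (m : nat) : theta * m%:R * NR = 0 + pi *+ 2 *+ m.
Proof. by rewrite /theta add0r -[RHS]mulr_natr; field. Qed.

Lemma sum_cos (m : nat) : (0 < m < N)%N -> \sum_(k < N) cos (theta * m%:R * k%:R) = 0.
Proof.
move=> /andP[m0 mN]; set x := theta * m%:R.
have mR : 0 < m%:R :> R by rewrite ltr0n.
have x2 : x / 2 = pi * (m%:R / NR) by rewrite /x /theta -[pi *+ 2]mulr_natr; field.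
have sx : 0 < sin (x / 2).
  apply: sin_gt0_pi; rewrite x2 mulr_gt0 ?divr_gt0 ?pi_gt0//=.
  by rewrite gtr_pMr ?pi_gt0// ltr_pdivrMr// mul1r ltr_nat.
apply/eqP; rewrite -(mulrI_eq0 _ (lregP (_ : 2 * sin (x / 2) != 0))); last first.
  by rewrite mulf_neq0 ?gt_eqF.
apply/eqP; rewrite mulr_sumr.
pose t (k : nat) : R := sin (x * k%:R - x / 2).
rewrite (eq_bigr (fun k : 'I_N => t k.+1 - t k)); last first.
  move=> k _; rewrite /t -[k.+1%:R]natr1.
  have -> : x * (k%:R + 1) - x / 2 = x * k%:R + x / 2 by field.
  by rewrite sinD sinB; ring.
rewrite -(big_mkord predT (fun k => t k.+1 - t k)) telescope_sumr// /t mulr0 add0r.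
rewrite thN addrAC (periodicn (@sinD2pi R)) add0r.
by rewrite subrr.
Qed.

Lemma sum_sin (m : nat) : \sum_(k < N) sin (theta * m%:R * k%:R) = 0.
Proof.
pose f (k : nat) : R := sin (theta * m%:R * k%:R).
have f0 : f 0%N = 0 by rewrite /f mulr0 sin0.
have fN : f N = 0 by rewrite /f thN (periodicn (@sinD2pi R)) sin0.
have fB k : (k <= N)%N -> f (N - k)%N = - f k.
  move=> kN; rewrite /f natrB// mulrBr thN addrAC (periodicn (@sinD2pi R)) add0r.
  exact: sinN.
have sh : \sum_(k < N) f k.+1 = \sum_(k < N) f k.
  apply/eqP; rewrite -subr_eq0 -sumrB -(big_mkord predT (fun k => f k.+1 - f k)).
  by rewrite telescope_sumr// fN f0 subr0.
have : \sum_(k < N) f k.+1 = - \sum_(k < N) f k.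
  rewrite (reindex_inj rev_ord_inj) -sumrN; apply: eq_bigr => k _.
  by rewrite /= subnSK// fB// ltnW.
by rewrite sh -/(\sum_(k < N) f k); move: (\sum_(k < N) f k) => y; lra.
Qed.

(** The discrete Hartley transform: a real symmetric orthogonal matrix with all entries O(N^{-1/2}),
    available in every dimension. Composed with random signs it flattens a given point. *)
Definition hart (i j : 'I_N) : R :=
  (Num.sqrt NR)^-1 * (cos (theta * i%:R * j%:R) + sin (theta * i%:R * j%:R)).

Lemma hartC i j : hart i j = hart j i.
Proof. by rewrite /hart mulrAC. Qed.

Lemma hart_sqr i j : hart i j ^+ 2 <= 2 / NR.
Proof.
rewrite /hart exprMn exprVn sqr_sqrtr ?(ltW NR0)// mulrC ler_wpM2r ?invr_ge0 ?(ltW NR0)//.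
set x := _ * _; have := cos2Dsin2 x; have := sqr_ge0 (cos x - sin x).
by rewrite sqrrB sqrrD; lra.
Qed.

Lemma hart_orth i j : \sum_k hart i k * hart k j = (i == j)%:R.
Proof.
wlog ji : i j / (j <= i)%N.
  move=> W; have [h|/ltnW h] := leqP j i; first exact: W.
  by rewrite eq_sym -(W j i h); apply: eq_bigr => k _; rewrite mulrC hartC (hartC i).
have -> : \sum_k hart i k * hart k j = NR^-1 * (\sum_(k < N) cos (theta * (i - j)%:R * k%:R) +
    \sum_(k < N) sin (theta * (i + j)%:R * k%:R)).
  rewrite -big_split mulr_sumr; apply: eq_bigr => k _ /=; rewrite /hart.
  rewrite natrB// natrD !mulrBr !mulrDr !mulrBl !mulrDl.
  have -> : theta * k%:R * j%:R = theta * j%:R * k%:R by ring.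
  rewrite cosB sinD.
  have -> : NR^-1 = (Num.sqrt NR)^-1 * (Num.sqrt NR)^-1.
    by rewrite -expr2 exprVn sqr_sqrtr// ltW.
  by ring.
rewrite sum_sin addr0; have [->|ne] := eqVneq i j.
  rewrite subnn (eq_bigr (fun=> 1)) => [|k _]; last by rewrite mulr0 mul0r cos0.
  by rewrite sumr_const card_ord mulVf.
rewrite sum_cos ?mulr0// subn_gt0 ltn_neqAle ji andbT; apply/andP; split.
  by apply: contra ne => /eqP e; apply/eqP/val_inj.
exact: leq_ltn_trans (leq_subr _ _) (ltn_ord i).
Qed.

Definition hmul (z : 'I_N -> R) : 'I_N -> R := fun k => \sum_j hart k j * z j.

Lemma hmulK z : hmul (hmul z) = z.
Proof.
apply/funext => k; rewrite /hmul.
under eq_bigr do rewrite mulr_sumr.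
rewrite exchange_big/=; under eq_bigr do (under eq_bigr do rewrite mulrA; rewrite -mulr_suml hart_orth).
rewrite (bigD1 k)//= eqxx mul1r big1 ?addr0// => j jk.
by rewrite eq_sym (negbTE jk) mul0r.
Qed.

Lemma inner_hmul z z' : inner (hmul z) (hmul z') = inner z z'.
Proof.
rewrite -{2}(hmulK z') /inner; transitivity (\sum_k \sum_j hart k j * z j * hmul z' k).
  by apply: eq_bigr => k _; rewrite /hmul mulr_suml.
rewrite exchange_big; apply: eq_bigr => j _; rewrite {2}/hmul mulr_sumr; apply: eq_bigr => k _.
by rewrite (hartC k) mulrAC mulrC mulrA.
Qed.

Definition qrot (xi : {ffun 'I_N -> bool}) z := hmul (gz xi z).
Definition qinv (xi : {ffun 'I_N -> bool}) z := gz xi (hmul z).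

Lemma qrotK xi z : qinv xi (qrot xi z) = z.
Proof.
rewrite /qinv /qrot hmulK; apply/funext => k.
by rewrite /gz mulrA -expr2 sqrr_sign mul1r.
Qed.

Lemma inner_qrot xi z z' : inner (qrot xi z) (qrot xi z') = inner z z'.
Proof. by rewrite inner_hmul inner_gz. Qed.

Lemma inner_qinv xi z z' : inner (qinv xi z) (qinv xi z') = inner z z'.
Proof. by rewrite inner_gz inner_hmul. Qed.

Lemma sum_sign_exp (c : 'I_N -> R) :
  \sum_(xi : {ffun 'I_N -> bool}) expR (\sum_j (-1) ^+ xi j * c j) <=
    2 ^+ N * expR (2 * \sum_j c j ^+ 2).
Proof.
have -> : \sum_(xi : {ffun 'I_N -> bool}) expR (\sum_j (-1) ^+ xi j * c j) =
    \prod_j \sum_(b : bool) expR ((-1) ^+ b * c j).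
  rewrite bigA_distr_bigA; apply: eq_bigr => xi _.
  by rewrite expR_sum.
have -> : 2 ^+ N * expR (2 * \sum_j c j ^+ 2) = \prod_(j < N) (2 * expR (2 * c j ^+ 2)).
  by rewrite big_split/= prodr_const card_ord mulr_sumr expR_sum.
apply: ler_prod => j _; rewrite big_bool /= expr1 expr0 mul1r mulN1r.
rewrite addr_ge0 ?expR_ge0//=; have := cosh_le (c j); lra.
Qed.

Lemma pow8_le (x : R) : x ^+ 8 <= 8 ^+ 8 * (expR x + expR (- x)).
Proof.
have main (y : R) : 0 <= y -> y ^+ 8 <= 8 ^+ 8 * expR y.
  move=> y0; have -> : expR y = expR (y / 8) ^+ 8 by rewrite -expRM_natl; congr expR; field.
  rewrite -exprMn; apply: lerXn2r; rewrite ?nnegrE// ?mulr_ge0 ?expR_ge0//.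
  by have := expR_ge1Dx (y / 8); lra.
have [x0|x0] := leP 0 x.
  apply: (le_trans (main x x0)); rewrite ler_wpM2l ?exprn_ge0// lerDl; exact: expR_ge0.
have -> : x ^+ 8 = (- x) ^+ 8 by ring.
apply: (le_trans (main (- x) _)); first by rewrite oppr_ge0 ltW.
by rewrite ler_wpM2l ?exprn_ge0// lerDr; exact: expR_ge0.
Qed.

(** Rotated coordinates have exponential moments at most e^4, so by [pow8_le] the mean of the sum of
    eighth powers is at most C8 N / 4. Each of two points then fails to be flat for at most a
    quarter of the rotations. *)
Definition C8 : R := 8 * (8 ^+ 8 * expR 4).

Definition flat8 (z : 'I_N -> R) : bool := \sum_k z k ^+ 8 <= C8 * NR.

Lemma sum_qrot8 z : inner z z = NR ->
  \sum_(xi : {ffun 'I_N -> bool}) \sum_k qrot xi z k ^+ 8 <= 2 ^+ N * (C8 / 4 * NR).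
Proof.
move=> nz; rewrite exchange_big/=.
have -> : 2 ^+ N * (C8 / 4 * NR) = \sum_(k < N) 2 ^+ N * (2 * (8 ^+ 8 * expR 4)).
  by rewrite sumr_const card_ord -[RHS]mulr_natr /C8; field.
apply: ler_sum => k _.
have g (e : R) : e ^+ 2 = 1 -> \sum_(xi : {ffun 'I_N -> bool}) expR (e * qrot xi z k) <= 2 ^+ N * expR 4.
  move=> e2; have := sum_sign_exp (fun j => e * hart k j * z j).
  rewrite (eq_bigr (fun xi => expR (e * qrot xi z k))); last first.
    move=> xi _; rewrite /qrot /hmul /gz mulr_sumr; congr expR; apply: eq_bigr => j _.
    by ring.
  move/le_trans; apply; rewrite ler_pM2l ?exprn_gt0// ler_expR.
  have : \sum_j (e * hart k j * z j) ^+ 2 <= 2.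
    apply: (@le_trans _ _ (\sum_j 2 / NR * (z j * z j))).
      apply: ler_sum => j _; rewrite 2!exprMn e2 mul1r -(expr2 (z j)).
      by apply: ler_wpM2r; [exact: sqr_ge0|exact: hart_sqr].
    by rewrite -mulr_sumr -/(inner z z) nz divfK.
  lra.
apply: (@le_trans _ _ (\sum_(xi : {ffun 'I_N -> bool}) 8 ^+ 8 *
   (expR (1 * qrot xi z k) + expR (-1 * qrot xi z k)))).
  by apply: ler_sum => xi _; rewrite mul1r mulN1r; exact: pow8_le.
rewrite -mulr_sumr big_split/=.
have h1 := g 1 (expr1n _ _); have h2 := g (-1); rewrite sqrrN expr1n in h2.
have {}h2 := h2 erefl.
have -> : 2 ^+ N * (2 * (8 ^+ 8 * expR 4)) = 8 ^+ 8 * (2 ^+ N * expR 4 + 2 ^+ N * expR 4) :> R by ring.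
by apply: ler_wpM2l; [rewrite exprn_ge0|exact: lerD].
Qed.

Lemma many_flat z z' : inner z z = NR -> inner z' z' = NR ->
  2 ^+ N / 2 <= \sum_(xi : {ffun 'I_N -> bool}) (flat8 (qrot xi z) && flat8 (qrot xi z'))%:R :> R.
Proof.
move=> nz nz'; have C0 : 0 < C8 by rewrite /C8 !mulr_gt0 ?exprn_gt0 ?expR_gt0.
have CN : 0 < C8 * NR by rewrite mulr_gt0.
have bad y : inner y y = NR ->
    \sum_(xi : {ffun 'I_N -> bool}) (~~ flat8 (qrot xi y))%:R <= 2 ^+ N / 4 :> R.
  move=> ny; rewrite -(ler_pM2r CN) mulr_suml.
  have -> : 2 ^+ N / 4 * (C8 * NR) = 2 ^+ N * (C8 / 4 * NR) by field.
  apply: le_trans (sum_qrot8 ny); apply: ler_sum => xi _.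
  have s0 : 0 <= \sum_k qrot xi y k ^+ 8 by apply: sumr_ge0 => k _; exact: exprn_even_ge0.
  case F : (flat8 (qrot xi y)).
    by have -> : (~~ true)%:R = 0 :> R by []; rewrite mul0r.
  have -> : (~~ false)%:R = 1 :> R by [].
  by move/negbT: F; rewrite /flat8 -ltNge mul1r; exact: ltW.
have tot : \sum_(xi : {ffun 'I_N -> bool}) 1 = 2 ^+ N :> R.
  by rewrite sumr_const card_ffun card_bool card_ord natrX.
have : \sum_(xi : {ffun 'I_N -> bool}) (1 : R) <=
    \sum_(xi : {ffun 'I_N -> bool}) (flat8 (qrot xi z) && flat8 (qrot xi z'))%:R +
    (\sum_(xi : {ffun 'I_N -> bool}) (~~ flat8 (qrot xi z))%:R +
     \sum_(xi : {ffun 'I_N -> bool}) (~~ flat8 (qrot xi z'))%:R).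
  rewrite -!big_split; apply: ler_sum => xi _ /=.
  by case: (flat8 _); case: (flat8 _) => /=; rewrite ?addr0 ?add0r// ?lerDl.
by rewrite tot; have := bad _ nz; have := bad _ nz'; lra.
Qed.

Variable p : nat.
Notation T := {ffun 'I_p -> 'I_N}.

(** All [HFg] walks are images of one walk on tensors, so that fields of different families can be
    evaluated at the same tensor. *)
Lemma gE_HFg (K : finType) n (w : K -> T -> R) F :
  gE n (HFg w) F = gE n [seq (fun f : T => (f == h)%:R : R) | h <- enum T]
    (fun g => F (fun k => \sum_f g f * (Num.sqrt (p`!%:R^-1) * sdev R p N * w k f))).
Proof.
pose L (g : T -> R) : K -> R := fun k => \sum_f g f * (Num.sqrt (p`!%:R^-1) * sdev R p N * w k f).
rewrite [RHS](@gE_map R (T -> R) (K -> R) n L _ F); last 2 first.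
- move=> g h; apply/funext => k; rewrite vaddE /L -big_split; apply: eq_bigr => f _.
  by rewrite vaddE mulrDl.
- move=> c g; apply/funext => k; rewrite vscaleE /L mulr_sumr; apply: eq_bigr => f _.
  by rewrite vscaleE mulrA.
rewrite -map_comp; congr (gE n _ F); apply: eq_map => h; apply/funext => k /=.
rewrite /L (bigD1 h)//= eqxx mul1r big1 ?addr0// => f fh.
by rewrite (negbTE fh) mul0r.
Qed.

(** No single rotation flattens all pairs. But for each tensor the maximizing pair becomes flat
    under at least half of the rotations, so the maxima over flat rotated pairs, taken after
    rotating back and averaged over [xi], reach half of the full one. Rotating back by a fixed [xi]
    preserves covariances. *)
Theorem flatten_pairs (I : finType) (a b : I -> 'I_N -> R) : sph a -> sph b ->
  exists (J : finType) (a' b' : J -> 'I_N -> R) (h : J -> I),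
  [/\ sph a', sph b', forall j, ov (a' j) (b' j) = ov (a (h j)) (b (h j)),
    forall j, flat8 (a' j) /\ flat8 (b' j) &
    forall s B, 0 < s -> evb (fun n => Emax s (pairF p a' b') n 0) B ->
       evb (fun n => Emax s (pairF p a b) n 0) (2 * B)].
Proof.
move=> sa sb; pose Xi := {ffun 'I_N -> bool}.
pose good (t : I * Xi) := flat8 (qrot t.2 (a t.1)) && flat8 (qrot t.2 (b t.1)).
pose J := {t : I * Xi | good t}.
pose a' (j : J) := qrot (val j).2 (a (val j).1); pose b' (j : J) := qrot (val j).2 (b (val j).1).
exists J, a', b', (fun j => (val j).1); split.
- by move=> j; rewrite /a' inner_qrot sa.
- by move=> j; rewrite /b' inner_qrot sb.
- by move=> j; rewrite /ov inner_qrot.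
- by move=> j; have /andP := valP j.
move=> s B s0 HB.
move=> eps e0; have e2 : 0 < eps / 2 by rewrite divr_gt0.
have [n0 hn0] : exists n0, forall n, (n0 <= n)%N -> forall xi : Xi, forall x,
    Emax s (pairF p (fun j => qinv xi (a' j)) (fun j => qinv xi (b' j))) n x <=
    expR (eps / 2) * Emax s (pairF p a' b') n x.
  apply: (@fin_eventually Xi (fun xi n => forall x, Emax s (pairF p (fun j => qinv xi (a' j))
     (fun j => qinv xi (b' j))) n x <= expR (eps / 2) * Emax s (pairF p a' b') n x)) => xi.
  apply: (@Emax_same R J s _ _ s0 _ _ e2) => i j.
  by rewrite !cov_pairF /ov !inner_qinv.
have [l0 hl0] := HB _ e2.
exists (maxn n0 l0) => l; rewrite geq_max => /andP[k0 k1].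
have {}hn0 := hn0 _ (leq_trans k0 (ltn_pow2 l)); have {}hl0 := hl0 l k1.
move: hn0 hl0; set n := (2 ^ l)%N => hn0 hl0.
have X0 : 0 < 2 ^+ N :> R by rewrite exprn_gt0.
have key : 2 ^+ N / 2 * Emax s (pairF p a b) n 0 <=
    \sum_(xi : Xi) Emax s (pairF p (fun j => qinv xi (a' j)) (fun j => qinv xi (b' j))) n 0.
  rewrite /Emax /pairF gE_HFg -gE_mull.
  under eq_bigr do rewrite gE_HFg.
  rewrite -(gE_sum n _ (index_enum Xi)); apply: gE_le => g.
  set cf := Num.sqrt _ * _.
  pose val_ (z z' : 'I_N -> R) := \sum_f g f * (cf * (mono z f + mono z' f)).
  set x := (X in expmax s (0 + X)).
  have [/eqP I0|/card_gt0P[i0 _]] := posnP #|I|.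
    rewrite expmax_empty ?mulr0; last exact/eqP.
    by apply: sumr_ge0 => xi _; exact: expmax_ge0.
  have [i Hi] : exists i, expmax s (0 + x) <= expR (s * x i).
    exists [arg max_(i > i0) x i]%O; case: arg_maxP => // k _ Hk.
    apply: expmax_le => [|i]; first exact: expR_ge0.
    by rewrite vaddE add0r ler_expR ler_wpM2l// ?(ltW s0)//; exact: Hk.
  apply: (@le_trans _ _ (\sum_(xi : Xi) (good (i, xi))%:R * expR (s * x i))).
    rewrite -mulr_suml; apply: ler_pM.
    - by rewrite divr_ge0// ltW.
    - exact: expmax_ge0.
    - exact: (many_flat (sa i) (sb i)).
    - exact: Hi.
  apply: ler_sum => xi _; case gi : (good (i, xi)); last by rewrite mul0r expmax_ge0.
  rewrite mul1r; pose j : J := Sub (i, xi) gi.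
  apply: le_trans (expmax_ge s _ j); rewrite ler_expR vaddE add0r /= /a' /b' SubK /=.
  by rewrite !qrotK.
have h2 : 2 ^+ N / 2 * Emax s (pairF p a b) n 0 <= 2 ^+ N * (expR (eps / 2) * Emax s (pairF p a' b') n 0).
  apply: (le_trans key); apply: (@le_trans _ _ (\sum_(xi : Xi) expR (eps / 2) * Emax s (pairF p a' b') n 0)).
    by apply: ler_sum => xi _; exact: hn0.
  by rewrite sumr_const card_ffun card_bool card_ord -[leLHS]mulr_natl natrX.
have h3 : Emax s (pairF p a b) n 0 <= 2 * (expR (eps / 2) * Emax s (pairF p a' b') n 0).
  rewrite -(ler_pM2l X0); move: h2; move: (2 ^+ N) (Emax _ _ _ _) (expR _ * _) => u1 u2 u3; lra.
apply: (le_trans h3); rewrite [leRHS]mulrCA ler_pM2l//.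
have -> : expR eps = expR (eps / 2) * expR (eps / 2) by rewrite -expRD -splitr.
by rewrite -mulrA ler_pM2l ?expR_gt0.
Qed.

End Hartley.

(** * The overlap gap *)
Section Gap.
Context {R : realType}.
Variables (p : nat) (D : domain).
Hypothesis p_ge4 : (4 <= p)%N.
Hypothesis p_even : ~~ odd p.
Notation vp := (p`!%:R^-1 : R).
Let vp0 : 0 < vp. Proof. exact: vp_gt0. Qed.

Definition pairH (N : nat) (I : finType) (a b : I -> 'I_N -> R) : seq (I -> R) :=
  Hg (fun i (f : {ffun 'I_p -> 'I_N}) => mono (a i) f + mono (b i) f).

Section FixN.
Variable N : nat.
Hypothesis N_gt0 : (0 < N)%N.
Notation NR := (N%:R : R).
Let NR0 : 0 < NR. Proof. by rewrite ltr0n. Qed.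

(** Points of the cube are flat already, and a rotation would leave the cube; only the sphere needs
    [flatten_pairs]. *)
Lemma flat_reduce (I : finType) (a b : I -> 'I_N -> R) (q : R) :
  (forall i, Theta R D N (a i)) -> (forall i, Theta R D N (b i)) ->
  (forall i, q <= ov (a i) (b i) <= 2 * q) ->
  exists (J : finType) (a' b' : J -> 'I_N -> R),
  [/\ forall j, Theta R D N (a' j) /\ Theta R D N (b' j),
    forall j, q <= ov (a' j) (b' j) <= 2 * q,
    forall j, flat8 (a' j) /\ flat8 (b' j) &
    forall s B, 0 < s -> evb (fun n => Emax s (pairF p a' b') n 0) B ->
       evb (fun n => Emax s (pairF p a b) n 0) (2 * B)].
Proof.
case: D => aT bT ovq.
  have fl (z : 'I_N -> R) : Theta R Ising N z -> flat8 z.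
    move=> zT; rewrite /flat8 (eq_bigr (fun=> 1)); last first.
      by move=> k _; case: (zT k) => ->; ring.
    rewrite sumr_const card_ord ler_peMl ?(ltW NR0)//.
    have : 1 <= expR 4 :> R by rewrite -expR0 ler_expR.
    by rewrite /C8; move: (expR 4) => e; lra.
  exists I, a, b; split=> //; first by move=> j; split; apply: fl.
  move=> s B s0 h eps e0; have [l0 hl] := h eps e0; exists l0 => l ll.
  have k := hl l ll; apply: (le_trans k).
  have e : 0 < expR eps := expR_gt0 _.
  have B0 : 0 <= expR eps * B := le_trans (Emax_ge0 _ _ _ _) k.
  by lra.
have [J [a' [b' [h [sa sb o fl tr]]]]] := flatten_pairs N_gt0 p aT bT.
exists J, a', b'; split=> [j|j|j|].
- by split; [exact: sa|exact: sb].
- by rewrite o.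
- exact: fl.
- exact: tr.
Qed.

Lemma pairs_walk_bound (eta dl q K0 lam s : R) (I : finType) (a b : I -> 'I_N -> R) :
  max_bound p N D eta -> 0 <= dl <= 1 -> C8 * NR <= (dl * NR) ^+ 4 ->
  0 < q -> 2 * q <= 1 -> 0 < K0 -> K0 ^+ 3 * q = 2 * (C8 + 1) -> 0 <= lam -> 0 < s ->
  (forall i, Theta R D N (a i)) -> (forall i, Theta R D N (b i)) ->
  (forall i, q <= ov (a i) (b i) <= 2 * q) ->
  let th := Num.sqrt (vp * p%:R * (2 * q) ^+ p.-1 + 128 * lam ^+ 2 * K0 ^+ 2) in
  evb (fun n => Emax s (pairH a b) n 0)
    (expR (s ^+ 2 * (4 / NR)) * (2 *
    (2 * expR (s ^+ 2 / NR * (4 + 2 * p%:R + 3 * p%:R ^+ 2 + 256 * lam ^+ 2 * K0 ^+ 2)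
       - s * (lam * (q / 2))) *
     (replica_cst p N s eta dl th * replica_cst p N s eta dl th)))).
Proof.
move=> Heta dl01 dlN q0 q1 K00 K03 lam0 s0 aT bT ovq th.
have sa : sph a by move=> i; exact: Theta_inner (aT i).
have sb : sph b by move=> i; exact: Theta_inner (bT i).
have w_sym i : sym_fun (fun f : {ffun 'I_p -> 'I_N} => mono (a i) f + mono (b i) f).
  by move=> f t; rewrite !mono_sym.
have vF i : cov (pairF p a b) i i <= 4 / NR.
  rewrite cov_pairF// (ovC (b i) (a i)) (ov_self N_gt0 (sa i)) (ov_self N_gt0 (sb i)) expr1n.
  rewrite mulrAC; apply: ler_wpM2r; first by rewrite invr_ge0 ltW.
  have o1 : ov (a i) (b i) ^+ p <= 1 by apply: even_pow_le1 => //; exact: (ov_norm N_gt0 (sa i) (sb i)).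
  have o0 : 0 <= ov (a i) (b i) ^+ p by exact: even_pow_ge0.
  apply: (@le_trans _ _ (1 * 4)); last by rewrite mul1r.
  by apply: ler_pM; rewrite ?vp_le1 ?(ltW vp0)//; lra.
have V0 : 0 <= 4 / NR by rewrite divr_ge0// ltW.
apply: (asle_evb (expR_ge0 _) (G := Emax s (pairF p a b))).
  apply: (Emax_compare s0 V0) => //.
  - by move=> i; apply: le_trans (vF i); exact: cov_Hg_le.
  - exact: incr_Hg_HFg.
have [J [a' [b' [T' o' fl tr]]]] := flat_reduce aT bT ovq.
apply: tr => //.
have coord (z : 'I_N -> R) k : flat8 z -> z k ^+ 2 <= dl * NR.
  rewrite /flat8 => h; have h8 : z k ^+ 8 <= (dl * NR) ^+ 4.
    apply: le_trans dlN; apply: le_trans h; rewrite (bigD1 k)//= lerDl.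
    by apply: sumr_ge0 => j _; exact: exprn_even_ge0.
  have dN0 : 0 <= dl * NR by rewrite mulr_ge0 ?(ltW NR0)//; case/andP: dl01.
  rewrite -(@ler_pXn2r _ 4) ?nnegrE ?sqr_ge0// -exprM.
  exact: h8.
apply: (pair_bound N_gt0 p_ge4 p_even Heta) => //.
- by move=> i; case: (T' i).
- by move=> i; case: (T' i).
- by move=> i k; apply: coord; case: (fl i).
- by move=> i k; apply: coord; case: (fl i).
move=> i; have [fa fb] := fl i; have [ta tb] := T' i.
have o1 : q <= ov (a' i) (b' i) by case/andP: (o' i).
have K3 : 0 < K0 ^+ 3 by rewrite exprn_gt0.
(* The relation [K0 ^+ 3 * q = 2 * (C8 + 1)] makes this loss equal to N q / 2, so at least half of
   the overlap survives clipping. *)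
have h : \sum_k (a' i k * b' i k - clip K0 (a' i k) * clip K0 (b' i k)) <=
    (C8 * NR + C8 * NR + NR + NR) / (2 * K0 ^+ 3).
  apply: (@le_trans _ _ (\sum_k (a' i k ^+ 8 + b' i k ^+ 8 + a' i k ^+ 2 + b' i k ^+ 2) / (2 * K0 ^+ 3))).
    by apply: ler_sum => k _; exact: clip_prod.
  rewrite -mulr_suml !big_split/=; apply: ler_wpM2r; first by rewrite invr_ge0 mulr_ge0// ltW.
  have e (z : 'I_N -> R) : Theta R D N z -> \sum_k z k ^+ 2 = NR.
    by move=> /Theta_inner <-; apply: eq_bigr => k _; rewrite expr2.
  by rewrite (e _ ta) (e _ tb); move: fa fb; rewrite /flat8 => fa fb; rewrite !lerD.
rewrite sumrB -/(inner (a' i) (b' i)) in h.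
have e1 : (C8 * NR + C8 * NR + NR + NR) / (2 * K0 ^+ 3) = NR * (q / 2).
  have -> : q = 2 * (C8 + 1) / K0 ^+ 3 by rewrite -K03 mulrC mulKf ?gt_eqF.
  by field; rewrite gt_eqF.
rewrite e1 in h; rewrite [leRHS]mulrC ler_pdivlMr//.
have : q * NR <= inner (a' i) (b' i) by rewrite -ler_pdivlMr.
move: h; move: (inner _ _) (\sum_k _) => u1 u2; lra.
Qed.

(** Polynomial and cardinality losses in N are harmless here: the mesh [dl] is chosen with N and the
    disorder bound [Rm] fixed. *)
Lemma Hamil_lip (J : {ffun 'I_p -> 'I_N} -> R) (Rm dl : R) (z z' : 'I_N -> R) :
  (forall f, incr f -> `|J f| <= Rm) -> 0 <= Rm -> 0 <= dl ->
  inner z z = NR -> inner z' z' = NR -> (forall k, `|z k - z' k| <= dl) ->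
  Hamil J z - Hamil J z' <= #|{ffun 'I_p -> 'I_N}|%:R * (Rm * (p%:R * (NR ^+ p * dl))).
Proof.
move=> JR Rm0 dl0 nz nz' zz; rewrite /Hamil -sumrB.
have c0 : 0 <= Rm * (p%:R * (NR ^+ p * dl)).
  by rewrite mulr_ge0// mulr_ge0// mulr_ge0// exprn_ge0// ltW.
apply: (@le_trans _ _ (\sum_(f : {ffun 'I_p -> 'I_N}) Rm * (p%:R * (NR ^+ p * dl)))); last first.
  by rewrite sumr_const -[leLHS]mulr_natl.
rewrite [leLHS]big_mkcond/=; apply: ler_sum => f _; case: ifPn => // fi.
rewrite -mulrBr; apply: (le_trans (ler_norm _)); rewrite normrM.
apply: ler_pM => //; first exact: JR.
rewrite prod_telescope; apply: (le_trans (ler_norm_sum _ _ _)).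
apply: (@le_trans _ _ (\sum_(l < p) NR ^+ p * dl)); last first.
  by rewrite sumr_const card_ord -[leLHS]mulr_natl.
apply: ler_sum => l _; rewrite normr_prod.
have -> : NR ^+ p * dl = \prod_(i < p) (NR * (if i == l then dl else 1)).
  rewrite big_split/= prodr_const card_ord; congr (_ * _).
  by rewrite (bigD1 l)//= eqxx big1 ?mulr1// => i il; rewrite (negbTE il).
have N1 : 1 <= NR by rewrite ler1n.
apply: ler_prod => i _; rewrite normr_ge0/= /hyb; case: ifPn => [il|_].
  have -> : (i == l) = false by apply/eqP => e; rewrite e ltnn in il.
  by rewrite mulr1; exact: sphere_coord.
case: eqP => _; last by rewrite mulr1; exact: sphere_coord.
by apply: (le_trans (zz _)); rewrite ler_peMl.
Qed.

Lemma HamilN (J : {ffun 'I_p -> 'I_N} -> R) z : Hamil J (- z) = Hamil J z.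
Proof.
apply: eq_bigr => f _; congr (_ * _); rewrite (eq_bigr (fun i => -1 * z (f i))).
  by rewrite big_split/= prodr_const card_ord -signr_odd (negbTE p_even) expr0 mul1r.
by move=> i _; rewrite voppE mulN1r.
Qed.

Lemma ThetaN (z : 'I_N -> R) : Theta R D N z -> Theta R D N (- z).
Proof.
case: D => /= h; last by rewrite innerN.
by move=> i; rewrite voppE; case: (h i) => ->; rewrite ?opprK; [right|left].
Qed.

(** Net points are picked inside [S], one for each cell that meets it, so that domain and overlap
    constraints hold for them exactly. *)
Lemma finite_net (S : set (('I_N -> R) * ('I_N -> R))) (dl : R) : 0 < dl ->
  (forall z, S z -> inner z.1 z.1 = NR /\ inner z.2 z.2 = NR) ->
  exists (I : finType) (a b : I -> 'I_N -> R),
    (forall i, S (a i, b i)) /\ forall z, S z -> exists i,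
      forall k, `|z.1 k - a i k| <= dl /\ `|z.2 k - b i k| <= dl.
Proof.
move=> dl0 Sn; pose G := Num.truncn (2 * NR / dl).
pose cell (z : 'I_N -> R) : {ffun 'I_N -> 'I_G.+1} :=
  [ffun k => inord (Num.truncn ((z k + NR) / dl))].
have same z z' : inner z z = NR -> inner z' z' = NR -> cell z = cell z' ->
    forall k, `|z k - z' k| <= dl.
  have bd (y : 'I_N -> R) k : inner y y = NR -> 0 <= (y k + NR) / dl /\
      (Num.truncn ((y k + NR) / dl) < G.+1)%N.
    move=> ny; have := sphere_coord k ny; rewrite ler_norml => /andP[y1 y2]; split.
      by rewrite divr_ge0 ?(ltW dl0)//; lra.
    rewrite ltnS /G; apply: le_truncn; rewrite ler_pM2r ?invr_gt0//; lra.
  move=> nz nz' /ffunP e k; have := e k; rewrite !ffunE => /(congr1 val).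
  have [p1 q1] := bd z k nz; have [p2 q2] := bd z' k nz'.
  rewrite /= !inordK// => et; have := truncn_itv p1; have := truncn_itv p2; rewrite et -natr1.
  rewrite !ler_pdivlMr// !ltr_pdivrMr// => /andP[t1 t2] /andP[t3 t4].
  by rewrite ler_norml; move: t1 t2 t3 t4; move: (Num.truncn _)%:R => m; lra.
pose Y := ({ffun 'I_N -> 'I_G.+1} * {ffun 'I_N -> 'I_G.+1})%type.
pose ok (y : Y) := `[< exists z, S z /\ (cell z.1, cell z.2) = y >].
pose I := {y : Y | ok y}.
have pk (i : I) : {z | S z /\ (cell z.1, cell z.2) = val i}.
  by apply: cid; apply/asboolP; exact: (valP i).
exists I, (fun i => (projT1 (pk i)).1), (fun i => (projT1 (pk i)).2); split.
  by move=> i; case: (pk i) => -[z1 z2] [].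
move=> z Sz; have oz : ok (cell z.1, cell z.2) by apply/asboolP; exists z.
exists (Sub (cell z.1, cell z.2) oz) => k; case: (pk _) => y [Sy /= [e1 e2]].
have [n1 n2] := Sn _ Sz; have [m1 m2] := Sn _ Sy.
by split; apply: same.
Qed.

End FixN.
End Gap.

(** * Probability of bad pairs and choice of parameters *)

Section Final.
Context {R : realType}.
Variables (p : nat) (D : domain).
Hypothesis p_ge4 : (4 <= p)%N.
Hypothesis p_even : ~~ odd p.
Notation vp := (p`!%:R^-1 : R).
Let vp0 : 0 < vp. Proof. exact: vp_gt0. Qed.

(** A Chernoff bound at exponent [s] over a finite net. The mesh may depend on the disorder bound
    [Rm], so the net loses at most 1 in the exponent; its cardinality costs nothing because the
    moment bound is uniform in the index type. *)
Lemma bad_pairs_prob (N : nat) (s q eO B0 e0 : R) (d : measure_display)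
    (Omega : measurableType d) (P : probability Omega R)
    (J : {ffun 'I_p -> 'I_N} -> Omega -> R) :
  (0 < N)%N -> 0 < s -> 0 <= q -> 0 < e0 ->
  (forall (I : finType) (a b : I -> 'I_N -> R), (forall i, Theta R D N (a i)) ->
     (forall i, Theta R D N (b i)) -> (forall i, q <= ov (a i) (b i) <= 2 * q) ->
     evb (fun n => Emax s (pairH p a b) n 0) B0) ->
  gaussian_disorder P J ->
  exists B : set Omega, [/\ measurable B,
    (P B <= (expR 4 * B0 * expR (- (2 * s * eO)) + e0)%:E)%E &
    forall om, ~ B om -> forall z1 z2 : 'I_N -> R, Theta R D N z1 -> Theta R D N z2 ->
      eO <= Hamil (J^~ om) z1 -> eO <= Hamil (J^~ om) z2 ->
      ~ (q < N%:R^-1 * `|inner z1 z2| < 2 * q)].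
Proof.
move=> N0 s0 q0 e00 HI HJ; have NR0 : 0 < N%:R :> R by rewrite ltr0n.
have [Rm [Rm0 [Bt [mBt PBt hBt]]]] := disorder_tail HJ N0 e00.
pose S : set (('I_N -> R) * ('I_N -> R)) :=
  [set z | [/\ Theta R D N z.1, Theta R D N z.2 & q <= ov z.1 z.2 <= 2 * q]].
pose L : R := #|{ffun 'I_p -> 'I_N}|%:R * (Rm * (p%:R * N%:R ^+ p)).
have L0 : 0 <= L by rewrite mulr_ge0// mulr_ge0 ?(ltW Rm0)// mulr_ge0// exprn_ge0// ltW.
pose dl : R := (2 * s * L + 1)^-1.
have sL : 0 <= 2 * s * L by rewrite mulr_ge0// mulr_ge0// ltW.
have dl0 : 0 < dl by rewrite invr_gt0; lra.
have sLd : s * (L * dl) <= 1 / 2.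
  have : (2 * s * L + 1) * dl = 1 by rewrite mulfV// gt_eqF//; lra.
  have -> : (2 * s * L + 1) * dl = 2 * (s * (L * dl)) + dl by ring.
  by move: dl0; clear; lra.
have Sn z : S z -> inner z.1 z.1 = N%:R /\ inner z.2 z.2 = N%:R.
  by move=> [t1 t2 _]; split; [exact: Theta_inner t1|exact: Theta_inner t2].
have [I [a [b [Sab net]]]] := finite_net dl0 Sn.
have aT i : Theta R D N (a i) by case: (Sab i).
have bT i : Theta R D N (b i) by case: (Sab i).
have oab i : q <= ov (a i) (b i) <= 2 * q by case: (Sab i).
pose bad om := exists z1 z2 : 'I_N -> R, [/\ Theta R D N z1, Theta R D N z2,
   eO <= Hamil (J^~ om) z1, eO <= Hamil (J^~ om) z2 & q < N%:R^-1 * `|inner z1 z2| < 2 * q].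
pose E : set Omega := [set om | bad om /\ ~ Bt om].
have EI om : E om -> exists i, 2 * s * eO - 1 <= s * (Hamil (J^~ om) (a i) + Hamil (J^~ om) (b i)).
  case=> -[z1 [z2 [t1 t2 h1 h2 o12]]] nB; case/andP: o12 => o1 o2.
  (* As p is even, [z2] and [- z2] have the same energy; the sign is chosen to make the overlap
     nonnegative. *)
  have [z2' [t2' h2' o']] : exists z2', [/\ Theta R D N z2', eO <= Hamil (J^~ om) z2' &
      q <= ov z1 z2' <= 2 * q].
    have [p0|p0] := leP 0 (inner z1 z2).
      by exists z2; split=> //; move: o1 o2; rewrite (ger0_norm p0) mulrC => /ltW -> /ltW ->.
    exists (- z2); split; first exact: ThetaN.
      by rewrite HamilN.
    rewrite ovC ovN ovC /ov -mulNr; move: o1 o2; rewrite (ltr0_norm p0) mulrC.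
    by move=> /ltW -> /ltW ->.
  have [|i hi] := net (z1, z2'); first by split.
  exists i; have Jb f : incr f -> `|J f om| <= Rm by move=> fi; exact: ltW (hBt om nB f fi).
  have l1 := Hamil_lip N0 Jb (ltW Rm0) (ltW dl0) (Theta_inner t1) (Theta_inner (aT i)) (fun k => (hi k).1).
  have l2 := Hamil_lip N0 Jb (ltW Rm0) (ltW dl0) (Theta_inner t2') (Theta_inner (bT i)) (fun k => (hi k).2).
  have eL : #|{ffun 'I_p -> 'I_N}|%:R * (Rm * (p%:R * (N%:R ^+ p * dl))) = L * dl.
    by rewrite /L; ring.
  rewrite eL in l1 l2.
  have g : 2 * eO - 2 * (L * dl) <= Hamil (J^~ om) (a i) + Hamil (J^~ om) (b i).
    by move: l1 l2 h1 h2'; move: (Hamil _ _) (Hamil _ _) (Hamil _ _) (Hamil _ _) (L * dl) => *; lra.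
  by have := ler_wpM2l (ltW s0) g; lra.
have [I0|[i0 _]] : #|I| = 0%N \/ exists i : I, i \in I.
- by case: (posnP #|I|) => [->|/card_gt0P[i Ii]]; [left|right; exists i].
  exists Bt; split => // [|om nB z1 z2 t1 t2 h1 h2 hq].
    apply: (le_trans PBt); rewrite lee_fin lerDr; rewrite mulr_ge0 ?expR_ge0// mulr_ge0 ?expR_ge0//.
    have [l0 hl0] := HI I a b aT bT oab 1 ltr01.
    have := le_trans (Emax_ge0 _ _ _ _) (hl0 l0 (leqnn _)).
    by rewrite pmulr_rge0// expR_gt0.
  have [i _] : exists i, 2 * s * eO - 1 <= s * (Hamil (J^~ om) (a i) + Hamil (J^~ om) (b i)).
    by apply: EI; split=> //; exists z1, z2; split.
  exact: (fintype0 i I0).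
have [m [/andP[m0 m1] me]] := smooth_parameter (I := I) (ltr01 : 0 < 1 :> R).
pose beta := s / m; have be0 : 0 < beta by rewrite divr_gt0.
have mb : m * beta = s by rewrite mulrC divfK// gt_eqF.
pose w (f : {ffun 'I_p -> 'I_N}) (i : I) : R := beta * (mono (a i) f + mono (b i) f).
pose mm : 'I_1 -> R := fun _ => m.
pose W : 'I_1 -> I -> R := fun _ _ => 1.
have powE x : power_fun mm W x = expR (m * ln (\sum_i expR (x i))).
  rewrite /power_fun big_ord1 /mm /partition_fun; congr (expR (_ * ln _)).
  by apply: eq_bigr => i _; rewrite mul1r.
pose b0 := expR (2 * s * eO - 1); have b00 : 0 < b0 by exact: expR_gt0.
have hb om : E om -> b0 <= power_fun mm W (\sum_(f | incr f) J f om *: w f).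
  move=> Eom; have [i hi] := EI om Eom; rewrite powE; pose x := \sum_(f | incr f) J f om *: w f; rewrite -/x.
  have xi : x i = beta * (Hamil (J^~ om) (a i) + Hamil (J^~ om) (b i)).
    rewrite /x fct_sumE /Hamil -big_split mulr_sumr; apply: eq_bigr => f _ /=.
    by rewrite vscaleE /w /mono; ring.
  rewrite ler_expR; apply: (le_trans hi).
  have -> : s * (Hamil (J^~ om) (a i) + Hamil (J^~ om) (b i)) = m * x i by rewrite xi mulrA mb.
  rewrite ler_pM2l// -[leLHS]expRK ler_ln ?posrE ?expR_gt0 ?(sum_expR_gt0 i x)//.
  by rewrite (bigD1 i)//= lerDl; apply: sumr_ge0 => k _; exact: expR_ge0.
have W0 j i : 0 <= W j i by exact: ler01.
have W1 j : exists i, 0 < W j i by exists i0; exact: ltr01.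
have [l0 Hl0] := disorder_le_walk HJ N0 W0 W1 Rm0 b00 (ltr01 : 0 < 1 :> R)
   (fun om (h : E om) => hBt om h.2) hb.
have [l1 Hl1] := HI I a b aT bT oab 1 ltr01.
pose l := maxn l0 l1.
have [B [mB EB hB]] := Hl0 l (leq_maxl _ _); have hE := Hl1 l (leq_maxr _ _).
exists (B `|` Bt); split.
- exact: measurableU.
- have PU : (P (B `|` Bt) <= P B + P Bt)%E.
    exact: measureU2.
  apply: (le_trans PU); rewrite EFinD; apply: leeD => //.
  have fB : P B \is a fin_num by exact: fin_num_measure.
  move: hB; rewrite -(fineK fB) -EFinM !lee_fin => hB.
  move: hB; have -> : [seq sdev R p N *: w f | f <- enum {ffun 'I_p -> 'I_N} & incr f] =
      [seq beta *: u | u <- pairH p a b].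
    rewrite /pairH /Hg -map_comp; apply: eq_map => f; apply/funext => k.
    by rewrite /= !vscaleE /w mulrCA.
  rewrite -gE_scale => hB.
  have h1 : gE (2 ^ l) (pairH p a b) (fun y => power_fun mm W (beta *: y)) <=
      expR 1 * Emax s (pairH p a b) (2 ^ l) 0.
    rewrite /Emax -gE_mull; apply: gE_le => y; rewrite powE add0r -mb.
    exact: (smooth_le_expmax y i0 (ltW m0) (ltW be0) me).
  (* One unit of exponent each for the grid link, the smoothed maximum and the walk bound; with the
     unit lost to the net in [b0] this makes [expR 4]. *)
  have h2 : b0 * fine (P B) <= expR 1 * (expR 1 * (expR 1 * B0)).
    apply: (le_trans hB); apply: ler_wpM2l; first exact: expR_ge0.
    by apply: (le_trans h1); apply: ler_wpM2l; first exact: expR_ge0.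
  rewrite -(ler_pM2l b00); apply: (le_trans h2).
  have -> : b0 * (expR 4 * B0 * expR (- (2 * s * eO))) = (b0 * expR 4 * expR (- (2 * s * eO))) * B0 by ring.
  rewrite /b0 -!expRD !mulrA -!expRD.
  have -> : 2 * s * eO - 1 + 4 - 2 * s * eO = 1 + 1 + 1 :> R by ring.
  exact: lexx.
- move=> om nB z1 z2 t1 t2 h1 h2 hq.
  have nBt : ~ Bt om by move=> h; apply: nB; right.
  by apply: nB; left; apply: EB; split=> //; exists z1, z2; split.
Qed.

(** Since s = sig N, every term s^2 / N becomes sig s and is made small by [sig]. The rescaling r =
    sqrt(1 + 2 rho) <= 1 + rho of the ground state costs 2 rho |eta0|. Together the losses take at
    most 5/16 of lam q from the gain lam q / 2. *)
Lemma gap_exponent (N : nat) (eta0 del dl q K0 lam sig : R) : (0 < N)%N ->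
  let th := Num.sqrt (vp * p%:R * (2 * q) ^+ p.-1 + 128 * lam ^+ 2 * K0 ^+ 2) in
  let kap := p%:R ^+ 2 * Num.sqrt dl in
  let rho := 10 / vp * th ^+ 2 in
  let s := sig * N%:R in
  0 < sig -> 0 <= del -> rho <= 1 -> 2 * rho * `|eta0| <= lam * q / 8 -> 4 * del <= lam * q / 16 ->
  6 * kap <= lam * q / 16 ->
  sig * (8 + 2 * p%:R + 3 * p%:R ^+ 2 + 256 * lam ^+ 2 * K0 ^+ 2 + 128 * th ^+ 2 +
     24 * (1 + kap ^+ 2)) <= lam * q / 16 ->
  expR (s ^+ 2 * (4 / N%:R)) * (2 *
    (2 * expR (s ^+ 2 / N%:R * (4 + 2 * p%:R + 3 * p%:R ^+ 2 + 256 * lam ^+ 2 * K0 ^+ 2)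
       - s * (lam * (q / 2))) *
     (replica_cst p N s (eta0 + del) dl th * replica_cst p N s (eta0 + del) dl th))) <=
  1024 * expR (s * (2 * eta0 - lam * q / 8)).
Proof.
move=> N0 th kap rho s sg0 del0 rho1 hrho hdel hkap hsig.
have NR0 : 0 < N%:R :> R by rewrite ltr0n.
have s0 : 0 < s by rewrite mulr_gt0.
rewrite /replica_cst -/kap; set r := Num.sqrt (1 + 20 / vp * th ^+ 2).
have rho0 : 0 <= rho by rewrite mulr_ge0 ?sqr_ge0// divr_ge0// ltW.
have r2 : r ^+ 2 = 1 + 2 * rho.
  have e : 1 + 20 / vp * th ^+ 2 = 1 + 2 * rho by rewrite /rho; ring.
  by rewrite /r e sqr_sqrtr//; lra.
have r0 : 0 <= r by exact: sqrtr_ge0.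
have r_le : r <= 1 + rho.
  by rewrite -(@ler_pXn2r _ 2) ?nnegrE//; [rewrite r2; have := sqr_ge0 rho; lra|lra].
have r_ge : 1 <= r by rewrite -(@ler_pXn2r _ 2) ?nnegrE// r2 expr1n; lra.
have kap0 : 0 <= kap by rewrite mulr_ge0 ?exprn_ge0 ?sqrtr_ge0.
set X := 64 * _ + _ + _ + _; set Y := s ^+ 2 / _ * _ - _.
have -> : expR (s ^+ 2 * (4 / N%:R)) * (2 * (2 * expR Y * (16 * expR X * (16 * expR X)))) =
    1024 * expR (s ^+ 2 * (4 / N%:R) + (Y + (X + X))).
  by rewrite !expRD; ring.
rewrite ler_pM2l; last by rewrite ltr0n.
rewrite ler_expR.
have -> : s ^+ 2 * (4 / N%:R) + (Y + (X + X)) = s * (4 * sig + sig * (4 + 2 * p%:R + 3 * p%:R ^+ 2 +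
   256 * lam ^+ 2 * K0 ^+ 2) - lam * q / 2 + 128 * sig * th ^+ 2 + 6 * sig * r ^+ 2 * (1 + kap ^+ 2)
   + 3 * (r * kap) + 2 * (r * (eta0 + del))).
  by rewrite /X /Y /s; field; rewrite gt_eqF.
rewrite ler_pM2l//.
have h1 : 6 * sig * r ^+ 2 * (1 + kap ^+ 2) <= sig * (24 * (1 + kap ^+ 2)).
  have k1 : 0 <= 1 + kap ^+ 2 by rewrite addr_ge0// sqr_ge0.
  have -> : sig * (24 * (1 + kap ^+ 2)) = 6 * sig * 4 * (1 + kap ^+ 2) by ring.
  by apply: ler_wpM2r => //; apply: ler_wpM2l; [rewrite mulr_ge0// ltW|rewrite r2; lra].
have h2 : 3 * (r * kap) <= 6 * kap by have : r * kap <= 2 * kap by [apply: ler_wpM2r => //; lra]; lra.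
have h3 : 2 * (r * (eta0 + del)) <= 2 * eta0 + 2 * rho * `|eta0| + 4 * del.
  have k1 : (r - 1) * eta0 <= rho * `|eta0|.
    apply: (@le_trans _ _ ((r - 1) * `|eta0|)).
      by apply: ler_wpM2l; [lra|exact: ler_norm].
    by apply: ler_wpM2r => //; lra.
  have k2 : r * del <= 2 * del by apply: ler_wpM2r => //; lra.
  by move: k1 k2; rewrite mulrDr; lra.
move: hsig; rewrite !mulrDr; move: h1 h2 h3 hrho hdel hkap del0; clear; rewrite ?mulrDr; lra.
Qed.

(** All three parameters are powers of one small t: q = c1 t^3, K0 = 1/t, lam = c2 t^5. The gain lam
    q and the penalty cost lam^2 K0^2 are then both of order t^8 and are balanced by constants, the
    decoupling cost q^(p-1) being O(t^9). *)
Lemma gap_parameters (eta0 C : R) : 0 < C -> exists q K0 lam : R,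
  [/\ 0 < q, 4 * q <= 1, 0 < K0, 0 < lam & [/\ K0 ^+ 3 * q = 2 * (C + 1), lam * q <= 1 &
   (2 * `|eta0| + 2) * (10 / vp * (vp * p%:R * (2 * q) ^+ p.-1 + 128 * lam ^+ 2 * K0 ^+ 2)) <=
     lam * q / 8]].
Proof.
move=> C0; pose c1 := 2 * (C + 1); have c10 : 0 < c1 by rewrite /c1; lra.
pose G := (2 * `|eta0| + 2) * (10 / vp).
have G0 : 0 < G by rewrite mulr_gt0 ?divr_gt0//; have := normr_ge0 eta0; lra.
have G2 : 0 < 2048 * G by apply: mulr_gt0; [rewrite ltr0n|exact: G0].
(* Makes the lam^2 K0^2 cost exactly half of the allowance lam q / 8. The term [c3] in the
   denominator of [t] fits the decoupling cost into the other half. *)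
pose c2 := c1 / (2048 * G); have c20 : 0 < c2 by exact: divr_gt0 c10 G2.
have c1E : c1 = c2 * (2048 * G) by rewrite /c2 divfK; [|rewrite gt_eqF].
pose c3 := G * p%:R * 128 * c1 ^+ 2 / c2.
have c30 : 0 <= c3.
  apply: mulr_ge0; last by rewrite invr_ge0; exact: ltW c20.
  apply: mulr_ge0; last exact: sqr_ge0.
  apply: mulr_ge0; last by rewrite ler0n.
  by apply: mulr_ge0; [exact: ltW G0|rewrite ler0n].
pose t := (1 + 4 * c1 + c2 + c3)^-1.
have den : 0 < 1 + 4 * c1 + c2 + c3 by lra.
have t0 : 0 < t by rewrite invr_gt0.
have td : t * (1 + 4 * c1 + c2 + c3) = 1 by rewrite mulVf// gt_eqF.
have t1 : t <= 1 by rewrite invf_le1//; lra.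
have tle (x : R) : x <= 1 + 4 * c1 + c2 + c3 -> t * x <= 1.
  by move=> h; rewrite -[leRHS]td ler_pM2l.
have [b1 b2 b3] : [/\ 4 * c1 <= 1 + 4 * c1 + c2 + c3, c2 <= 1 + 4 * c1 + c2 + c3 &
    c3 <= 1 + 4 * c1 + c2 + c3].
  have gen (x y z : R) : 0 < x -> 0 < y -> 0 <= z -> [/\ 4 * x <= 1 + 4 * x + y + z,
      y <= 1 + 4 * x + y + z & z <= 1 + 4 * x + y + z].
    by clear; move=> *; split; lra.
  exact: gen c10 c20 c30.
have tc1 := tle _ b1; have tc2 := tle _ b2; have tc3 := tle _ b3.
have t3 : t ^+ 3 <= t by rewrite -[leRHS]expr1; apply: ler_wiXn2l => //; exact: ltW.
have t5 : t ^+ 5 <= t by rewrite -[leRHS]expr1; apply: ler_wiXn2l => //; exact: ltW.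
have tp k : 0 < t ^+ k by rewrite exprn_gt0.
have q4 : 4 * (c1 * t ^+ 3) <= 1.
  by apply: le_trans tc1; have := ler_wpM2l (ltW c10) t3; lra.
exists (c1 * t ^+ 3), t^-1, (c2 * t ^+ 5); split.
- by rewrite mulr_gt0.
- exact: q4.
- by rewrite invr_gt0.
- by rewrite mulr_gt0.
split.
- by rewrite exprVn mulrCA mulVf ?mulr1// gt_eqF.
- have h : c2 * t ^+ 5 <= 1 by apply: le_trans tc2; rewrite mulrC ler_pM2r.
  have qp := mulr_gt0 c10 (tp 3); have lp := mulr_gt0 c20 (tp 5).
  apply: mulr_ile1; [exact: ltW lp|exact: ltW qp|exact: h|].
  by move: q4 qp; clear; lra.
set q := c1 * t ^+ 3.
have q20 : 0 <= 2 * q by rewrite mulr_ge0// mulr_ge0// ltW.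
have pw : (2 * q) ^+ p.-1 <= (2 * q) ^+ 3.
  apply: ler_wiXn2l => //; first by rewrite /q; lra.
  by rewrite -ltnS prednK//; exact: leq_trans p_ge4.
have e2 : (c2 * t ^+ 5) ^+ 2 * t^-1 ^+ 2 = c2 ^+ 2 * t ^+ 8.
  by field; rewrite gt_eqF.
rewrite mulrA -/G -(mulrA 128) e2.
apply: (@le_trans _ _ (G * (1 * p%:R * (2 * q) ^+ 3 + 128 * (c2 ^+ 2 * t ^+ 8)))).
  apply: ler_wpM2l; first exact: ltW.
  rewrite lerD2r; apply: ler_pM; rewrite ?mulr_ge0 ?exprn_ge0 ?(ltW vp0)//.
  by apply: ler_wpM2r => //; exact: vp_le1.
have a1 : G * (128 * (c2 ^+ 2 * t ^+ 8)) = c1 * c2 * t ^+ 8 / 16.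
  by rewrite {1}c1E; field.
have a2 : G * (1 * p%:R * (2 * q) ^+ 3) = t * c3 * (c1 * c2 * t ^+ 8 / 16).
  by rewrite /c3 /q; field; rewrite gt_eqF.
rewrite mulrDr a1 a2.
have a3 : 0 <= c1 * c2 * t ^+ 8 / 16.
  apply: mulr_ge0; last by rewrite invr_ge0 ler0n.
  by apply: mulr_ge0; [apply: mulr_ge0; exact: ltW|exact: ltW (tp 8)].
have a4 : c2 * t ^+ 5 * q / 8 = 2 * (c1 * c2 * t ^+ 8 / 16) by rewrite /q; field.
rewrite a4; have := ler_piMl a3 tc3; move: (c1 * c2 * t ^+ 8 / 16) (t * c3) => y1 y2; lra.
Qed.

End Final.

Lemma evb_weaken (R : realType) (F : nat -> R) (B B' : R) : B <= B' -> evb F B -> evb F B'.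
Proof.
move=> BB h eps e0; have [l0 hl] := h eps e0; exists l0 => l ll.
by apply: (le_trans (hl l ll)); rewrite ler_wpM2l// expR_ge0.
Qed.

Theorem theorem1 (R : realType) (p : nat) (D : domain) :
  (4 <= p)%N -> ~~ odd p ->
  forall etaOPT : R, is_eta_opt D p etaOPT ->
  exists (etaOGP nu1 nu2 c : R) (N0 : nat),
    etaOGP < etaOPT /\ 0 < nu1 /\ nu1 < nu2 /\ nu2 < 1 /\ 0 < c /\
    forall d (Omega : measurableType d) (P : probability Omega R)
           (J : forall N : nat, {ffun 'I_p -> 'I_N} -> Omega -> R),
      (forall N, gaussian_disorder P (J N)) ->
      forall N : nat, (N0 <= N)%N ->
        prob_atleast P
          [set w | forall z1 z2 : 'I_N -> R,
             z1 \in Theta R D N -> z2 \in Theta R D N ->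
             etaOGP <= Hamil (fun f => J N f w) z1 ->
             etaOGP <= Hamil (fun f => J N f w) z2 ->
             ~ (nu1 < N%:R^-1 * `|inner z1 z2| < nu2)]
          (1 - expR (- (c * N%:R))).
Proof.
move=> p4 pe eta0 Heta.
have C80 : 0 < C8 :> R by rewrite /C8 mulr_gt0// mulr_gt0 ?exprn_gt0// expR_gt0.
have [q [K0 [lam [q0 q4 K00 lam0 [K3 lq1 hG]]]]] := gap_parameters p4 eta0 C80.
have lq0 : 0 < lam * q by rewrite mulr_gt0.
have p0 : 0 <= p%:R ^+ 2 :> R by exact: sqr_ge0.
have v0 : 0 < p`!%:R^-1 :> R by exact: vp_gt0.
pose th := Num.sqrt (p`!%:R^-1 * p%:R * (2 * q) ^+ p.-1 + 128 * lam ^+ 2 * K0 ^+ 2).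
have th2 : th ^+ 2 = p`!%:R^-1 * p%:R * (2 * q) ^+ p.-1 + 128 * lam ^+ 2 * K0 ^+ 2.
  rewrite sqr_sqrtr//; apply: addr_ge0; last first.
    by apply: mulr_ge0; [apply: mulr_ge0 => //; exact: sqr_ge0|exact: sqr_ge0].
  apply: mulr_ge0; first by apply: mulr_ge0 => //; exact: ltW.
  by apply: exprn_ge0; apply: mulr_ge0 => //; exact: ltW.
pose rho := 10 / p`!%:R^-1 * th ^+ 2.
rewrite -th2 -/rho in hG.
have rho0 : 0 <= rho by apply: mulr_ge0; [rewrite divr_ge0// ltW|exact: sqr_ge0].
have e00 := normr_ge0 eta0; have re0 := mulr_ge0 rho0 e00.
have rho1 : rho <= 1 by move: hG; rewrite mulrDl; lra.
have rhoe : 2 * rho * `|eta0| <= lam * q / 8 by move: hG; rewrite mulrDl; lra.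
(* [del], [w] and [sig] are each sized to use at most lam q / 16 in [gap_exponent]; the divisor of
   [w] comes from 6 p^2 w = 6 kap. *)
pose del := lam * q / 64; have del0 : 0 < del by rewrite divr_gt0.
pose w := lam * q / (96 * p%:R ^+ 2 + 1).
have den0 : 0 < 96 * p%:R ^+ 2 + 1 :> R by lra.
have w0 : 0 < w by rewrite divr_gt0.
have w1 : w <= 1 by rewrite ler_pdivrMr// mul1r; lra.
pose dl := w ^+ 2; have dl0 : 0 < dl by rewrite exprn_gt0.
have dl01 : 0 <= dl <= 1 by rewrite ltW//= exprn_ile1// ltW.
pose kap := p%:R ^+ 2 * Num.sqrt dl.
have kapE : kap = p%:R ^+ 2 * w by rewrite /kap /dl sqrtr_sqr gtr0_norm.
have hk : 6 * kap <= lam * q / 16.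
  rewrite kapE; have e : w * (96 * p%:R ^+ 2 + 1) = lam * q by rewrite divfK// gt_eqF.
  by move: e w0; move: (p%:R ^+ 2) => u; lra.
pose Big := 8 + 2 * p%:R + 3 * p%:R ^+ 2 + 256 * lam ^+ 2 * K0 ^+ 2 + 128 * th ^+ 2 +
     24 * (1 + kap ^+ 2).
have Big0 : 0 < Big.
  have h1 : 0 <= 256 * lam ^+ 2 * K0 ^+ 2.
    by apply: mulr_ge0; [apply: mulr_ge0 => //; exact: sqr_ge0|exact: sqr_ge0].
  have h2 := sqr_ge0 th; have h3 := sqr_ge0 kap; have h4 : 0 <= p%:R :> R by [].
  have gen (x1 x2 x3 x4 x5 : R) : 0 <= x1 -> 0 <= x2 -> 0 <= x3 -> 0 <= x4 -> 0 <= x5 ->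
    0 < 8 + 2 * x5 + 3 * x4 + x1 + 128 * x2 + 24 * (1 + x3) by clear; move=> *; lra.
  exact: gen h1 h2 h3 p0 h4.
pose sig := lam * q / 16 / Big; have sig0 : 0 < sig by rewrite divr_gt0// divr_gt0.
have hsig : sig * Big <= lam * q / 16 by rewrite divfK// gt_eqF.
pose c := sig * (lam * q) / 32; have c0 : 0 < c by rewrite divr_gt0// mulr_gt0.
(* [is_eta_opt] gives a threshold for each probability space and disorder, whereas one threshold
   must serve all. [max_bound] is deterministic, so a single realization suffices; if none exists
   the claim is vacuous. *)
have [N1 HN1] : exists N1 : nat, forall d (Omega : measurableType d) (P : probability Omega R)
    (J : forall N : nat, {ffun 'I_p -> 'I_N} -> Omega -> R), (forall N, gaussian_disorder P (J N)) ->
    forall N, (N1 <= N)%N -> (0 < N)%N -> max_bound p N D (eta0 + del).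
  have [[d [Om [P [J HJ]]]]|none] := pselect (exists d (Omega : measurableType d)
    (P : probability Omega R) (J : forall N : nat, {ffun 'I_p -> 'I_N} -> Omega -> R),
    forall N, gaussian_disorder P (J N)); last first.
    by exists 0%N => d Om P J HJ; case: none; exists d, Om, P, J.
  have h2 : 0 < 1 / 2 :> R by rewrite divr_gt0.
  have [N1 h] := Heta d Om P J HJ del del0 (1 / 2) h2.
  exists N1 => _ _ _ _ _ N hN Npos; have [A [mA [AE PA]]] := h N hN.
  apply: (disorder_max_bound Npos (HJ N) mA).
    by apply: le_trans PA; rewrite lee_fin; lra.
  by move=> om /AE /=; rewrite ler_norml => /andP[_]; lra.
(* Ensures C8 N <= (dl N)^4, so that bounded eighth moments force every squared coordinate below dl
   N. *)
pose N2 := (Num.truncn (C8 / dl ^+ 4 : R)).+1.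
(* Half of the allowed probability goes to the disorder tail; [N3] makes 1024 e^4 e^{-cN} at most
   1/2 for the other half. *)
pose N3 := (Num.truncn (2048 * expR 4 / c)).+1.
(* Two points at this level use s lam q / 16 of the margin s lam q / 8, leaving the factor exp(- s
   lam q / 16) = exp(- 2 c N); one of the two factors exp(- c N) absorbs the constants. *)
exists (eta0 - lam * q / 32), q, (2 * q), c, (N1 + N2 + N3)%N.
split; first by lra.
split; first by [].
split; first by lra.
split; first by lra.
split; first by [].
move=> d Omega P J HJ N hN.
have hN1 : (N1 <= N)%N by apply: leq_trans hN; rewrite -addnA leq_addr.
have hN2 : (N2 <= N)%N by apply: leq_trans hN; rewrite -addnA addnCA leq_addr.
have hN3 : (N3 <= N)%N by apply: leq_trans hN; rewrite leq_addl.
have Npos : (0 < N)%N by exact: leq_trans hN2.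
have NR0 : 0 < N%:R :> R by rewrite ltr0n.
have NR1 : 1 <= N%:R :> R by rewrite ler1n.
have big2 : C8 * N%:R <= (dl * N%:R) ^+ 4.
  have h : C8 / dl ^+ 4 <= N%:R.
    by apply: ltW; apply: lt_le_trans (truncnS_gt _) _; rewrite ler_nat.
  rewrite ler_pdivrMr ?exprn_gt0// in h.
  rewrite exprMn (exprS N%:R) mulrA (mulrC (dl ^+ 4)).
  apply: (@le_trans _ _ (N%:R * dl ^+ 4 * N%:R)); first by rewrite ler_pM2r.
  rewrite ler_pM2l; last by rewrite mulr_gt0// exprn_gt0.
  by rewrite -[leLHS]expr1 ler_weXn2l.
have big3 : 2048 * expR 4 <= expR (c * N%:R).
  have h : 2048 * expR 4 / c <= N%:R.
    by apply: ltW; apply: lt_le_trans (truncnS_gt _) _; rewrite ler_nat.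
  rewrite ler_pdivrMr// in h.
  by apply: (le_trans h); rewrite (mulrC N%:R); apply: le_trans (expR_ge1Dx _); rewrite lerDr.
pose s := sig * N%:R; have s0 : 0 < s by rewrite mulr_gt0.
have Hmax := HN1 d Omega P J HJ N hN1 Npos.
have q21 : 2 * q <= 1 by lra.
have del4 : 4 * del <= lam * q / 16 by rewrite /del; lra.
have HI (I : finType) (a b : I -> 'I_N -> R) : (forall i, Theta R D N (a i)) ->
     (forall i, Theta R D N (b i)) -> (forall i, q <= ov (a i) (b i) <= 2 * q) ->
     evb (fun n => Emax s (pairH p a b) n 0) (1024 * expR (s * (2 * eta0 - lam * q / 8))).
  move=> aT bT oab.
  apply: evb_weaken (pairs_walk_bound p4 pe Npos Hmax dl01 big2 q0 q21 K00 K3 (ltW lam0) s0 aT bT oab).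
  exact: (gap_exponent Npos sig0 (ltW del0) rho1 rhoe del4 hk hsig).
have e0 : 0 < expR (- (c * N%:R)) / 2 by apply: divr_gt0; [exact: expR_gt0|rewrite ltr0n].
have [B [mB PB hB]] := bad_pairs_prob pe (eta0 - lam * q / 32) Npos s0 (ltW q0) e0 HI (HJ N).
exists (~` B); split; first exact: measurableC.
split.
  by move=> om nB z1 z2 /set_mem t1 /set_mem t2 h1 h2; exact: (hB om nB z1 z2 t1 t2 h1 h2).
rewrite probability_setC// EFinB; apply: leeB => //; apply: (le_trans PB).
rewrite lee_fin.
set u := expR (- (c * N%:R)).
have -> : expR 4 * (1024 * expR (s * (2 * eta0 - lam * q / 8))) *
    expR (- (2 * s * (eta0 - lam * q / 32))) = 1024 * expR 4 * (u * u).
  have -> : u * u = expR (s * (2 * eta0 - lam * q / 8)) * expR (- (2 * s * (eta0 - lam * q / 32))).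
    by rewrite /u -!expRD; congr expR; rewrite /c /s; field.
  by ring.
have ue : expR (c * N%:R) * u = 1 by rewrite /u -expRD subrr expR0.
have u0 : 0 < u by exact: expR_gt0.
have := ler_wpM2r (ltW u0) big3; rewrite ue => k.
have := ler_wpM2r (ltW u0) k; rewrite mul1r.
have gen (E y : R) : 2048 * E * y * y <= y -> 1024 * E * (y * y) + y / 2 <= y by clear; lra.
exact: gen.
Qed.
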